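(* Let $p_1,p_2\in[1,\infty)$ satisfy $\underline p_0:=\frac{p_1p_2}{p_1+p_2-1}\ge3$. Assume that $\mathcal P$ has a $p_1$-moment, that the marked point process $\hat{\mathcal P}$ exhibits exponential decay of dependence (EDD), and that the score $\xi$ has a $p_2$-moment. Assume $\operatorname{Var}H_\lambda=\Omega(\lambda^\nu)$ for some $\nu>2/3$. Let $(\hat\xi^{[r]})_{r\in(0,\infty)}$ be a given family of short-range scores and let $Z$ be standard normal. (a) If $\xi$ satisfies exponential probabilistic stabilization for the family $(\hat\xi^{[r]})_{r\in(0,\infty)}$, then $$d_W\Big(\frac{H_\lambda-\mathbb E H_\lambda}{\sqrt{\operatorname{Var}H_\lambda}},Z\Big)=O\big((\log\lambda)^{3d}\lambda^{-1.5\nu+1}\big).$$ (b) If $\xi$ satisfies polynomial probabilistic stabilization with order $\beta$ for the family $(\hat\xi^{[r]})_{r\in(0,\infty)}$, then $$d_W\Big(\frac{H_\lambda-\mathbb E H_\lambda}{\sqrt{\operatorname{Var}H_\lambda}},Z\Big)=O\big(\lambda^{-1.5\nu+1+\tau(\gamma_0,\gamma_2)}\big),$$ where $\underline p_1:=1-2/\underline p_0=1-\frac{2(p_1+p_2-1)}{p_1p_2}$, $\gamma_2=\beta\,\underline p_1$, $\gamma_0=d(2+\underline p_1)$ and $\tau(\gamma_0,\gamma_2)=\frac32\Big(\frac{2\nu d+2\gamma_0}{3d+\gamma_2}\vee\frac{\nu d+2\gamma_0}{3d+\gamma_2-\gamma_0}\Big)$.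
   Context: Notation: $a\vee b=\max$, $a\wedge b=\min$, $\|X\|_p=(\mathbb E|X|^p)^{1/p}$. Asymptotics are as $\lambda\to\infty$; $f(\lambda)=\Omega(g(\lambda))$ means $f\ge c\,g$ for some $c>0$ and all large $\lambda$. $d$ is Euclidean distance, also $d(A,B)=\inf\{d(x,y):x\in A,y\in B\}$; $\operatorname{diam}(A)=\sup\{d(x,y):x,y\in A\}$; $B(x,r)$ is the open ball. $d_W(X_1,X_2)=\sup_h|\mathbb E h(X_1)-\mathbb E h(X_2)|$ over all $h:\mathbb R\to\mathbb R$ with $|h(x)-h(y)|\le|x-y|$; $d_{TV}$ is total variation distance. Setting. $\mathcal P$ is a simple stationary point process on $\mathbb R^d$, $d\ge1$, with intensity $\mu\in(0,\infty)$. $\mathbb M$ is a measurable (mark) space and $\hat{\mathcal P}=\sum_{x\in\mathcal P}\delta_{(x,M_x)}$ is a simple marked point process on $\mathbb R^d\times\mathbb M$ with ground process $\mathcal P$ (each $x\in\mathcal P$ carries exactly one mark $M_x$; marks may depend on each other and on $\mathcal P$). $\mathcal N_{\mathbb R^d\times\mathbb M}$ is the space of locally finite subsets of $\mathbb R^d\times\mathbb M$ with the evaluation $\sigma$-algebra; $\mathcal B(\cdot)$ denotes Borel sets; $\Gamma_\lambda=[-\tfrac12\lambda^{1/d},\tfrac12\lambda^{1/d}]^d$, $\lambda\in(0,\infty)$. A score is a measurable function $\xi:(\mathbb R^d\times\mathbb M)\times\mathcal N_{\mathbb R^d\times\mathbb M}\times\mathcal B(\mathbb R^d)\to\mathbb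 R$, with $\xi((x,m_x),\hat{\mathcal X},A)=0$ when $(x,m_x)\notin\hat{\mathcal X}\cap(A\times\mathbb M)$. $H_\lambda=\sum_{x\in\mathcal P\cap\Gamma_\lambda}\xi((x,M_x),\hat{\mathcal P},\Gamma_\lambda)$. $\mathbb P_x,\mathbb E_x$ denote Palm probability and expectation given a point of $\mathcal P$ at $x$. $\mathcal P$ has a $p_1$-moment if $b_1:=\|\operatorname{card}(\mathcal P\cap\Gamma_1)\|_{p_1}<\infty$. $\xi$ has a $p_2$-moment if $b_2:=\sup_{\lambda\in(0,\infty)}\sup_{x\in\Gamma_\lambda}(\mathbb E_x|\xi((x,M_x),\hat{\mathcal P},\Gamma_\lambda)|^{p_2})^{1/p_2}<\infty$. EDD. $\hat{\mathcal P}$ exhibits exponential decay of dependence if there are constants $\theta_0\in[0,\infty)$, $\theta_1,\theta_2,\theta_3\in(0,\infty)$ such that for all $A,B\in\mathcal B(\mathbb R^d)$ with $d(A,B)\ge\theta_3[\log(\operatorname{diam}(A)\vee\operatorname{diam}(B))\vee1]$, $$d_{TV}\big(\mathcal L(\hat{\mathcal P}|_{A\cup B}),\mathcal L(\hat{\mathcal P}|_A\cup\tilde{\hat{\mathcal P}}|_B)\big)\le\theta_1(\operatorname{diam}(A)^{\theta_0}\vee1)(\operatorname{diam}(B)^{\theta_0}\vee1)e^{-\theta_2d(A,B)},$$ where $\tilde{\hat{\mathcal P}}$ is an independent copy of $\hat{\mathcal P}$, and $\hat{\mathcal P}|_A$ is the restriction to points with ground location in $A$. Short-range scores. For $r\in(0,\infty)$,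 a short-range score (estimator) $\hat\xi^{[r]}$ is a measurable function with the same domain and range as $\xi$ such that for almost all realizations $\hat{\mathcal X}$ of $\hat{\mathcal P}$, all locally finite $\hat{\mathcal Y}\subset(\mathbb R^d\setminus B(x,r))\times\mathbb M$ and all $(x,m_x)\in\hat{\mathcal X}$: $\hat\xi^{[r]}((x,m_x),[\hat{\mathcal X}\cap(B(x,r)\times\mathbb M)]\cup\hat{\mathcal Y},\Gamma_\lambda)=\hat\xi^{[r]}((x,m_x),\hat{\mathcal X}\cap(B(x,r)\times\mathbb M),\Gamma_\lambda)$. Probabilistic stabilization. Put $\varphi^{(Pr)}(r)=\sup_{\lambda\in(0,\infty)}\sup_{x\in\Gamma_\lambda}\mathbb P_x\big(\xi((x,M_x),\hat{\mathcal P},\Gamma_\lambda)\ne\hat\xi^{[r]}((x,M_x),\hat{\mathcal P},\Gamma_\lambda)\big)$. $\xi$ satisfies exponential probabilistic stabilization for the family $(\hat\xi^{[r]})$ if there are positive $C_1,C_2$ with $\varphi^{(Pr)}(r)\le C_1e^{-C_2r}$ for all $r\in(0,\infty)$; it satisfies polynomial probabilistic stabilization with order $\beta>0$ if there is $C>0$ with $\varphi^{(Pr)}(r)\le Cr^{-\beta}$ for all $r\in(0,\infty)$. *)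

(* Defs.v *)
From HB Require Import structures.
From mathcomp Require Import all_boot all_order all_algebra.
From mathcomp Require Import all_classical all_reals all_analysis.
From mathcomp Require Import measurable_realfun.

Set Implicit Arguments.
Unset Strict Implicit.
Unset Printing Implicit Defensive.

Import Order.TTheory GRing.Theory Num.Theory.
Import numFieldNormedType.Exports.

Local Open Scope classical_set_scope.
Local Open Scope ring_scope.

(* The norm inherited from 'rV[R]_d is the sup norm: it is used only through
   the topology (Borel sets) and the notion of bounded set. Distances are
   measured by [edist]. *)
Definition euclid (R : realType) (d : nat) : Type := 'rV[R]_d.

HB.instance Definition _ (R : realType) (d : nat) :=
  NormedModule.on (euclid R d).
HB.instance Definition _ (R : realType) (d : nat) :=
  Pointed.on (euclid R d).

Definition borel_display : measure_display. Proof. by constructor. Qed.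

Section borel.
Variables (R : realType) (d : nat).

Definition borel : set (set (euclid R d)) := <<s [set U | open U] >>.

Let borel0 : borel set0.
Proof. exact: sigma_algebra0. Qed.

Let borelC A : borel A -> borel (~` A).
Proof. exact: sigma_algebraC. Qed.

Let borel_bigcup (F : (set (euclid R d))^nat) :
  (forall i, borel (F i)) -> borel (\bigcup_i F i).
Proof. exact: sigma_algebra_bigcup. Qed.

HB.instance Definition _ := @isMeasurable.Build borel_display (euclid R d)
  borel borel0 borelC borel_bigcup.

End borel.

Section geometry.
Variables (R : realType) (d : nat).
Implicit Types (x y : euclid R d) (A B : set (euclid R d)).

Definition edist x y : R := Num.sqrt (\sum_(i < d) (x 0 i - y 0 i) ^+ 2).

Definition eball x (r : R) : set (euclid R d) := [set y | edist x y < r].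

(* [setdist] and [diam] are only meaningful for nonempty (and, for [diam],
   bounded) arguments. *)
Definition setdist A B : R := inf [set edist x y | x in A & y in B].

Definition diam A : R := sup [set edist x y | x in A & y in A].

Definition Gamma (lam : R) : set (euclid R d) :=
  [set x | forall i : 'I_d, `|x 0 i| <= 2^-1 * lam `^ (d%:R^-1)].

End geometry.
Arguments Gamma {R} d lam.

(* [loc] gives the ground location of a point: it is [fst] for subsets of
   R^d x M, for which boundedness concerns the first component only, and [id]
   for subsets of R^d. *)
Definition locally_finite (R : realType) (d : nat) (T : Type)
    (loc : T -> euclid R d) (X : set T) : Prop :=
  forall B, bounded_set B -> finite_set (X `&` loc @^-1` B).

Record lfset (R : realType) (d : nat) (T : Type) (loc : T -> euclid R d) :=
  LFSet { points :> set T ; lfset_lf : locally_finite loc points }.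

Section lfset_constructions.
Variables (R : realType) (d : nat) (T : Type) (loc : T -> euclid R d).
Implicit Types (X Y : lfset loc) (A : set (euclid R d)).

Lemma locally_finite0 : locally_finite loc set0.
Proof. by move=> B _; rewrite set0I. Qed.

Definition lf0 : lfset loc := LFSet locally_finite0.

Lemma locally_finiteI X A : locally_finite loc (X `&` loc @^-1` A).
Proof.
move=> B bB; rewrite setIAC; apply: finite_setIl; exact: lfset_lf.
Qed.

Definition restr A X : lfset loc := LFSet (@locally_finiteI X A).

Lemma locally_finiteU X Y : locally_finite loc (X `|` Y).
Proof. by move=> B bB; rewrite setIUl finite_setU; split; exact: lfset_lf. Qed.

Definition lfU X Y : lfset loc := LFSet (@locally_finiteU X Y).

End lfset_constructions.

HB.instance Definition _ (R : realType) (d : nat) (T : Type)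
  (loc : T -> euclid R d) := gen_eqMixin (lfset loc).
HB.instance Definition _ (R : realType) (d : nat) (T : Type)
  (loc : T -> euclid R d) := gen_choiceMixin (lfset loc).
HB.instance Definition _ (R : realType) (d : nat) (T : Type)
  (loc : T -> euclid R d) := isPointed.Build (lfset loc) (lf0 loc).

Definition lfset_display : measure_display -> measure_display.
Proof. exact. Qed.

Section evaluation_sigma_algebra.
Variables (R : realType) (d : nat) (dT : measure_display)
  (T : measurableType dT) (loc : T -> euclid R d).

Definition evaluation (C : set T) (X : lfset loc) : \bar R :=
  counting ((X : set T) `&` C).

Definition evaluations : set (set (lfset loc)) :=
  <<s [set evaluation C @^-1` U | C in measurable & U in measurable] >>.

Let evaluations0 : evaluations set0.
Proof. exact: sigma_algebra0. Qed.

Let evaluationsC A : evaluations A -> evaluations (~` A).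
Proof. exact: sigma_algebraC. Qed.

Let evaluations_bigcup (F : (set (lfset loc))^nat) :
  (forall i, evaluations (F i)) -> evaluations (\bigcup_i F i).
Proof. exact: sigma_algebra_bigcup. Qed.

HB.instance Definition _ := @isMeasurable.Build (lfset_display dT) (lfset loc)
  evaluations evaluations0 evaluationsC evaluations_bigcup.

End evaluation_sigma_algebra.

Definition gconf (R : realType) (d : nat) := lfset (@id (euclid R d)).
Definition mconf (R : realType) (d : nat) (M : Type) :=
  lfset (@fst (euclid R d) M).

HB.instance Definition _ (R : realType) (d : nat) :=
  Measurable.on (gconf R d).
HB.instance Definition _ (R : realType) (d : nat) (dM : measure_display)
  (M : measurableType dM) := Measurable.on (mconf R d M).

Section ground.
Variables (R : realType) (d : nat).

Lemma locally_finite_ground (M : Type) (X : mconf R d M) :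
  locally_finite id (fst @` (X : set _)).
Proof.
move=> B bB; rewrite preimage_id.
apply: (@sub_finite_set _ _ (fst @` ((X : set _) `&` fst @^-1` B))).
  by move=> _ [[z Xz <-] Bz]; exists z.
exact/finite_image/lfset_lf.
Qed.

Definition ground (M : Type) (X : mconf R d M) : gconf R d :=
  LFSet (@locally_finite_ground M X).

Lemma locally_finite_shift (t : euclid R d) (X : gconf R d) :
  locally_finite id [set x + t | x in (X : set _)].
Proof.
move=> B bB; rewrite preimage_id.
apply: (@sub_finite_set _ _
  [set x + t | x in (X : set _) `&` id @^-1` [set x | B (x + t)]]).
  by move=> _ [[x Xx <-] Bx]; exists x.
apply/finite_image/lfset_lf; case: bB => M0 [M0r bM].
exists (M0 + `|t|); split; first by rewrite realD ?normr_real.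
move=> m M0m x /= Bx.
have {}Bx : `|x + t| <= m - `|t| by apply: bM => //; rewrite ltrBrDr.
by rewrite -(addrK t x) (le_trans (ler_normB _ _))// -lerBrDr.
Qed.

Definition shift (t : euclid R d) (X : gconf R d) : gconf R d :=
  LFSet (@locally_finite_shift t X).

End ground.

Definition dTV (R : realType) (dT : measure_display) (T : measurableType dT)
    (m1 m2 : set T -> \bar R) : \bar R :=
  ereal_sup [set `|m1 E - m2 E|%E | E in measurable].

Definition dW (R : realType) (d1 d2 : measure_display)
    (T1 : measurableType d1) (T2 : measurableType d2)
    (P1 : probability T1 R) (X1 : T1 -> R)
    (P2 : probability T2 R) (X2 : T2 -> R) : \bar R :=
  ereal_sup [set `|'E_P1[h \o X1] - 'E_P2[h \o X2]|%E
            | h in [set h : R -> R | forall x y, `|h x - h y| <= `|x - y|]].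

Section marked_point_process.
Variables (R : realType) (d : nat) (dM : measure_display)
  (M : measurableType dM) (dO : measure_display) (Omega : measurableType dO)
  (P : probability Omega R) (hP : {RV P >-> mconf R d M}).

(* Points of [hP w] are counted without multiplicity since [hP w] is a set;
   this says that the ground process is simple too. *)
Definition unique_marks : Prop :=
  forall w x m m', (hP w : set _) (x, m) -> (hP w : set _) (x, m') -> m = m'.

Definition stationary : Prop :=
  forall (t : euclid R d) (E : set (gconf R d)), measurable E ->
    P [set w | E (shift t (ground (hP w)))] = P [set w | E (ground (hP w))].

Definition card_in (A : set (euclid R d)) (w : Omega) : \bar R :=
  counting ((ground (hP w) : set _) `&` A).

Definition intensity_measure (A : set (euclid R d)) : \bar R :=
  (\int[P]_w card_in A w)%E.

(* [Gamma d 1] is a unit cube. *)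
Definition has_intensity (mu : R) : Prop :=
  intensity_measure (Gamma d 1) = mu%:E.

Definition point_moment (p1 : R) : Prop :=
  ('N[P]_(p1%:E)[card_in (Gamma d 1)] < +oo)%E.

(* [palm x] is the joint law of (M_x, hP) under the Palm probability P_x: the
   Palm family disintegrates the Campbell measure with respect to the intensity
   measure of the ground process. *)
Definition is_palm (palm : R.-pker (euclid R d) ~> (M * mconf R d M)%type)
    : Prop :=
  forall f : (euclid R d * M) * mconf R d M -> \bar R,
    measurable_fun setT f -> (forall y, 0 <= f y)%E ->
    ((\int[P]_w \esum_(z in (hP w : set _)) f (z, hP w)) =
     \int[intensity_measure]_x \int[palm x]_y f ((x, y.1), y.2))%E.

(* Exponential decay of dependence. The law of the union of the restriction to
   A and of an independent copy restricted to B is realised on Omega * Omega.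
   For nonempty A and B, an infinite diameter makes the separation condition
   fail; if A or B is empty the two laws coincide. Hence the condition only
   concerns nonempty bounded sets. *)
Definition EDD : Prop :=
  exists th0 th1 th2 th3 : R,
    [/\ 0 <= th0, 0 < th1, 0 < th2, 0 < th3 &
      forall A B : set (euclid R d), measurable A -> measurable B ->
        A !=set0 -> B !=set0 -> bounded_set A -> bounded_set B ->
        th3 * Num.max (ln (Num.max (diam A) (diam B))) 1 <= setdist A B ->
        (dTV (pushforward P (fun w => restr (A `|` B) (hP w)))
             (pushforward (P \x P)
                (fun w => lfU (restr A (hP w.1)) (restr B (hP w.2)))) <=
         (th1 * Num.max (diam A `^ th0) 1 * Num.max (diam B `^ th0) 1
              * expR (- th2 * setdist A B))%:E)%E].

Definition score_fun : Type :=
  euclid R d * M -> mconf R d M -> set (euclid R d) -> R.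

Definition measurable_score (xi : score_fun) : Prop :=
  forall A : set (euclid R d), measurable A ->
    measurable_fun setT
      (fun zX : (euclid R d * M) * mconf R d M => xi zX.1 zX.2 A).

Definition is_score (xi : score_fun) : Prop :=
  measurable_score xi /\
  forall z (X : mconf R d M) A, measurable A ->
    ~ ((X : set _) z /\ A z.1) -> xi z X A = 0.

Definition H (xi : score_fun) (lam : R) (w : Omega) : R :=
  \sum_(z \in (hP w : set _) `&` fst @^-1` Gamma d lam)
    xi z (hP w) (Gamma d lam).

Definition short_range (r : R) (xih : score_fun) : Prop :=
  measurable_score xih /\
  forall lam, 0 < lam ->
    {ae P, forall w, forall (z : euclid R d * M) (Y : mconf R d M),
      (hP w : set _) z ->
      (Y : set _) `<=` fst @^-1` (~` eball z.1 r) ->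
      xih z (lfU (restr (eball z.1 r) (hP w)) Y) (Gamma d lam) =
      xih z (restr (eball z.1 r) (hP w)) (Gamma d lam)}.

Section palm_conditions.
Variable palm : R.-pker (euclid R d) ~> (M * mconf R d M)%type.

Definition score_moment (xi : score_fun) (p2 : R) : Prop :=
  (ereal_sup [set e | exists (lam : R) (x : euclid R d),
     [/\ (0 < lam)%R, Gamma d lam x &
      e = 'N[palm x]_(p2%:E)
            [(fun y => (xi (x, y.1) y.2 (Gamma d lam))%:E)]]]
   < +oo)%E.

Definition phiPr (xi : score_fun) (xih : R -> score_fun) (r : R) : \bar R :=
  ereal_sup [set e | exists (lam : R) (x : euclid R d),
    [/\ 0 < lam, Gamma d lam x &
     e = palm x [set y | xi (x, y.1) y.2 (Gamma d lam) <>
                         xih r (x, y.1) y.2 (Gamma d lam)]]].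

Definition exp_stabilization (xi : score_fun) (xih : R -> score_fun) : Prop :=
  exists C1 C2 : R, [/\ 0 < C1, 0 < C2 & forall r, 0 < r ->
    (phiPr xi xih r <= (C1 * expR (- C2 * r))%:E)%E].

Definition poly_stabilization (xi : score_fun) (xih : R -> score_fun)
    (beta : R) : Prop :=
  exists2 C : R, 0 < C & forall r, 0 < r ->
    (phiPr xi xih r <= (C * r `^ (- beta))%:E)%E.

End palm_conditions.

Definition variance_lower_bound (xi : score_fun) (nu : R) : Prop :=
  exists2 c : R, 0 < c &
    \forall lam \near +oo, ((c * lam `^ nu)%:E <= 'V_P[H xi lam])%E.

Definition normalized_H (xi : score_fun) (lam : R) (w : Omega) : R :=
  (H xi lam w - fine 'E_P[H xi lam]) / Num.sqrt (fine 'V_P[H xi lam]).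

End marked_point_process.

Section exponents.
Variable R : realType.

Definition p0 (p1 p2 : R) : R := p1 * p2 / (p1 + p2 - 1).

Definition p1bar (p1 p2 : R) : R := 1 - 2 / p0 p1 p2.

Definition gamma2 (beta p1 p2 : R) : R := beta * p1bar p1 p2.

Definition gamma0 (d : nat) (p1 p2 : R) : R := d%:R * (2 + p1bar p1 p2).

Definition tau (d : nat) (nu g0 g2 : R) : R :=
  3 / 2 * Num.max ((2 * nu * d%:R + 2 * g0) / (3 * d%:R + g2))
                  ((nu * d%:R + 2 * g0) / (3 * d%:R + g2 - g0)).

End exponents.

(* Main.v *)
Require Import Defs.
From mathcomp Require Import all_boot all_order all_algebra.
From mathcomp Require Import all_classical all_reals all_analysis.
From mathcomp Require Import measurable_realfun.
From mathcomp Require Import ring lra.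

(* Stein's method with dependency neighbourhoods. Cut [Gamma d lam] into unit
   cubes and write [H] as the sum of the contributions [X_k] of the cubes. Replace
   [X_k] by [Y_k], the sum of the short-range scores over the cube, computed from
   the points at distance at most [1 + r] from it and truncated at the level
   [T = eps `^ (- 1 / p0)], where [eps] dominates [mu] times the probability that
   the two scores differ. By Campbell's formula and Young's inequality
   [E |X_k| `^ p0] is bounded, and [Y_k] is the truncation of [X_k] up to
   probability [eps]; hence [E (X_k - Y_k)^2 = O(eps `^ (1 - 2 / p0))] while
   [E |Y_k|^3 = O(1)]. As soon as [r] is a large multiple of [ln lam], exponential
   decay of dependence makes [Y_k] and the [Y_j] with [|j - k| >> r] independent up
   to an arbitrary negative power of [lam], so that with [sigma^2 = Var H] the
   distance to the normal law is of order
     lam eps `^ ((1 - 2 / p0) / 2) / sigma + lam r^(2 d) / sigma^3.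
   In (a) take [r ~ ln lam] and [eps] a large negative power of [lam]; in (b) take
   [r = lam `^ (tau / (2 d))] and [eps ~ r `^ (- beta)]. *)

Set Implicit Arguments.
Unset Strict Implicit.
Unset Printing Implicit Defensive.

Import Order.TTheory GRing.Theory Num.Theory.
Import numFieldNormedType.Exports.

Local Open Scope classical_set_scope.
Local Open Scope ring_scope.

(** * Stein's equation *)

Section comparison.
Variable R : realType.
Implicit Types (f g k : R -> R) (x y : R).

(** Total variation only controls bounded functionals, while the scores merely have moments; this
    forces the truncation. The price is that each covariance bound carries the size [T / sigma] of
    the blocks, a power of [lam] that the exponential decay must absorb. The level [T] equates the
    two truncation losses, [T^(2 - p0)] from the moment and [T^2 eps] from the exceptional event;
    [p0 >= 3] then keeps third moments bounded. Distant blocks are only nearly independent, so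
    Stein's expansion around two nested neighbourhoods carries a defect [kap], multiplied by the
    square of the number of blocks. The factor [r^(2 d)] is the square of the number of cubes in a
    neighbourhood. The truncated sum does not have variance one; its defect is charged to the
    truncation error. Test functions are only Lipschitz, so Stein's solution has no second
    derivative to bound: the Lipschitz property of its derivative is extracted from difference
    quotients. In (b) everything reduces to [nu <= tau + tau beta (1 - 2/p0) / (4 d)], which rests
    on an a priori upper bound for [nu]. *)

Definition gauss (x : R) : R := expR (- (x ^+ 2 / 2)).

Lemma is_derive_gauss x : is_derive x 1 gauss (- x * gauss x).
Proof.
rewrite /gauss; apply: is_derive_eq.
rewrite /GRing.scale /=; lra.
Qed.

Lemma gauss_gt0 x : 0 < gauss x.
Proof. exact: expR_gt0. Qed.

Lemma gaussN x : gauss (- x) = gauss x.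
Proof. by rewrite /gauss sqrrN. Qed.

Lemma gauss_le1 x : gauss x <= 1.
Proof. by rewrite -[leRHS]expR0 ler_expR; have := sqr_ge0 x; lra. Qed.

Lemma gauss_ge_half x : `|x| <= 1 -> 1 / 2 <= gauss x.
Proof.
rewrite ler_norml => /andP[x1 x2]; apply: le_trans (expR_ge1Dx _).
have : x ^+ 2 <= 1 by nra.
lra.
Qed.

Lemma mulr_gauss_le x : 0 < x -> gauss x <= 2 / x.
Proof.
move=> x0; rewrite ler_pdivlMr//.
have h1 := expR_ge1Dx (x ^+ 2 / 2).
have h2 : gauss x * expR (x ^+ 2 / 2) = 1 by rewrite -expRD addNr expR0.
have := gauss_gt0 x; nra.
Qed.

Lemma derivable_within (f df : R -> R) (A : set R) :
  (forall x, is_derive x 1 f (df x)) -> {within A, continuous f}.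
Proof.
move=> h; apply: continuous_subspaceT => x.
by apply/differentiable_continuous/derivable1_diffP; apply: ex_derive.
Qed.

(* [psi - G] and [psi + G] are nonincreasing, with nonnegative limit at infinity. *)
Lemma comparison_at_infty (G dG psi dpsi : R -> R) :
  (forall x, is_derive x 1 G (dG x)) ->
  (forall x, 1 <= x -> is_derive x 1 psi (dpsi x)) ->
  (forall x, 1 <= x -> 0 <= psi x) ->
  (forall x, 1 <= x -> `|dG x| <= - dpsi x) ->
  (forall e N : R, 0 < e -> exists2 y, N <= y & `|G y| <= e) ->
  forall x, 1 <= x -> `|G x| <= psi x.
Proof.
move=> hG hpsi psi0 hd hlim x x1.
apply/ler_addgt0Pr => e e0.
have [y xy Gy] := hlim e x e0.
suff : `|G y - G x| <= psi x - psi y.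
  have := psi0 y (le_trans x1 xy).
  rewrite !ler_norml in Gy *; lra.
have key (s : R) : `|s| = 1 -> psi y + s * G y <= psi x + s * G x.
  move=> s1.
  pose D (t : R) := psi t + s * G t.
  have hD (t : R) : 1 <= t -> is_derive t 1 D (dpsi t + s * dG t).
    by move=> t1; have := hpsi t t1 => ?; have := hG t => ?; apply: is_derive_eq.
  have [||c cxy] := @MVT_segment _ D (fun t => dpsi t + s * dG t) x y xy.
  - by move=> t; rewrite in_itv/= => /andP[xt _]; apply: hD; lra.
  - apply: derivable_within_continuous => t; rewrite in_itv/= => /andP[xt _].
    by have /hD ? : 1 <= t by lra.
  move: cxy; rewrite in_itv/= => /andP[xc cy] E.
  have c1 : 1 <= c by lra.
  have : s * dG c <= - dpsi c.
    by apply: le_trans (hd c c1); rewrite -[leRHS]mul1r -s1 -normrM ler_norm.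
  rewrite /D in E; nra.
have := key 1 (normr1 R); have := key (-1) (normrN1 R).
rewrite ler_norml; lra.
Qed.

(** Smallness is only asked at some arbitrarily large points: by the monotonicity behind
    [comparison_at_infty], one such point for each [e] and [N] is enough. *)
Definition vanishing (G : R -> R) :=
  forall e N : R, 0 < e -> exists2 y, N <= y & `|G y| <= e.

Section ode.
Variables (g k : R -> R).
Hypothesis hg : forall x, is_derive x 1 g (k x + x * g x).

(** [gauss] is the integrating factor of [g' = k + x g]: it removes the term [x g] and leaves a pure
    integration problem. *)
Lemma is_derive_gaussM x : is_derive x 1 (fun x => gauss x * g x) (gauss x * k x).
Proof.
have ? := is_derive_gauss x; have ? := hg x.
by apply: is_derive_eq; rewrite /GRing.scale/=; lra.
Qed.

Hypothesis g0 : vanishing (fun x => gauss x * g x).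

(** The majorant is [A gauss], whose derivative [- A x gauss] matches a right-hand side of linear
    growth; dividing by [gauss] leaves the constant [A]. *)
Lemma ode_bound_linear (A : R) : (forall x, 1 <= x -> `|k x| <= A * x) ->
  forall x, 1 <= x -> `|g x| <= A.
Proof.
move=> hk x x1.
have A0 : 0 <= A.
  by have := hk 1 (lexx _); rewrite mulr1; apply: le_trans.
have := @comparison_at_infty _ _ (fun x => A * gauss x)
  (fun x => A * (- x * gauss x)) is_derive_gaussM _ _ _ g0 x x1.
rewrite normrM (gtr0_norm (gauss_gt0 x)) [leRHS]mulrC ler_pM2l ?gauss_gt0//.
apply.
- by move=> y _; have ? := is_derive_gauss y; apply: is_derive_eq.
- by move=> y _; rewrite mulr_ge0// ltW// gauss_gt0.
- move=> y y1; rewrite normrM (gtr0_norm (gauss_gt0 y)).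
  have := hk y y1; have := gauss_gt0 y; nra.
Qed.

(** Mills-ratio majorant [K gauss / x], with derivative [- K gauss - K gauss / x^2]; its factor
    [1 / x] is what turns into a bound on [x g]. *)
Lemma ode_bound_cst (K : R) : (forall x, 1 <= x -> `|k x| <= K) ->
  forall x, 1 <= x -> `|x * g x| <= K.
Proof.
move=> hk x x1.
have K0 : 0 <= K by have := hk 1 (lexx _); apply: le_trans.
have x0 : 0 < x by lra.
have := @comparison_at_infty _ _ (fun x => K * (gauss x * x^-1))
  (fun x => K * (- gauss x - gauss x * (x^-1 * x^-1))) is_derive_gaussM _ _ _ g0 x x1.
rewrite !normrM (gtr0_norm (gauss_gt0 x)) mulrCA ler_pM2l ?gauss_gt0//.
rewrite (ger0_norm (ltW x0)) [x * _]mulrC => hh; rewrite -ler_pdivlMr//; apply: hh.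
- move=> y y1; have y0 : y != 0 by lra.
  have ? := is_derive_gauss y.
  have ? := @is_deriveV R id y 1 1 y0 (is_derive_id _ _).
  apply: is_derive_eq; rewrite /GRing.scale/=.
  by field.
- move=> y y1; rewrite !mulr_ge0// ?invr_ge0 ?ltW ?gauss_gt0//; lra.
- move=> y y1; rewrite normrM (gtr0_norm (gauss_gt0 y)).
  have := hk y y1; have := gauss_gt0 y => p0 kK.
  have : 0 <= y^-1 * y^-1 by rewrite mulr_ge0// invr_ge0; lra.
  set z := _ * _ => z0.
  have : gauss y * `|k y| <= gauss y * K by rewrite ler_pM2l.
  have : 0 <= K * (gauss y * z) by rewrite mulr_ge0// mulr_ge0// ltW.
  lra.
Qed.

(** The mean value theorem on [[x, 1]], of length at most 2, gives the term [2 B]; the outer factor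
    2 comes from [gauss >= 1/2] near the origin. *)
Lemma ode_bound_near0 (A B : R) : (forall x, `|x| <= 1 -> `|k x| <= B) ->
  `|g 1| <= A -> forall x, `|x| <= 1 -> `|g x| <= 2 * (A + 2 * B).
Proof.
move=> hk g1 x x1.
have B0 : 0 <= B by have := hk 0; rewrite normr0 => /(_ ler01); apply: le_trans.
have := x1; rewrite ler_norml => /andP[x1' x1''].
have [|||c] := @MVT_segment _ (fun x => gauss x * g x) (fun x => gauss x * k x) x 1.
- lra.
- by move=> t _; exact: is_derive_gaussM.
- exact: derivable_within is_derive_gaussM.
rewrite in_itv/= => /andP[xc c1] E.
have kc : `|gauss c * k c| <= B.
  rewrite normrM (gtr0_norm (gauss_gt0 c)).
  have := hk c; rewrite ler_norml => /(_ _) h.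
  have := gauss_le1 c; have := gauss_gt0 c; have := normr_ge0 (k c).
  have /h : -1 <= c <= 1 by lra.
  by nra.
have : `|gauss x * g x| <= A + 2 * B.
  have -> : gauss x * g x = gauss 1 * g 1 - gauss c * k c * (1 - x) by lra.
  apply: le_trans (ler_normB _ _) _; apply: lerD.
    rewrite normrM (gtr0_norm (gauss_gt0 1)).
    have := gauss_le1 1; have := gauss_gt0 1; have := normr_ge0 (g 1); nra.
  rewrite normrM (ger0_norm (_ : 0 <= 1 - x)); last lra.
  have := normr_ge0 (gauss c * k c); nra.
rewrite normrM (gtr0_norm (gauss_gt0 x)).
have := gauss_ge_half x1; have := normr_ge0 (g x); nra.
Qed.

End ode.

(** Reflection preserves the form of the equation, so that bounds on the positive half-line transfer
    to the negative one. *)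
Lemma ode_opp g k : (forall x, is_derive x 1 g (k x + x * g x)) ->
  forall x, is_derive x 1 (fun x => g (- x)) (- k (- x) + x * g (- x)).
Proof.
move=> hg x; have h := hg (- x).
have := @is_derive1_comp R g (@GRing.opp R) x _ _ h _.
move/(_ (-1)) => /(_ _) h2.
have := is_derive_eq h2; apply.
by rewrite /GRing.scale/=; lra.
Qed.

(** Glues [x >= 1], [x <= -1] and the middle range, whose constant [2 (A + 2 A)] is the largest of
    the three. *)
Lemma ode_bound_linearT g k (A : R) : (forall x, is_derive x 1 g (k x + x * g x)) ->
  vanishing (fun x => gauss x * g x) -> vanishing (fun x => gauss x * g (- x)) ->
  (forall x, `|k x| <= A * Num.max 1 `|x|) -> forall x, `|g x| <= 6 * A.
Proof.
move=> hg gp gm hk.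
have A0 : 0 <= A.
  by have := hk 0; rewrite normr0 (max_l ler01) mulr1; apply: le_trans.
have hp x : 1 <= x -> `|g x| <= A.
  move=> x1; apply: ode_bound_linear x1 => // y y1.
  by have := hk y; rewrite (@ger0_norm _ y) ?max_r//; lra.
have hm x : 1 <= x -> `|g (- x)| <= A.
  move=> x1; apply: (ode_bound_linear (ode_opp hg)) x1 => // y y1.
  by have := hk (- y); rewrite !normrN (@ger0_norm _ y) ?max_r//; lra.
move=> x; have [x1|x1] := leP `|x| 1.
  have := @ode_bound_near0 _ _ hg A A _ (hp _ (lexx _)) x x1.
  have -> : 2 * (A + 2 * A) = 6 * A by lra.
  by apply => y y1; have := hk y; rewrite max_l// mulr1.
suff : `|g x| <= A by lra.
have [x0|x0] := leP 0 x.
  by apply: hp; rewrite ger0_norm// in x1; lra.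
by rewrite -(opprK x); apply: hm; rewrite ltr0_norm// in x1; lra.
Qed.

Lemma ode_bound_cstT g k (K : R) : (forall x, is_derive x 1 g (k x + x * g x)) ->
  vanishing (fun x => gauss x * g x) -> vanishing (fun x => gauss x * g (- x)) ->
  (forall x, `|k x| <= K) -> forall x, `|g x| <= 6 * K /\ `|x * g x| <= 6 * K.
Proof.
move=> hg gp gm hk x.
have K0 : 0 <= K by have := hk 0; apply: le_trans.
have hg1 : `|g x| <= 6 * K.
  apply: (ode_bound_linearT hg) => // y; apply: le_trans (hk y) _.
  by rewrite ler_peMr// le_max lexx.
split => //; have [x1|x1] := leP `|x| 1.
  by rewrite normrM; have := normr_ge0 x; have := normr_ge0 (g x); nra.
suff : `|x * g x| <= K by lra.
have [x0|x0] := leP 0 x.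
  by apply: (ode_bound_cst hg) => //; rewrite ger0_norm// in x1; lra.
have := @ode_bound_cst _ _ (ode_opp hg) gm K _ (- x).
rewrite opprK mulNr normrN; apply; last by rewrite ltr0_norm// in x1; lra.
by move=> y _; rewrite normrN.
Qed.

End comparison.

(** * Integration against the standard normal law *)

Section normal_density.
Variable R : realType.
Local Notation mu := (@lebesgue_measure R).
Local Notation N01 := (@normal_prob R 0 1).

(** Change of variables is available through the Radon-Nikodym derivative; identifying it with the
    explicit density turns normal expectations into Lebesgue integrals. *)
Lemma ae_eq_normal_density :
  ae_eq mu setT (Radon_Nikodym (charge_of_finite_measure N01) mu)
    (fun x => (normal_pdf 0 1 x)%:E).
Proof.
have dom : N01 `<< mu := normal_prob_dominates 0 1.
apply: integral_ae_eq => //=.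
- exact: Radon_Nikodym_integrable.
- by apply/measurable_EFinP; exact: measurable_normal_pdf.
- by move=> E _ mE; rewrite -Radon_Nikodym_integral.
Qed.

Lemma ge0_integral_normal (f : R -> \bar R) : measurable_fun setT f ->
  (forall x, 0 <= f x)%E ->
  (\int[N01]_x f x = \int[mu]_x (f x * (normal_pdf 0 1 x)%:E))%E.
Proof.
move=> mf f0; have dom : N01 `<< mu := normal_prob_dominates 0 1.
rewrite -(Radon_Nikodym_SigmaFinite.change_of_variables dom)//.
apply: ae_eq_integral => //.
- apply: emeasurable_funM => //.
  exact: measurable_int (Radon_Nikodym_SigmaFinite.f_integrable dom).
- apply: emeasurable_funM => //; apply/measurable_EFinP.
  exact: measurable_normal_pdf.
- apply: ae_eqe_mul2l; apply: ae_eq_trans ae_eq_normal_density.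
  exact: ae_eq_Radon_Nikodym_SigmaFinite.
Qed.

Lemma integral_normal (f : R -> \bar R) : N01.-integrable setT f ->
  (\int[N01]_x f x = \int[mu]_x (f x * (normal_pdf 0 1 x)%:E))%E.
Proof.
move=> fi; have dom : N01 `<< mu := normal_prob_dominates 0 1.
have mf := measurable_int _ fi.
rewrite -(Radon_Nikodym_change_of_variables dom)//.
apply: ae_eq_integral => //.
- exact: emeasurable_funM.
- apply: emeasurable_funM => //; apply/measurable_EFinP.
  exact: measurable_normal_pdf.
- exact: ae_eqe_mul2l ae_eq_normal_density.
Qed.

Lemma normal_pdf01E (x : R) : normal_pdf 0 1 x = normal_peak 1 * gauss x.
Proof.
by rewrite normal_pdfE ?oner_eq0// /normal_fun /gauss subr0 expr1n mulNr.
Qed.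

Lemma normal_peak1_gt0 : 0 < @normal_peak R 1.
Proof. exact/normal_peak_gt0/oner_neq0. Qed.

(** Square root of [gauss], proportional to the normal density of variance 2: it stays integrable
    and dominates [gauss] times a quadratic factor. *)
Definition wide_gauss (x : R) : R := expR (- (x ^+ 2 / 4)).

Lemma measurable_wide_gauss : measurable_fun setT wide_gauss.
Proof.
apply: measurableT_comp => //; apply: measurableT_comp => //.
by apply: measurable_funM => //; exact: measurable_funX.
Qed.
#[local] Hint Resolve measurable_wide_gauss : core.

Lemma integrable_wide_gauss : mu.-integrable setT (EFin \o wide_gauss).
Proof.
have s0 : Num.sqrt (2 : R) != 0 by rewrite sqrtr_eq0 -ltNge.
have -> : EFin \o wide_gauss = (fun x => ((normal_peak (Num.sqrt 2))^-1)%:E *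
    (normal_pdf 0 (Num.sqrt 2) x)%:E)%E.
  apply/funext => x /=; rewrite -EFinM normal_pdfE// mulrA mulVf ?mul1r.
    rewrite /normal_fun /wide_gauss subr0 sqr_sqrtr// mulNr.
    by congr (expR (- (_ / _)))%:E; lra.
  by rewrite gt_eqF// normal_peak_gt0.
exact/integrableZl/integrable_normal_pdf.
Qed.

Lemma gauss_wide_gauss x : gauss x = wide_gauss x * wide_gauss x.
Proof. by rewrite /gauss /wide_gauss -expRD; congr expR; lra. Qed.

Lemma wide_gauss_gt0 x : 0 < wide_gauss x. Proof. exact: expR_gt0. Qed.

(** By [1 + t <= exp t] at [t = x^2 / 4], half of the Gaussian decay pays for quadratic growth. *)
Lemma poly_gauss_le (a : R) x : 0 <= a -> a <= 1 + x ^+ 2 / 4 ->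
  a * gauss x <= wide_gauss x.
Proof.
move=> a0 ax; rewrite gauss_wide_gauss.
have : wide_gauss x * expR (x ^+ 2 / 4) = 1 by rewrite -expRD addNr expR0.
have := expR_ge1Dx (x ^+ 2 / 4); have := wide_gauss_gt0 x.
set w := wide_gauss x; set e := expR _ => w0 e1 we.
have : w * a <= w * e by rewrite ler_pM2l//; lra.
nra.
Qed.

Lemma norm_gauss_le x : `|x| * gauss x <= wide_gauss x.
Proof.
apply: poly_gauss_le => //; rewrite -[x ^+ 2]real_normK ?num_real//.
have := sqr_ge0 (1 - `|x| / 2); nra.
Qed.

Lemma sqr_gauss_le x : x ^+ 2 * gauss x <= 4 * wide_gauss x.
Proof.
have := @poly_gauss_le (x ^+ 2 / 4) x; have := sqr_ge0 x; lra.
Qed.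

Lemma gauss_le_wide x : gauss x <= wide_gauss x.
Proof.
by rewrite -[leLHS]mul1r; apply: poly_gauss_le => //; have := sqr_ge0 x; lra.
Qed.

Lemma measurable_gauss : measurable_fun setT (@gauss R).
Proof.
apply: measurableT_comp => //; apply: measurableT_comp => //.
by apply: measurable_funM => //; exact: measurable_funX.
Qed.

Lemma continuous_gauss : continuous (@gauss R).
Proof.
move=> x; apply/differentiable_continuous/derivable1_diffP.
by have ? := is_derive_gauss x.
Qed.

Lemma wide_gauss_dominated (C : R) (q : R -> R) : measurable_fun setT q ->
  (forall x, `|q x| <= C * wide_gauss x) -> mu.-integrable setT (EFin \o q).
Proof.
move=> mq hq.
apply: (@le_integrable _ _ _ mu _ _ _ (fun x => C%:E * (wide_gauss x)%:E)%E) => //.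
- exact/measurable_EFinP.
- move=> x _ /=; rewrite lee_fin; apply: le_trans (hq x) _.
  by rewrite ler_norm.
- exact/integrableZl/integrable_wide_gauss.
Qed.

Definition normal_abs_mean : R := fine (\int[N01]_x `|x|%:E).

Lemma integrable_normal_abs : N01.-integrable setT (EFin \o id).
Proof.
apply/integrableP; split; first exact/measurable_EFinP.
rewrite ge0_integral_normal => [||x]; last by [].
- apply: (@le_lt_trans _ _
    (\int[mu]_x ((normal_peak 1)%:E * (wide_gauss x)%:E)))%E.
    apply: ge0_le_integral => //=.
    + move=> x _; rewrite mule_ge0// lee_fin normal_pdf_ge0//.
    + apply: emeasurable_funM; last first.
        by apply/measurable_EFinP; exact: measurable_normal_pdf.
      by apply/measurable_EFinP; exact: normr_measurable.
    + by apply: emeasurable_funM => //;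
        have /measurable_int := integrable_wide_gauss.
    + move=> x _; rewrite -!EFinM lee_fin normal_pdf01E mulrCA ler_pM2l.
        exact: norm_gauss_le.
      exact: normal_peak1_gt0.
  have /(integrableZl measurableT (normal_peak 1))/integrableP[_] :=
    integrable_wide_gauss.
  apply: le_lt_trans; apply: ge0_le_integral => //=.
  + by move=> x _; rewrite -EFinM lee_fin mulr_ge0// ltW// ?expR_gt0// normal_peak1_gt0.
  + by apply: emeasurable_funM => //;
        have /measurable_int := integrable_wide_gauss.
  + apply/measurable_EFinP; apply: measurableT_comp; first exact: normr_measurable.
    exact: measurable_funM.
  + by move=> x _; rewrite lee_fin ler_norm.
- by apply: measurableT_comp => //; exact/measurable_EFinP.
Qed.

Lemma normal_abs_meanE : (\int[N01]_x `|x|%:E)%E = normal_abs_mean%:E.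
Proof.
rewrite fineK//; have /integrable_abse := integrable_normal_abs.
by move=> /(integrable_fin_num measurableT).
Qed.

Lemma normal_abs_mean_ge0 : 0 <= normal_abs_mean.
Proof. by apply: fine_ge0; apply: integral_ge0 => x _; rewrite lee_fin. Qed.

End normal_density.

(** * Stein solutions for Lipschitz test functions *)

Section stein.
Variable R : realType.
Local Notation mu := (@lebesgue_measure R).
Local Notation N01 := (@normal_prob R 0 1).
Implicit Type h : R -> R.

Definition lipschitz1 h := forall x y, `|h x - h y| <= `|x - y|.

Lemma lipschitz1_continuous h : lipschitz1 h -> continuous h.
Proof.
move=> hl x; apply/cvgrPdist_le => e e0.
near=> y; apply: le_trans (hl x y) _.
near: y; apply: cvgr_dist_le => //; exact: cvg_id.
Unshelve. all: by end_near. Qed.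

Lemma lipschitz1_measurable h : lipschitz1 h -> measurable_fun setT h.
Proof. by move/lipschitz1_continuous/continuous_measurable_fun. Qed.

Lemma lipschitz1_growth h x : lipschitz1 h -> `|h x| <= `|h 0| + `|x|.
Proof.
move=> /(_ x 0); rewrite subr0 => hl.
by rewrite -(subrK (h 0) (h x)) addrC; apply: le_trans (ler_normD _ _) _; lra.
Qed.

Lemma integrable_normal_lipschitz1 h : lipschitz1 h ->
  N01.-integrable setT (EFin \o h).
Proof.
move=> hl; have mh := lipschitz1_measurable hl.
apply: (@le_integrable _ _ _ N01 _ _ _ (fun x => `|h 0|%:E + `|x%:E|)%E) => //.
- exact/measurable_EFinP.
- move=> x _ /=; rewrite lee_fin; apply: le_trans (lipschitz1_growth x hl) _.
  by rewrite ler_norm.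
- apply: (integrableD measurableT).
    exact: (@finite_measure_integrable_cst _ _ _ N01).
  exact: (integrable_abse (integrable_normal_abs R)).
Qed.

Definition normal_mean h : R := fine (\int[N01]_x (h x)%:E).

Lemma normal_meanE h : lipschitz1 h ->
  (\int[N01]_x (h x)%:E)%E = (normal_mean h)%:E.
Proof.
move=> hl; rewrite fineK//.
exact: (integrable_fin_num measurableT (integrable_normal_lipschitz1 hl)).
Qed.

Section lipschitz_test.
Variable h : R -> R.
Hypothesis hl : lipschitz1 h.
Let c := normal_mean h.
Let A := 1 + normal_abs_mean R.
Let hc x := h x - c.
Let q x := hc x * gauss x.

Let A1 : 1 <= A. Proof. by have := normal_abs_mean_ge0 R; rewrite /A; lra. Qed.

Let integrable_cst (r : R) : N01.-integrable setT (EFin \o cst r).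
Proof. exact: (@finite_measure_integrable_cst _ _ _ N01). Qed.

Lemma normal_mean_dist0 : `|hc 0| <= normal_abs_mean R.
Proof.
have ih := integrable_normal_lipschitz1 hl.
have E : (\int[N01]_x ((h 0)%:E - (h x)%:E) = (hc 0)%:E)%E.
  rewrite integralB//; last exact: integrable_cst.
  rewrite integral_cst//= probability_setT mule1.
  by rewrite normal_meanE.
rewrite -lee_fin -normal_abs_meanE -abse_EFin -E.
apply: le_trans (le_abse_integral _ _ _) _ => //.
  by apply: measurable_int (integrableB _ (integrable_cst (h 0)) ih).
apply: ge0_le_integral => //.
- by apply: measurableT_comp => //;
    apply: measurable_int (integrableB _ (integrable_cst (h 0)) ih).
- by apply/measurable_EFinP; exact: normr_measurable.
- by move=> x _; rewrite -EFinB abse_EFin lee_fin; have := hl 0 x; rewrite sub0r normrN.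
Qed.

Lemma centered_growth x : `|hc x| <= A * Num.max 1 `|x|.
Proof.
have h1 : `|hc x| <= `|hc 0| + `|x|.
  have -> : hc x = hc 0 + (h x - h 0) by rewrite /hc; lra.
  by apply: le_trans (ler_normD _ _) _; have := hl x 0; rewrite subr0; lra.
apply: le_trans h1 _; have := normal_mean_dist0; have := normal_abs_mean_ge0 R.
rewrite /A; set m := Num.max _ _ => a0 ha.
have : 1 <= m by rewrite le_max lexx.
have : `|x| <= m by rewrite le_max lexx orbT.
by nra.
Qed.

Let mhc : measurable_fun setT hc.
Proof. by apply: measurable_funB => //; exact: lipschitz1_measurable. Qed.
Let mq : measurable_fun setT q.
Proof. by apply: measurable_funM => //; exact: measurable_gauss. Qed.

Let q_le x : `|q x| <= A * wide_gauss x.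
Proof.
rewrite /q normrM (gtr0_norm (gauss_gt0 x)).
have h1 : Num.max 1 `|x| * gauss x <= wide_gauss x.
  by case: (leP 1 `|x|) => _; [exact: norm_gauss_le|rewrite mul1r; exact: gauss_le_wide].
have := centered_growth x; have := gauss_gt0 x; have := A1.
move=> a1 g0 hx; apply: (@le_trans _ _ (A * Num.max 1 `|x| * gauss x)).
  by rewrite ler_pM2r.
by rewrite -mulrA ler_pM2l//; lra.
Qed.

Let xq_le x : `|x * q x| <= 4 * A * wide_gauss x.
Proof.
rewrite normrM [`|q x|]normrM (gtr0_norm (gauss_gt0 x)).
have h1 : `|x| * Num.max 1 `|x| * gauss x <= 4 * wide_gauss x.
  case: (leP 1 `|x|) => _.
    by rewrite -expr2 real_normK ?num_real//; exact: sqr_gauss_le.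
  by rewrite mulr1; have := norm_gauss_le x; have := wide_gauss_gt0 x; lra.
have := centered_growth x; have := gauss_gt0 x; have := A1; have := normr_ge0 x.
move=> x0 a1 g0 hx.
have : `|x| * (`|hc x| * gauss x) <= `|x| * (A * Num.max 1 `|x| * gauss x).
  by rewrite ler_wpM2l// ler_pM2r.
have : A * (`|x| * Num.max 1 `|x| * gauss x) <= A * (4 * wide_gauss x).
  by rewrite ler_wpM2l//; lra.
by lra.
Qed.

Let iq : mu.-integrable setT (EFin \o q).
Proof. exact: wide_gauss_dominated q_le. Qed.

Let ixq : mu.-integrable setT (EFin \o (fun x => x * q x)).
Proof. by apply: wide_gauss_dominated xq_le; exact: measurable_funM. Qed.

Let intq0 : (\int[mu]_x q x)%R = 0.
Proof.
have ih := integrable_normal_lipschitz1 hl.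
have E : (\int[N01]_x ((h x)%:E - c%:E) = 0)%E.
  rewrite integralB//; last exact: integrable_cst.
  by rewrite integral_cst//= probability_setT mule1 normal_meanE// subee.
have ihc : N01.-integrable setT (fun x => (h x)%:E - c%:E)%E.
  exact: integrableB ih (integrable_cst c).
rewrite (integral_normal ihc) in E; move: E.
under eq_integral => x _ do rewrite normal_pdf01E -EFinB -EFinM mulrCA EFinM.
rewrite integralZl//= => /eqP; rewrite mule_eq0 => /orP[|/eqP].
  by rewrite eqe gt_eqF// normal_peak1_gt0.
by rewrite /Rintegral => ->.
Qed.

Let F x := (\int[mu]_(t in `]-oo, x]) q t)%R.

(** Markov's inequality for the tail: on [D] the factor [|t| / y] is at least 1, and [t q t] is
    integrable, which gives decay of order [1 / y]. *)
Let tail (D : set (measurableTypeR R)) y : measurable D -> 0 < y -> (forall t, D t -> y <= `|t|) ->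
  `| (\int[mu]_(t in D) q t)%R | <= y^-1 * (\int[mu]_t `|t * q t|)%R.
Proof.
move=> mD y0 hD.
have iqD : mu.-integrable D (EFin \o q) by exact: integrableS iq.
apply: le_trans (le_normr_Rintegral _ _) _ => //.
rewrite -RintegralZl//; last exact: integrable_norm ixq.
rewrite Rintegral_mkcond; apply: le_Rintegral => //.
- have := integrable_norm iqD; rewrite (integrable_mkcond _ mD) restrict_EFin.
  exact.
- exact: integrableZl (integrable_norm ixq).
- move=> x _; rewrite patchE; case: ifPn => [/[!inE] Dx|_].
    rewrite ler_pdivlMl// [leRHS]normrM ler_wpM2r//; exact: hD.
  by rewrite mulr_ge0// invr_ge0 ltW.
Qed.

Let X := (\int[mu]_t `|t * q t|)%R.

Let X0 : 0 <= X. Proof. by apply: Rintegral_ge0. Qed.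

Let tail_vanish (G : R -> R) : (forall y, 0 < y -> `|G y| <= y^-1 * X) -> vanishing G.
Proof.
move=> hG e N e0.
pose y := Num.max N ((X + 1) / e).
have y0 : 0 < y by rewrite lt_max divr_gt0 ?orbT// ltr_wpDl// mulr_ge0.
exists y; first by rewrite le_max lexx.
apply: le_trans (hG y y0) _; rewrite mulrC ler_pdivrMr//.
have : (X + 1) / e <= y by rewrite le_max lexx orbT.
rewrite ler_pdivrMr// mulrC; lra.
Qed.

(** As [q] has integral zero, the integral up to [y] is minus the remaining tail; this is where
    centring by the normal mean enters. *)
Let vanish_F : vanishing F.
Proof.
apply: tail_vanish => y y0; rewrite -normrN.
have -> : - F y = (\int[mu]_(t in `]y, +oo[) q t)%R.
  apply/eqP; rewrite eqr_oppLR -addr_eq0 -intq0 /F -Rintegral_setU//=.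
  - by rewrite -itv_bndbnd_setU// set_itvNyy.
  - by rewrite -itv_bndbnd_setU// set_itvNyy.
  - apply/disj_setPS => t []; rewrite /= !in_itv/= andbT => ty yt.
    by have := lt_le_trans yt ty; rewrite ltxx.
apply: tail => // t /=; rewrite in_itv/= andbT => yt.
by rewrite gtr0_norm; lra.
Qed.

Let vanish_FN : vanishing (fun y => F (- y)).
Proof.
apply: tail_vanish => y y0; apply: tail => // t /=; rewrite in_itv/= => yt.
by rewrite ltr0_norm; lra.
Qed.

Let is_derive_F (x : R) : is_derive x 1 F (q x).
Proof.
have := @continuous_FTC1 R q -oo%O x (x + 1).
case=> [|||y|dF F'].
- by rewrite ltrDl.
- exact: integrableS iq.
- exact: ltNyr.
- apply: continuousM; last exact: continuous_gauss.
  apply: continuousB; last exact: cvg_cst.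
  exact: lipschitz1_continuous.
- by apply: DeriveDef; [exact: dF|rewrite -derive1E; exact: F'].
Qed.

(** The classical solution: [exp (x^2 / 2)] times the integral over []-oo, x]] of the centred test
    function against [exp (- t^2 / 2)]. *)
Definition stein_sol x := F x / gauss x.
Definition stein_der x := hc x + x * stein_sol x.

Lemma is_derive_stein_sol (x : R) : is_derive x 1 stein_sol (stein_der x).
Proof.
have g0 : gauss x != 0 by rewrite gt_eqF// gauss_gt0.
have ? := is_derive_F x; have ? := is_derive_gauss x.
have ? := @is_deriveV R (@gauss R) x _ 1 g0 (is_derive_gauss x).
apply: is_derive_eq; rewrite /GRing.scale/= /stein_der /stein_sol /q -/(hc x).
by field.
Qed.

Lemma stein_sol_gauss x : gauss x * stein_sol x = F x.
Proof. by rewrite /stein_sol mulrC divfK// gt_eqF// gauss_gt0. Qed.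

Lemma stein_sol_bound x : `|stein_sol x| <= 6 * A.
Proof.
apply: (ode_bound_linearT is_derive_stein_sol).
- under eq_fun do rewrite stein_sol_gauss; exact: vanish_F.
- under eq_fun => y do rewrite -gaussN stein_sol_gauss; exact: vanish_FN.
- exact: centered_growth.
Qed.

Let B := 6 * A.
Let dq d x := (stein_sol (x + d) - stein_sol x) / d.

Let bounded_vanish (u : R -> R) b : (forall x, `|u x| <= b) ->
  vanishing (fun x => gauss x * u x).
Proof.
move=> hu e N e0; have b0 : 0 <= b by apply: le_trans (hu 0).
pose y := Num.max N ((2 * b + 1) / e).
have y0 : 0 < y by rewrite lt_max divr_gt0 ?orbT// ltr_wpDl// mulr_ge0.
exists y; first by rewrite le_max lexx.
rewrite normrM (gtr0_norm (gauss_gt0 y)).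
apply: (@le_trans _ _ (2 / y * b)).
  by apply: ler_pM => //; [exact/ltW/gauss_gt0|exact: mulr_gauss_le].
rewrite mulrAC ler_pdivrMr//.
have : (2 * b + 1) / e <= y by rewrite le_max lexx orbT.
rewrite ler_pdivrMr// mulrC; lra.
Qed.

(* The quotient [dq d] solves Stein's equation with the bounded right-hand side
   [stein_sol (x + d) + (h (x + d) - h x) / d]. *)
Let dqP d : 0 < d -> forall x, `|dq d x| <= 6 * (B + 1) /\ `|x * dq d x| <= 6 * (B + 1).
Proof.
move=> d0.
pose k x := stein_sol (x + d) + (h (x + d) - h x) / d.
have dqb x : `|dq d x| <= 2 * B / d.
  rewrite /dq normrM (gtr0_norm (_ : 0 < d^-1)) ?invr_gt0// ler_pM2r ?invr_gt0//.
  apply: le_trans (ler_normB _ _) _.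
  by have := stein_sol_bound x; have := stein_sol_bound (x + d); rewrite /B; lra.
apply: (@ode_bound_cstT _ _ k).
- move=> x.
  have ? : is_derive x 1 (fun x => stein_sol (x + d)) (stein_der (x + d)).
    have hs := is_derive_stein_sol (x + d).
    have := @is_derive1_comp R stein_sol (fun x => x + d) x _ 1 hs _.
    by rewrite mulr1; apply; apply: is_derive_eq; rewrite addr0.
  have ? := is_derive_stein_sol x.
  apply: is_derive_eq; rewrite /GRing.scale/= /k /dq /stein_der /hc.
  by field; rewrite gt_eqF.
- exact: bounded_vanish dqb.
- exact: bounded_vanish (fun x => dqb (- x)).
- move=> x; apply: le_trans (ler_normD _ _) _; apply: lerD.
    exact: stein_sol_bound.
  rewrite normrM (gtr0_norm (_ : 0 < d^-1)) ?invr_gt0// ler_pdivrMr// mul1r.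
  by apply: le_trans (hl _ _) _; rewrite addrC addKr gtr0_norm.
Qed.

Definition stein_cst := 12 * (6 * A + 1).

(** [h] need not be differentiable, so no second derivative is taken: the increment of [stein_der]
    over a step [d] is written with [x * dq d x], the solution and the increment of [h], each
    contributing at most a multiple of [d]. *)
Lemma stein_der_lipschitz x y : `|stein_der x - stein_der y| <= stein_cst * `|x - y|.
Proof.
wlog xy : x y / x < y.
  move=> hw; have [xy|yx|->] := ltgtP x y; first exact: hw.
    by rewrite distrC [`|x - y|]distrC; exact: hw.
  by rewrite !subrr normr0 mulr0.
rewrite distrC [`|x - y|]distrC; pose d := y - x.
have d0 : 0 < d by rewrite subr_gt0.
have -> : y = x + d by rewrite /d; lra.
have -> : stein_der (x + d) - stein_der x =
  d * (x * dq d x) + d * stein_sol (x + d) + (h (x + d) - h x).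
  by rewrite /stein_der /hc /dq; field; rewrite gt_eqF.
have -> : x + d - x = d by lra.
rewrite (gtr0_norm d0).
have h1 : `|d * (x * dq d x)| <= d * (6 * (B + 1)).
  by rewrite normrM (gtr0_norm d0) ler_pM2l//; case: (dqP d0 x).
have h2 : `|d * stein_sol (x + d)| <= d * B.
  by rewrite normrM (gtr0_norm d0) ler_pM2l//; exact: stein_sol_bound.
have h3 : `|h (x + d) - h x| <= d.
  by apply: le_trans (hl _ _) _; rewrite addrC addKr gtr0_norm.
apply: le_trans (ler_normD _ _) _; apply: le_trans (lerD (ler_normD _ _) h3) _.
have : 0 <= d * A by rewrite mulr_ge0//; have := A1; lra.
rewrite /stein_cst -/B /B in h1 h2 *; lra.
Qed.

(** Within distance 1 of [x] there is a point where the derivative equals a difference of two values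
    of the bounded solution; the Lipschitz bound carries this back to [x]. *)
Lemma stein_der_bound x : `|stein_der x| <= 2 * stein_cst.
Proof.
have [|||z] := @MVT_segment _ stein_sol stein_der x (x + 1).
- by rewrite lerDl.
- by move=> t _; exact: is_derive_stein_sol.
- exact: derivable_within is_derive_stein_sol.
rewrite in_itv/= => /andP[xz zx] E.
have h1 := stein_sol_bound x; have h2 := stein_sol_bound (x + 1).
have h3 := stein_der_lipschitz x z.
have h4 : `|x - z| <= 1 by rewrite ler_norml; lra.
have h5 : `|stein_der z| <= 12 * A.
  have -> : stein_der z = stein_sol (x + 1) - stein_sol x by lra.
  by apply: le_trans (ler_normB _ _) _; lra.
have -> : stein_der x = (stein_der x - stein_der z) + stein_der z by lra.
apply: le_trans (ler_normD _ _) _.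
have := A1; rewrite /stein_cst in h3 *; have := normr_ge0 (x - z); nra.
Qed.

End lipschitz_test.

Definition stein_bound : R := 2 * (12 * (6 * (1 + normal_abs_mean R) + 1)).

(* The constant does not depend on the test function. *)
Lemma stein_equation h : lipschitz1 h -> exists f g : R -> R,
  [/\ forall x : R, is_derive x 1 f (g x),
      forall x, `|f x| <= stein_bound,
      forall x, `|g x| <= stein_bound,
      forall x y, `|g x - g y| <= stein_bound * `|x - y| &
      forall x, g x - x * f x = h x - normal_mean h].
Proof.
move=> hl; have a0 := normal_abs_mean_ge0 R.
exists (stein_sol h), (stein_der h); split.
- exact: is_derive_stein_sol.
- by move=> x; apply: le_trans (stein_sol_bound hl x) _; rewrite /stein_bound; lra.
- by move=> x; apply: le_trans (stein_der_bound hl x) _.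
- move=> x y; apply: le_trans (stein_der_lipschitz hl x y) _.
  by rewrite ler_wpM2r// /stein_cst /stein_bound; lra.
- by move=> x; rewrite /stein_der; lra.
Qed.

Lemma stein_bound_ge1 : 1 <= stein_bound.
Proof. by have := normal_abs_mean_ge0 R; rewrite /stein_bound; lra. Qed.

End stein.

(** * Local dependence *)

Section bounded_expectation.
Context {R : realType} {dO : measure_display} {Omega : measurableType dO}.
Variable P : probability Omega R.
Implicit Types f g : Omega -> R.

Definition Ex f : R := (\int[P]_w f w)%R.

Definition L1 f := P.-integrable setT (EFin \o f).

Definition bounded_meas f :=
  measurable_fun setT f /\ exists B, forall w, `|f w| <= B.

Lemma L1_dominated f g : measurable_fun setT f ->
  (forall w, `|f w| <= g w) -> L1 g -> L1 f.
Proof.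
move=> mf fg; apply: le_integrable => //; first exact/measurable_EFinP.
by move=> w _ /=; rewrite lee_fin; apply: le_trans (fg w) (ler_norm _).
Qed.

Lemma L1_cst (r : R) : L1 (cst r).
Proof. exact: finite_measure_integrable_cst. Qed.

Lemma L1_bounded f : bounded_meas f -> L1 f.
Proof. by move=> [mf [B fB]]; apply: L1_dominated (L1_cst B). Qed.
#[local] Hint Resolve L1_cst : core.

Lemma L1D f g : L1 f -> L1 g -> L1 (fun w => f w + g w).
Proof. exact: integrableD. Qed.

Lemma L1B f g : L1 f -> L1 g -> L1 (fun w => f w - g w).
Proof. by move=> hf hg; apply: (@integrableB _ _ _ P setT measurableT _ _ hf hg). Qed.

Lemma L1Z (k : R) f : L1 f -> L1 (fun w => k * f w).
Proof. by move=> hf; have := integrableZl measurableT k hf. Qed.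

Lemma L1_norm f : L1 f -> L1 (fun w => `|f w|).
Proof. exact: integrable_norm. Qed.

Lemma L1_measurable f : L1 f -> measurable_fun setT f.
Proof. by move=> /measurable_int/measurable_EFinP. Qed.

Lemma L1_sum (I : Type) (r : seq I) (p : pred I) (F : I -> Omega -> R) :
  (forall i, L1 (F i)) -> L1 (fun w => \sum_(i <- r | p i) F i w).
Proof.
move=> hF; elim: r => [|i r ih].
  by under [X in L1 X]eq_fun do rewrite big_nil; exact: (L1_cst 0).
under [X in L1 X]eq_fun do rewrite big_cons; case: (p i) => //; exact: L1D.
Qed.

Lemma ExD f g : L1 f -> L1 g -> Ex (fun w => f w + g w) = Ex f + Ex g.
Proof. by move=> hf hg; exact: RintegralD. Qed.

Lemma ExB f g : L1 f -> L1 g -> Ex (fun w => f w - g w) = Ex f - Ex g.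
Proof. by move=> hf hg; exact: RintegralB. Qed.

Lemma ExZ (k : R) f : L1 f -> Ex (fun w => k * f w) = k * Ex f.
Proof. by move=> hf; exact: RintegralZl. Qed.

Lemma Ex_cst (k : R) : Ex (fun=> k) = k.
Proof.
by rewrite /Ex /Rintegral integral_cst//= probability_setT mule1.
Qed.

Lemma Ex_sum (I : Type) (r : seq I) (p : pred I) (F : I -> Omega -> R) :
  (forall i, L1 (F i)) ->
  Ex (fun w => \sum_(i <- r | p i) F i w) = \sum_(i <- r | p i) Ex (F i).
Proof.
move=> hF; elim: r => [|i r ih].
  by rewrite big_nil; under [X in Ex X]eq_fun do rewrite big_nil; exact: Ex_cst.
rewrite big_cons; under [X in Ex X]eq_fun do rewrite big_cons.
by case: (p i) => //; rewrite ExD ?ih//; exact: L1_sum.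
Qed.

Lemma Ex_le f g : L1 f -> L1 g -> (forall w, f w <= g w) -> Ex f <= Ex g.
Proof. by move=> hf hg fg; apply: le_Rintegral. Qed.

Lemma Ex_ge0 f : (forall w, 0 <= f w) -> 0 <= Ex f.
Proof. by move=> f0; apply: Rintegral_ge0. Qed.

Lemma Ex_abs f : L1 f -> `|Ex f| <= Ex (fun w => `|f w|).
Proof. by move=> hf; exact: le_normr_Rintegral. Qed.

Lemma Ex_abs_le f g : L1 f -> L1 g -> (forall w, `|f w| <= g w) -> `|Ex f| <= Ex g.
Proof.
by move=> hf hg fg; apply: le_trans (Ex_abs hf) _; apply: Ex_le => //; exact: L1_norm.
Qed.

Lemma Ex_abs_bound f (B : R) : L1 f -> (forall w, `|f w| <= B) -> `|Ex f| <= B.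
Proof.
move=> hf fB; rewrite -[leRHS]Ex_cst; apply: Ex_abs_le => //; exact: L1_cst.
Qed.

Lemma eq_Ex f g : f =1 g -> Ex f = Ex g.
Proof. by move=> /funext ->. Qed.

Lemma EFin_Ex f : L1 f -> (Ex f)%:E = (\int[P]_w (f w)%:E)%E.
Proof. by move=> hf; rewrite fineK//; exact: integrable_fin_num. Qed.

Lemma bounded_cst (r : R) : bounded_meas (fun=> r).
Proof. by split => //; exists `|r|. Qed.

Lemma boundedD f g : bounded_meas f -> bounded_meas g ->
  bounded_meas (fun w => f w + g w).
Proof.
move=> [mf [A fA]] [mg [B gB]]; split; first exact: measurable_funD.
by exists (A + B) => w; apply: le_trans (ler_normD _ _) (lerD _ _).
Qed.

Lemma boundedN f : bounded_meas f -> bounded_meas (fun w => - f w).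
Proof.
move=> [mf [A fA]]; split; first exact: measurableT_comp.
by exists A => w; rewrite normrN.
Qed.

Lemma boundedB f g : bounded_meas f -> bounded_meas g ->
  bounded_meas (fun w => f w - g w).
Proof. by move=> hf hg; apply: boundedD => //; exact: boundedN. Qed.

Lemma boundedM f g : bounded_meas f -> bounded_meas g ->
  bounded_meas (fun w => f w * g w).
Proof.
move=> [mf [A fA]] [mg [B gB]]; split; first exact: measurable_funM.
by exists (A * B) => w; rewrite normrM ler_pM.
Qed.

Lemma bounded_norm f : bounded_meas f -> bounded_meas (fun w => `|f w|).
Proof.
move=> [mf [A fA]]; split; first exact: measurableT_comp.
by exists A => w; rewrite normr_id.
Qed.

Lemma bounded_sum (I : Type) (r : seq I) (p : pred I) (F : I -> Omega -> R) :
  (forall i, bounded_meas (F i)) ->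
  bounded_meas (fun w => \sum_(i <- r | p i) F i w).
Proof.
move=> hF; elim: r => [|i r ih].
  by under [X in bounded_meas X]eq_fun do rewrite big_nil; exact: bounded_cst.
under [X in bounded_meas X]eq_fun do rewrite big_cons; case: (p i) => //.
exact: boundedD.
Qed.

Lemma bounded_comp (h : R -> R) (B : R) f : measurable_fun setT h ->
  (forall x, `|h x| <= B) -> bounded_meas f -> bounded_meas (fun w => h (f w)).
Proof.
move=> mh hB [mf _]; split; first exact: measurableT_comp.
by exists B.
Qed.

End bounded_expectation.
#[global] Hint Resolve L1_cst : core.

Lemma lipschitz_measurable (R : realType) (C : R) (g : R -> R) :
  (forall x y, `|g x - g y| <= C * `|x - y|) -> measurable_fun setT g.
Proof.
move=> gL; apply: continuous_measurable_fun => x; apply/cvgrPdist_le => e e0.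
near=> y; apply: le_trans (gL x y) _.
have h : `|x - y| <= e / (`|C| + 1).
  near: y; apply: cvgr_dist_le; first exact: cvg_id.
  by rewrite divr_gt0// ltr_wpDl.
have c1 : 0 < `|C| + 1 by rewrite ltr_wpDl.
rewrite ler_pdivlMr// in h; have := normr_ge0 (x - y).
have := ler_norm C; nra.
Unshelve. all: by end_near. Qed.

Lemma derivable_measurable (R : realType) (f g : R -> R) :
  (forall x : R, is_derive x 1 f (g x)) -> measurable_fun setT f.
Proof.
move=> fg; apply: continuous_measurable_fun => x.
by apply/differentiable_continuous/derivable1_diffP; have := fg x => ?.
Qed.

Section dependency_neighbourhoods.
Context {R : realType} {dO : measure_display} {Omega : measurableType dO}.
Variable P : probability Omega R.
Local Notation Ex := (Ex P).
Variables (I : finType) (U : I -> Omega -> R) (N N' : I -> {set I}).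
Variables (a kap C : R) (m : nat).
Hypothesis bU : forall i, bounded_meas (U i).
Hypothesis NN' : forall i, N i \subset N' i.
Hypothesis cN' : forall i, (#|N' i| <= m)%N.
Hypothesis a0 : 0 <= a.
Hypothesis C0 : 0 <= C.
Hypothesis kap0 : 0 <= kap.
Hypothesis U1 : forall i, Ex (fun w => `|U i w|) <= a.
Hypothesis U2 : forall i, Ex (fun w => U i w ^+ 2) <= a ^+ 2.
Hypothesis U3 : forall i, Ex (fun w => `|U i w| ^+ 3) <= a ^+ 3.

Definition total_sum w := \sum_i U i w.
Definition outer_sum (S : {set I}) w := \sum_(j in ~: S) U j w.

(** Approximate independence with defect [kap]: a centred [U i] against the sum outside [N i], then
    a pair [U i * U j] against the sum outside the larger [N' i]. Independence would give
    [kap = 0]. *)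
Hypothesis far_mean : forall i (f : R -> R), measurable_fun setT f ->
  (forall x, `|f x| <= C) ->
  `|Ex (fun w => U i w * f (outer_sum (N i) w))| <= kap.
Hypothesis far_cov : forall i j (g : R -> R), j \in N i ->
  measurable_fun setT g -> (forall x, `|g x| <= C) ->
  `|Ex (fun w => U i w * U j w * g (outer_sum (N' i) w)) -
    Ex (fun w => U i w * U j w) * Ex (fun w => g (outer_sum (N' i) w))| <= kap.
Hypothesis far_pair : forall i j, j \notin N i ->
  `|Ex (fun w => U i w * U j w)| <= kap.

Let W := total_sum.

Let bW : bounded_meas W. Proof. exact: bounded_sum. Qed.
Let bO S : bounded_meas (outer_sum S). Proof. exact: bounded_sum. Qed.
Let bX n i : bounded_meas (fun w => `|U i w| ^+ n).
Proof.
elim: n => [|n ih]; first by under eq_fun do rewrite expr0; exact: bounded_cst.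
by under eq_fun do rewrite exprS; apply: boundedM => //; exact: bounded_norm.
Qed.

(** Third moments control mixed products through [3 x y z <= x^3 + y^3 + z^3], the difference being
    a sum of squares times [(x + y + z) / 2]. *)
Let Ex_triple i j k : Ex (fun w => `|U i w| * `|U j w| * `|U k w|) <= a ^+ 3.
Proof.
pose T w := 3^-1 * (`|U i w| ^+ 3 + `|U j w| ^+ 3 + `|U k w| ^+ 3).
have L3 l : L1 P (fun w => `|U l w| ^+ 3) by exact/L1_bounded/bX.
apply: (@le_trans _ _ (Ex T)).
  apply: Ex_le.
  - by apply: L1_bounded; apply: boundedM; [apply: boundedM|]; exact: bounded_norm.
  - by apply: L1Z; apply: L1D => //; exact: L1D.
  - move=> w; rewrite /T; have := normr_ge0 (U i w); have := normr_ge0 (U j w).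
    have := normr_ge0 (U k w).
    move: `|U i w| `|U j w| `|U k w| => x y z z0 y0 x0.
    have -> : 3^-1 * (x ^+ 3 + y ^+ 3 + z ^+ 3) = x * y * z +
      6^-1 * (x + y + z) * ((x - y) ^+ 2 + (y - z) ^+ 2 + (x - z) ^+ 2) by field.
    by rewrite lerDl !mulr_ge0 ?addr_ge0 ?sqr_ge0.
rewrite /T ExZ; last by apply: L1D => //; exact: L1D.
rewrite ExD//; last exact: L1D.
rewrite ExD//; have := U3 i; have := U3 j; have := U3 k; lra.
Qed.

Let Ex_pair i j : Ex (fun w => `|U i w| * `|U j w|) <= a ^+ 2.
Proof.
pose T w := 2^-1 * (`|U i w| ^+ 2 + `|U j w| ^+ 2).
have L2 l : L1 P (fun w => `|U l w| ^+ 2) by exact/L1_bounded/bX.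
apply: (@le_trans _ _ (Ex T)).
  apply: Ex_le.
  - by apply: L1_bounded; apply: boundedM; exact: bounded_norm.
  - by apply: L1Z; exact: L1D.
  - move=> w; rewrite /T; have := sqr_ge0 (`|U i w| - `|U j w|); nra.
rewrite /T ExZ; last exact: L1D.
rewrite ExD//.
have E2 l : Ex (fun w => `|U l w| ^+ 2) <= a ^+ 2.
  by under eq_Ex do rewrite real_normK ?num_real//; exact: U2.
by have := E2 i; have := E2 j; lra.
Qed.

Let outer_sumE S w : outer_sum S w = W w - \sum_(j in S) U j w.
Proof.
rewrite /W /total_sum (bigID (mem S))/= addrAC subrr add0r.
by apply: eq_bigl => j; rewrite inE.
Qed.

Let card_sum (S : {set I}) (r : R) : 0 <= r -> (#|S| <= m)%N ->
  \sum_(j in S) r <= m%:R * r.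
Proof. by move=> r0 Sm; rewrite sumr_const -[leLHS]mulr_natl ler_wpM2r// ler_nat. Qed.

Let cN i : (#|N i| <= m)%N.
Proof. exact: leq_trans (subset_leq_card (NN' i)) (cN' i). Qed.

Section stein_pair.
Variables f g : R -> R.
Hypothesis fg : forall x : R, is_derive x 1 f (g x).
Hypothesis fC : forall x, `|f x| <= C.
Hypothesis gC : forall x, `|g x| <= C.
Hypothesis gL : forall x y, `|g x - g y| <= C * `|x - y|.

(** A Lipschitz derivative replaces a bounded second derivative. The auxiliary claim expands at both
    ends of the interval, which covers both signs of [v]. *)
Let taylor x v : `|f x - f (x - v) - v * g x| <= C * v ^+ 2.
Proof.
have taylor_pos y u : 0 <= u -> `|f (y + u) - f y - u * g y| <= C * u ^+ 2 /\
    `|f (y + u) - f y - u * g (y + u)| <= C * u ^+ 2.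
  move=> u0; have [||z] := @MVT_segment _ f g y (y + u).
  - by rewrite lerDl.
  - exact: derivable_within fg.
  rewrite in_itv/= => /andP[z1 z2]; rewrite [y + u]addrC addrK addrC => ->.
  have K t : y <= t <= y + u -> `|g z * u - u * g t| <= C * u ^+ 2.
    move=> /andP[t1 t2]; rewrite mulrC -mulrBr normrM (ger0_norm u0).
    have : `|z - t| <= u by rewrite ler_norml; lra.
    have := gL z t; have := normr_ge0 (z - t); move: `|z - t| `|g z - g t| => p q.
    move=> p0 h1 h2; have : C * p <= C * u by rewrite ler_wpM2l.
    move=> h3; have : u * q <= u * (C * u) by rewrite ler_wpM2l//; lra.
    lra.
  by split; apply: K; lra.
have [v0|v0] := leP 0 v.
  by have [_] := taylor_pos (x - v) v v0; rewrite subrK.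
have [|+ _] := taylor_pos x (- v); first lra.
by rewrite sqrrN distrC; congr (`|_| <= _); lra.
Qed.

Let mf : measurable_fun setT f. Proof. exact: derivable_measurable fg. Qed.
Let mg : measurable_fun setT g. Proof. exact: lipschitz_measurable gL. Qed.

Let G := Ex (fun w => g (W w)).
Let n : R := #|I|%:R.
Let mr : R := m%:R.

Let bf (F : Omega -> R) : bounded_meas F -> bounded_meas (fun w => f (F w)).
Proof. exact: bounded_comp. Qed.
Let bg (F : Omega -> R) : bounded_meas F -> bounded_meas (fun w => g (F w)).
Proof. exact: bounded_comp. Qed.

(* [U i * f W] is expanded around the sums outside [N i] and, for the derivative,
   outside [N' i]. *)
Let e1 i := Ex (fun w => U i w * f (outer_sum (N i) w)).
Let V i w := \sum_(j in N i) U j w.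
Let V' i w := \sum_(j in N' i) U j w.
Let e2 i := Ex (fun w => U i w * (f (W w) - f (outer_sum (N i) w) - V i w * g (W w))).
Let e3 i j := Ex (fun w => U i w * U j w * (g (W w) - g (outer_sum (N' i) w))).
Let e4 i j := Ex (fun w => U i w * U j w * g (outer_sum (N' i) w)) -
    Ex (fun w => U i w * U j w) * Ex (fun w => g (outer_sum (N' i) w)).
Let e5 i := Ex (fun w => g (outer_sum (N' i) w)) - G.
Let c i j := Ex (fun w => U i w * U j w).

Let bV i : bounded_meas (V i). Proof. exact: bounded_sum. Qed.
Let bV' i : bounded_meas (V' i). Proof. exact: bounded_sum. Qed.

Ltac bnd := repeat first [apply: boundedB | apply: boundedD | apply: boundedM |
  apply: bounded_norm | apply: bf | apply: bg | exact: bU | exact: bV | exact: bV' |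
  exact: bW | exact: bO | exact: bounded_cst].
Ltac l1 := apply: L1_bounded; bnd.

(** [e1] and [e4] are independence defects, [e2], [e3] and [e5] Taylor remainders. The last summand
    is kept exact: summed over [i] it is the near part of [E W^2] times [E g(W)], to be compared
    with [E g(W)] itself. *)
Let stein_term i : Ex (fun w => U i w * f (W w)) =
  e1 i + e2 i + \sum_(j in N i) (e3 i j + e4 i j + c i j * e5 i) +
  (\sum_(j in N i) c i j) * G.
Proof.
have -> : (fun w => U i w * f (W w)) = (fun w =>
    U i w * f (outer_sum (N i) w) +
    U i w * (f (W w) - f (outer_sum (N i) w) - V i w * g (W w)) +
    \sum_(j in N i) (U i w * U j w * (g (W w) - g (outer_sum (N' i) w)) +
                     U i w * U j w * g (outer_sum (N' i) w))).
  apply/funext => w.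
  under eq_bigr do rewrite -mulrDr subrK -mulrA mulrC -mulrA.
  rewrite -!mulr_suml -/(V i w); lra.
rewrite ExD; [|l1|by apply: L1_sum => j; l1].
rewrite ExD; [|l1|l1].
rewrite Ex_sum; last by move=> j; l1.
rewrite -/(e1 i) -/(e2 i) -[RHS]addrA mulr_suml -big_split/=; congr (_ + _).
apply: eq_bigr => j _; rewrite ExD; [|l1|l1].
by rewrite /e3 /e4 /e5 /c; lra.
Qed.

Let e1_le i : `|e1 i| <= kap. Proof. exact: far_mean. Qed.

Let e2_le i : `|e2 i| <= C * (mr ^+ 2 * a ^+ 3).
Proof.
apply: (@le_trans _ _ (Ex (fun w => C * \sum_(j in N i) \sum_(k in N i)
    (`|U i w| * `|U j w| * `|U k w|)))).
  apply: Ex_abs_le; first l1.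
    by apply: L1Z; apply: L1_sum => j; apply: L1_sum => k; l1.
  move=> w; rewrite normrM.
  apply: (@le_trans _ _ (`|U i w| * (C * `|V i w| ^+ 2))).
    rewrite ler_wpM2l// outer_sumE -/(V i w) real_normK ?num_real//; exact: taylor.
  have hV : `|V i w| ^+ 2 <= (\sum_(j in N i) `|U j w|) ^+ 2.
    by rewrite ler_sqr ?nnegrE ?sumr_ge0//; exact: ler_norm_sum.
  rewrite mulrCA ler_wpM2l//.
  under eq_bigr => j _ do (rewrite -mulr_sumr -mulrA).
  by rewrite -mulr_sumr -mulr_suml -expr2 ler_wpM2l.
rewrite ExZ; last by apply: L1_sum => j; apply: L1_sum => k; l1.
rewrite ler_wpM2l// Ex_sum; last by move=> j; apply: L1_sum => k; l1.
rewrite expr2 -mulrA; apply: le_trans (card_sum _ (cN i)); last first.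
  by rewrite mulr_ge0// exprn_ge0.
apply: ler_sum => j _; rewrite Ex_sum; last by move=> k; l1.
apply: le_trans (card_sum _ (cN i)); last by rewrite exprn_ge0.
by apply: ler_sum => k _; exact: Ex_triple.
Qed.

Let gdist i w : `|g (W w) - g (outer_sum (N' i) w)| <=
  C * \sum_(k in N' i) `|U k w|.
Proof.
apply: le_trans (gL _ _) _; rewrite ler_wpM2l// outer_sumE opprB addrC subrK.
exact: ler_norm_sum.
Qed.

Let e3_le i j : `|e3 i j| <= C * (mr * a ^+ 3).
Proof.
apply: (@le_trans _ _ (Ex (fun w => C * \sum_(k in N' i)
    (`|U i w| * `|U j w| * `|U k w|)))).
  apply: Ex_abs_le; first l1.
    by apply: L1Z; apply: L1_sum => k; l1.
  move=> w; rewrite normrM [`|U i w * _|]normrM -mulr_sumr mulrCA ler_wpM2l//.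
rewrite ExZ; last by apply: L1_sum => k; l1.
rewrite ler_wpM2l// Ex_sum; last by move=> k; l1.
apply: le_trans (card_sum _ (cN' i)); last by rewrite exprn_ge0.
by apply: ler_sum => k _; exact: Ex_triple.
Qed.

Let e5_le i : `|e5 i| <= C * (mr * a).
Proof.
rewrite /e5 /G -ExB; [|l1|l1].
apply: (@le_trans _ _ (Ex (fun w => C * \sum_(k in N' i) `|U k w|))).
  apply: Ex_abs_le; [l1|by apply: L1Z; apply: L1_sum => k; l1|].
  by move=> w; rewrite distrC.
rewrite ExZ; last by apply: L1_sum => k; l1.
rewrite ler_wpM2l// Ex_sum; last by move=> k; l1.
apply: le_trans (card_sum _ (cN' i)) => //.
by apply: ler_sum => k _; exact: U1.
Qed.

Let c_le i j : `|c i j| <= a ^+ 2.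
Proof.
apply: le_trans (Ex_pair i j); apply: Ex_abs_le; [l1|l1|].
by move=> w; rewrite normrM.
Qed.

Lemma dependency_stein_bound :
  `|Ex (fun w => g (W w)) - Ex (fun w => W w * f (W w))| <=
  C * `|Ex (fun w => W w ^+ 2) - 1| + (C + 2) * (n ^+ 2 * kap) +
  3 * C * (n * (mr ^+ 2 * a ^+ 3)).
Proof.
have n0 : 0 <= n by rewrite ler0n.
have mr0 : 0 <= mr by rewrite ler0n.
have sI (r : R) : \sum_(i : I) r = n * r by rewrite sumr_const -mulr_natl.
have nn : n <= n ^+ 2.
  by rewrite /n -natrX ler_nat; case: #|I| => // k; rewrite leq_pmulr.
have E1 : Ex (fun w => W w * f (W w)) = \sum_i Ex (fun w => U i w * f (W w)).
  rewrite -Ex_sum; last by move=> i; l1.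
  by apply: eq_Ex => w; rewrite /W /total_sum mulr_suml.
have E2 : Ex (fun w => W w ^+ 2) = \sum_i \sum_j c i j.
  transitivity (\sum_i Ex (fun w => \sum_j U i w * U j w)); last first.
    by apply: eq_bigr => i _; rewrite Ex_sum// => j; l1.
  rewrite -Ex_sum; last by move=> i; apply: L1_sum => j; l1.
  apply: eq_Ex => w; rewrite expr2 {1}/W /total_sum mulr_suml.
  by apply: eq_bigr => i _; rewrite /W /total_sum mulr_sumr.
(* Pairs outside the neighbourhoods contribute at most [n^2 kap] to [E W^2], so the near covariances
   add up to almost the whole variance. *)
pose far := \sum_i \sum_(j in ~: N i) c i j.
have farE : \sum_i \sum_(j in N i) c i j = Ex (fun w => W w ^+ 2) - far.
  rewrite E2 /far -sumrB; apply: eq_bigr => i _.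
  rewrite [X in X - _](bigID (mem (N i)))/= [X in _ + _ - X](eq_bigl (fun j => j \notin N i)).
    by rewrite addrK.
  by move=> j; rewrite inE.
have far_le : `|far| <= n ^+ 2 * kap.
  rewrite expr2 -mulrA -sI; apply: le_trans (ler_norm_sum _ _ _) _.
  apply: ler_sum => i _; apply: le_trans (ler_norm_sum _ _ _) _.
  rewrite -sI [leRHS](bigID (mem (~: N i)))/= -[leLHS]addr0 lerD//.
    by apply: ler_sum => j; rewrite inE => /far_pair.
  by apply: sumr_ge0.
pose rest := \sum_i (e1 i + e2 i + \sum_(j in N i) (e3 i j + e4 i j + c i j * e5 i)).
have rest_le : `|rest| <= 2 * (n ^+ 2 * kap) + 3 * C * (n * (mr ^+ 2 * a ^+ 3)).
  apply: (@le_trans _ _ (\sum_(i : I) (kap + C * (mr ^+ 2 * a ^+ 3) +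
     (n * kap + mr * (C * (mr * a ^+ 3)) + mr * (a ^+ 2 * (C * (mr * a))))))).
    apply: le_trans (ler_norm_sum _ _ _) _; apply: ler_sum => i _.
    apply: le_trans (ler_normD _ _) _; apply: lerD.
      by apply: le_trans (ler_normD _ _) _; exact: lerD.
    apply: le_trans (ler_norm_sum _ _ _) _.
    apply: (@le_trans _ _ (\sum_(j in N i)
       (kap + (C * (mr * a ^+ 3) + a ^+ 2 * (C * (mr * a)))))).
      apply: ler_sum => j jN; apply: le_trans (ler_normD _ _) _.
      rewrite [leRHS]addrA [kap + _]addrC; apply: lerD.
        by apply: le_trans (ler_normD _ _) _; apply: lerD => //; exact: far_cov.
      by rewrite normrM ler_pM.
    rewrite big_split/= -addrA; apply: lerD.
      rewrite -sI [leRHS](bigID (mem (N i)))/= lerDl; exact: sumr_ge0.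
    rewrite -mulrDr; apply: card_sum => //.
    by rewrite addr_ge0// !mulr_ge0// ?exprn_ge0.
  rewrite sI.
  have : n * kap <= n ^+ 2 * kap by rewrite ler_wpM2r.
  nra.
have -> : Ex (fun w => W w * f (W w)) =
    rest + (Ex (fun w => W w ^+ 2) - far) * G.
  rewrite E1 -farE mulr_suml -big_split/=; apply: eq_bigr => i _.
  exact: stein_term.
have GC : `|G| <= C by apply: Ex_abs_bound; first l1.
rewrite -/G.
have -> : G - (rest + (Ex (fun w => W w ^+ 2) - far) * G) =
  - rest - G * (Ex (fun w => W w ^+ 2) - 1) + G * far by lra.
apply: le_trans (ler_normD _ _) _; rewrite [`|G * far|]normrM.
apply: le_trans (lerD (ler_normB _ _) (lexx _)) _; rewrite normrN normrM.
have : `|G| * `|Ex (fun w => W w ^+ 2) - 1| <= C * `|Ex (fun w => W w ^+ 2) - 1|.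
  by rewrite ler_wpM2r.
have : `|G| * `|far| <= C * (n ^+ 2 * kap) by rewrite ler_pM.
lra.
Qed.

End stein_pair.

Hypothesis C_stein : C = stein_bound R.

Lemma dependency_normal_approx (h : R -> R) : lipschitz1 h ->
  `|Ex (fun w => h (W w)) - normal_mean h| <=
  C * `|Ex (fun w => W w ^+ 2) - 1| + (C + 2) * (#|I|%:R ^+ 2 * kap) +
  3 * C * (#|I|%:R * (m%:R ^+ 2 * a ^+ 3)).
Proof.
move=> hl; have [f [g [fg fC gC gL eq]]] := stein_equation hl.
rewrite -C_stein in fC gC gL.
have := dependency_stein_bound fg fC gC gL; rewrite -/W.
have mf : measurable_fun setT f by exact: derivable_measurable fg.
have mg : measurable_fun setT g by exact: lipschitz_measurable gL.
have [mW [B WB]] := bW.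
have bfW : bounded_meas (fun w => f (W w)) by exact: bounded_comp fC bW.
have bgW : bounded_meas (fun w => g (W w)) by exact: bounded_comp gC bW.
have -> : (fun w => h (W w)) = (fun w => g (W w) - W w * f (W w) + normal_mean h).
  by apply/funext => w; rewrite eq subrK.
rewrite ExD; first last.
- exact: L1_cst.
- by apply: L1_bounded; apply: boundedB => //; exact: boundedM.
rewrite Ex_cst addrK ExB//; first exact: L1_bounded.
by apply: L1_bounded; exact: boundedM.
Qed.

End dependency_neighbourhoods.

(** * Total variation and covariance *)

Section total_variation.
Variable R : realType.

(** The sum counts the positive integers up to [y], capped at [n]: it is the integer part of [y] as
    long as [y <= n]. *)
Lemma staircase_sum n (y : R) : 0 <= y ->
  (y <= n%:R -> y - 1 <= \sum_(k < n) (k.+1%:R <= y)%R%:R <= y) /\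
  (n%:R <= y -> \sum_(k < n) (k.+1%:R <= y)%R%:R = n%:R :> R).
Proof.
move=> y0; elim: n => [|n [ih1 ih2]]; first by rewrite big_ord0; split => //; lra.
rewrite big_ord_recr/= -natr1; split => [yn|yn]; last first.
  by rewrite ih2 ?yn//; lra.
have [yn'|yn'] := leP y n%:R.
  have /negbTE -> : ~~ (n%:R + 1 <= y) by rewrite -ltNge; lra.
  by rewrite addr0; exact: ih1.
rewrite ih2; last by lra.
by have [] := leP (n%:R + 1) y => h; rewrite ?addr0/=; lra.
Qed.

Section comparison_of_laws.
Context {d1 d2 : measure_display} {T1 : measurableType d1} {T2 : measurableType d2}.
Variables (P1 : probability T1 R) (P2 : probability T2 R).
Variables (X1 : T1 -> R) (X2 : T2 -> R) (del : R).
Hypotheses (mX1 : measurable_fun setT X1) (mX2 : measurable_fun setT X2).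
Hypotheses (h1 : forall w, 0 <= X1 w <= 1) (h2 : forall w, 0 <= X2 w <= 1).
Hypothesis close : forall t : R,
  (`|P1 [set w | (t <= X1 w)%R] - P2 [set w | (t <= X2 w)%R]| <= del%:E)%E.

Let measurable_ge (d : measure_display) (T : measurableType d) (X : T -> R) (t : R) :
  measurable_fun setT X -> measurable [set w | t <= X w].
Proof.
move=> mX; have -> : [set w | t <= X w] = X @^-1` `[t, +oo[.
  by apply/seteqP; split => w /=; rewrite in_itv/= andbT.
by rewrite -[X in measurable X]setTI; exact: mX.
Qed.

Let stepP (d : measure_display) (T : measurableType d) (P : probability T R)
    (X : T -> R) n : measurable_fun setT X -> (forall w, 0 <= X w <= 1) ->
  `|Ex P X - n.+1%:R^-1 *
    \sum_(k < n.+1) fine (P [set w | (k.+1%:R / n.+1%:R <= X w)%R])| <= n.+1%:R^-1.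
Proof.
move=> mX hX.
have n0 : 0 < n.+1%:R :> R by rewrite ltr0n.
have LX : L1 P X.
  apply: L1_bounded; split => //; exists 1 => w.
  by have := hX w => /andP[x0 x1]; rewrite ger0_norm.
have L1i (k : nat) : L1 P \1_[set w | k%:R / n.+1%:R <= X w].
  by apply: integrable_indic; exact: measurable_ge.
have -> : \sum_(k < n.+1) fine (P [set w | (k.+1%:R / n.+1%:R <= X w)%R]) =
    Ex P (fun w => \sum_(k < n.+1) \1_[set w | k.+1%:R / n.+1%:R <= X w] w).
  rewrite Ex_sum//; apply: eq_bigr => k _; rewrite /Ex /Rintegral.
  by rewrite integral_indic ?setIT//; exact: measurable_ge.
have Ls : L1 P (fun w => \sum_(k < n.+1) \1_[set w | k.+1%:R / n.+1%:R <= X w] w).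
  exact: L1_sum.
rewrite -ExZ// -ExB//; last exact: L1Z.
apply: Ex_abs_bound; first by apply: L1B => //; exact: L1Z.
move=> w; have /andP[x0 x1] := hX w.
have y0 : 0 <= n.+1%:R * X w by rewrite mulr_ge0// ltW.
have [/(_ _)/andP[|]] := staircase_sum n.+1 y0.
  by rewrite ler_piMr// ltW.
have -> : \sum_(k < n.+1) (k.+1%:R <= n.+1%:R * X w)%R%:R =
   \sum_(k < n.+1) \1_[set w | k.+1%:R / n.+1%:R <= X w] w :> R.
  apply: eq_bigr => k _; rewrite indicE; congr (nat_of_bool _)%:R.
  by apply/idP/idP; rewrite inE/= ler_pdivrMr// [X w * _]mulrC.
move: (\sum_(k < _) _) => s s1 s2 _.
have -> : X w - n.+1%:R^-1 * s = n.+1%:R^-1 * (n.+1%:R * X w - s).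
  by rewrite mulrBr mulKf// gt_eqF.
rewrite normrM (gtr0_norm (_ : 0 < n.+1%:R^-1)) ?invr_gt0//.
by apply: ler_piMr; [rewrite invr_ge0 ltW|rewrite ler_norml; lra].
Qed.

(** Layer-cake argument: up to [1 / n], the mean of a variable with values in [[0, 1]] is the
    average of the [n] probabilities of exceeding [k / n], and these are compared one by one. *)
Lemma Ex_dist_le : `|Ex P1 X1 - Ex P2 X2| <= del.
Proof.
apply/ler_addgt0Pr => e e0.
pose n := Num.truncn (2 / e).
have n0 : 0 < n.+1%:R :> R by rewrite ltr0n.
have ne : n.+1%:R^-1 <= e / 2.
  rewrite -[leRHS]invrK ler_pV2 ?inE ?unitfE ?gt_eqF ?invr_gt0 ?divr_gt0//=.
  by rewrite invf_div; exact/ltW/truncnS_gt.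
have := stepP P1 n mX1 h1; have := stepP P2 n mX2 h2.
set s2 := \sum_(k < _) _; set s1 := \sum_(k < _) _ => b2 b1.
have : `|n.+1%:R^-1 * s1 - n.+1%:R^-1 * s2| <= del.
  rewrite -mulrBr normrM (gtr0_norm (_ : 0 < n.+1%:R^-1)) ?invr_gt0//.
  rewrite ler_pdivrMl// -sumrB; apply: le_trans (ler_norm_sum _ _ _) _.
  have -> : n.+1%:R * del = \sum_(k < n.+1) del.
    by rewrite sumr_const card_ord mulr_natl.
  apply: ler_sum => k _; rewrite -lee_fin -abse_EFin EFinB.
  by rewrite !fineK ?fin_num_measure//; exact: measurable_ge.
have tri (x1 x2 u1 u2 t r : R) : `|x2 - u2| <= t -> `|x1 - u1| <= t ->
    t <= r / 2 -> `|u1 - u2| <= del -> `|x1 - x2| <= del + r.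
  by rewrite !ler_norml; lra.
exact: tri b2 b1 ne.
Qed.

End comparison_of_laws.
End total_variation.

(** * Restrictions of configurations *)

Section restriction.
Context {R : realType} {d : nat} {dM : measure_display} {M : measurableType dM}.
Local Notation E := (euclid R d).
Local Notation conf := (mconf R d M).
Implicit Types (A B : set E) (X Y : conf).

Lemma lfset_eq (T : Type) (loc : T -> E) (X Y : lfset loc) :
  (X : set T) = (Y : set T) -> X = Y.
Proof.
by case: X Y => [X hX] [Y hY] /= XY; subst Y; congr LFSet; exact: Prop_irrelevance.
Qed.

Lemma measurable_evaluation (C : set (E * M)) : measurable C ->
  measurable_fun setT (fun X : conf => evaluation C X).
Proof.
move=> mC _ U mU; rewrite setTI; apply: sub_sigma_algebra.
by exists C => //; exists U.
Qed.

Lemma measurable_restr A : measurable A ->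
  measurable_fun setT (restr A : conf -> conf).
Proof.
move=> mA; apply: measurability => // _ [_ [C mC [U mU <-]] <-].
rewrite setTI.
have -> : restr A @^-1` (evaluation C @^-1` U) =
    (fun X : conf => evaluation (fst @^-1` A `&` C) X) @^-1` U.
  by apply/seteqP; split => X /=; rewrite /evaluation /= setIA.
rewrite -[X in measurable X]setTI; apply: measurable_evaluation => //.
apply: measurableI => //; rewrite -[X in measurable X]setTI.
exact: measurable_fst.
Qed.

Lemma restr_restrU A B X : restr A (restr (A `|` B) X) = restr A X.
Proof.
apply: lfset_eq => /=; apply/seteqP; split => z /=; first by move=> [[]].
by move=> [Xz Az]; split => //; split => //; left.
Qed.

Lemma restr_lfU A B X Y : [disjoint A & B] ->
  restr A (lfU (restr A X) (restr B Y)) = restr A X.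
Proof.
move=> /disj_setPLR AB; apply: lfset_eq => /=; apply/seteqP; split => z /=.
  by move=> [[//|[_ Bz]] Az]; have := AB _ Az.
by move=> [Xz Az]; split => //; left.
Qed.

Lemma lfUC X Y : lfU X Y = lfU Y X.
Proof. by apply: lfset_eq => /=; rewrite setUC. Qed.

End restriction.

Section covariance.
Context {R : realType} {d : nat} {dM : measure_display} {M : measurableType dM}
  {dO : measure_display} {Omega : measurableType dO}.
Variables (P : probability Omega R) (hP : {RV P >-> mconf R d M}).

Lemma Ex_prod (f g : Omega -> R) : bounded_meas f -> bounded_meas g ->
  Ex (P \x P)%E (fun w => f w.1 * g w.2) = Ex P f * Ex P g.
Proof.
move=> bf bg.
have b1 : bounded_meas (fun w : Omega * Omega => f w.1 * g w.2).
  move: bf bg => [mf [a fa]] [mg [b gb]].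
  apply: boundedM; split.
  - exact: measurableT_comp mf measurable_fst.
  - by exists a.
  - exact: measurableT_comp mg measurable_snd.
  - by exists b.
rewrite /Ex /Rintegral -(integral12_prod_meas1 (L1_bounded _ b1)).
rewrite /fubini_F/=.
under eq_integral => x _.
  under eq_integral => y _ do rewrite EFinM.
  rewrite integralZl//; last exact: L1_bounded.
  rewrite -EFin_Ex; last exact: L1_bounded.
  over.
rewrite integralZr//; last exact: L1_bounded.
by rewrite -EFin_Ex//; exact: L1_bounded.
Qed.

(** The affine map [s] sends [[- a b, a b]] onto [[0, 1]], so that superlevel events fall under the
    total variation bound; undoing it costs [2 a b]. Under the product measure the expectation
    factorises, which turns the difference into a covariance. *)
Lemma dTV_covariance (A B : set (euclid R d)) (F G : mconf R d M -> R) (a b del : R) :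
  measurable A -> measurable B -> A `&` B = set0 ->
  measurable_fun setT F -> measurable_fun setT G -> 0 < a -> 0 < b ->
  (forall X, `|F X| <= a) -> (forall X, `|G X| <= b) ->
  (dTV (pushforward P (fun w => restr (A `|` B) (hP w)))
       (pushforward (P \x P)
          (fun w => lfU (restr A (hP w.1)) (restr B (hP w.2)))) <= del%:E)%E ->
  `|Ex P (fun w => F (restr A (hP w)) * G (restr B (hP w))) -
    Ex P (fun w => F (restr A (hP w))) * Ex P (fun w => G (restr B (hP w)))| <=
  2 * (a * b) * del.
Proof.
move=> mA mB AB mF mG a0 b0 Fa Gb hTV.
have mFA : measurable_fun setT (fun X => F (restr A X)).
  exact: measurableT_comp mF (measurable_restr mA).
have mGB : measurable_fun setT (fun X => G (restr B X)).
  exact: measurableT_comp mG (measurable_restr mB).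
pose f w := F (restr A (hP w)); pose g w := G (restr B (hP w)).
have mf : measurable_fun setT f by exact: measurableT_comp mFA _.
have mg : measurable_fun setT g by exact: measurableT_comp mGB _.
have bf : bounded_meas f by split => //; exists a => w; exact: Fa.
have bg : bounded_meas g by split => //; exists b => w; exact: Gb.
have ab0 : 0 < a * b by rewrite mulr_gt0.
pose s (x : R) := (2 * (a * b))^-1 * (x + a * b).
pose Phi X := s (F (restr A X) * G (restr B X)).
have ms : measurable_fun setT s.
  by apply: measurable_funM => //; exact: measurable_funD.
have mPhi : measurable_fun setT Phi.
  by apply: (measurableT_comp ms); exact: measurable_funM.
have sP x : `|x| <= a * b -> 0 <= s x <= 1.
  rewrite ler_norml => /andP[x1 x2]; rewrite /s mulr_ge0 ?invr_ge0/=; [|lra|lra].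
  by rewrite ler_pdivrMl ?mulr1; lra.
have FG X Y : `|F X * G Y| <= a * b by rewrite normrM ler_pM.
have h12 : `|Ex P (fun w => s (f w * g w)) -
    Ex (P \x P)%E (fun w => s (f w.1 * g w.2))| <= del.
  apply: Ex_dist_le.
  - by apply: (measurableT_comp ms); exact: measurable_funM.
  - apply: (measurableT_comp ms); apply: measurable_funM.
      exact: measurableT_comp mf measurable_fst.
    exact: measurableT_comp mg measurable_snd.
  - by move=> w; exact/sP/FG.
  - by move=> w; exact/sP/FG.
  - move=> t; apply: le_trans hTV; apply: ereal_sup_ubound => /=.
    exists [set X | t <= Phi X].
      have -> : [set X | t <= Phi X] = Phi @^-1` `[t, +oo[.
        by apply/seteqP; split => w /=; rewrite in_itv/= andbT.
      by rewrite -[X in measurable X]setTI; exact: mPhi.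
    rewrite /pushforward; congr (`|P _ - (P \x P)%E _|)%E.
      apply/seteqP; split => w /=; rewrite /Phi restr_restrU.
        by rewrite setUC restr_restrU.
      by rewrite setUC restr_restrU.
    (* Disjointness lets each restriction recover its own half of the superposition of the two
       independent configurations. *)
    have dAB : [disjoint A & B] by apply/disj_setPS; rewrite AB.
    apply/seteqP; split => w /=; rewrite /Phi restr_lfU//.
      by rewrite lfUC restr_lfU// disj_set_sym.
    by rewrite lfUC restr_lfU// disj_set_sym.
have bfg1 : bounded_meas (fun w => f w * g w) by exact: boundedM.
have bfg2 : bounded_meas (fun w : Omega * Omega => f w.1 * g w.2).
  apply: boundedM; split.
  - exact: measurableT_comp mf measurable_fst.
  - by exists a => w; exact: Fa.
  - exact: measurableT_comp mg measurable_snd.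
  - by exists b => w; exact: Gb.
have Es (d' : measure_display) (T : measurableType d') (Q : probability T R) u :
    bounded_meas u -> Ex Q (fun w => s (u w)) = (2 * (a * b))^-1 * (Ex Q u + a * b).
  move=> bu; rewrite /s ExZ; last by apply: L1D; [exact: L1_bounded|exact: L1_cst].
  by rewrite ExD ?Ex_cst//; [exact: L1_bounded|exact: L1_cst].
move: h12; rewrite !Es// Ex_prod// -mulrBr.
have -> : Ex P (fun w => f w * g w) + a * b - (Ex P f * Ex P g + a * b) =
  Ex P (fun w => f w * g w) - Ex P f * Ex P g by lra.
by rewrite normrM (gtr0_norm (_ : 0 < (2 * (a * b))^-1)) ?invr_gt0 ?ler_pdivrMl//; lra.
Qed.

End covariance.

(** * Sums over a configuration and Campbell's formula *)

Section point_sums.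
Context {R : realType} {d : nat} {dM : measure_display} {M : measurableType dM}.
Local Notation E := (euclid R d).
Local Notation conf := (mconf R d M).
Implicit Types (C : set E) (X : conf) (f : E * M -> R).

Definition point_sum C f X : R := \sum_(z \in (X : set _) `&` fst @^-1` C) f z.

Lemma counting_seq (T : choiceType) (s : seq T) (D : set T) : uniq s ->
  (forall z, z \in s <-> D z) -> counting D = (size s)%:R%:E :> \bar R.
Proof.
move=> us sD; have DE : D = [set` s] by apply/seteqP; split => z; rewrite /= sD.
rewrite /counting DE; case: asboolP => [_|]; last by case; exact: finite_seq.
congr (_%:R%:E); apply/perm_size/uniq_perm => //.
by move=> z; rewrite in_fset_set; [apply/idP/idP; rewrite inE|exact: finite_seq].
Qed.

Lemma point_sum_seq C X : bounded_set C -> exists s : seq (E * M),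
  [/\ uniq s, forall z, z \in s <-> (X : set _) z /\ C z.1 &
      forall f, point_sum C f X = \sum_(z <- s) f z].
Proof.
move=> bC; have fin := @lfset_lf _ _ _ _ X _ bC.
exists (finmap.enum_fset (fset_set ((X : set _) `&` fst @^-1` C))).
split; first exact: finmap.fset_uniq.
- by move=> z; rewrite in_fset_set// inE.
- by move=> f; rewrite /point_sum fsbig_finite.
Qed.

Lemma evaluation_point_sum C (B : set (E * M)) X : bounded_set C ->
  evaluation (fst @^-1` C `&` B) X = (point_sum C \1_B X)%:E.
Proof.
move=> bC; have [s [us sP ->]] := point_sum_seq X bC.
rewrite /evaluation (@counting_seq _ [seq z <- s | z \in B]) ?filter_uniq//.
  congr EFin; rewrite size_filter -sum1_count natr_sum big_mkcond/=.
  by apply: eq_bigr => z _; rewrite indicE; case: (z \in B).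
move=> z; rewrite mem_filter setIA; split.
  by move=> /andP[/set_mem Bz /sP].
by move=> [/sP -> /mem_set ->].
Qed.

Lemma point_sumD C f g X : bounded_set C ->
  point_sum C (fun z => f z + g z) X = point_sum C f X + point_sum C g X.
Proof. by move=> bC; have [s [_ _ sE]] := point_sum_seq X bC; rewrite !sE big_split. Qed.

Lemma point_sumN C f X : bounded_set C ->
  point_sum C (fun z => - f z) X = - point_sum C f X.
Proof. by move=> bC; have [s [_ _ sE]] := point_sum_seq X bC; rewrite !sE sumrN. Qed.

Lemma point_sumB C f g X : bounded_set C ->
  point_sum C (fun z => f z - g z) X = point_sum C f X - point_sum C g X.
Proof. by move=> bC; rewrite point_sumD// point_sumN. Qed.

Lemma point_sumZ C (k : R) f X : bounded_set C ->
  point_sum C (fun z => k * f z) X = k * point_sum C f X.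
Proof. by move=> bC; have [s [_ _ sE]] := point_sum_seq X bC; rewrite !sE mulr_sumr. Qed.

Lemma point_sum_sum (I : Type) (r : seq I) C (F : I -> E * M -> R) X : bounded_set C ->
  point_sum C (fun z => \sum_(i <- r) F i z) X = \sum_(i <- r) point_sum C (F i) X.
Proof.
move=> bC; have [s [_ _ sE]] := point_sum_seq X bC; rewrite sE exchange_big/=.
by apply: eq_bigr => i _; rewrite sE.
Qed.

Lemma eq_point_sum C f g X : bounded_set C ->
  (forall z, (X : set _) z -> C z.1 -> f z = g z) -> point_sum C f X = point_sum C g X.
Proof.
move=> bC fg; have [s [_ sP sE]] := point_sum_seq X bC; rewrite !sE.
by rewrite !big_seq; apply: eq_bigr => z /sP[]; exact: fg.
Qed.

Lemma point_sum_ge0 C f X : bounded_set C ->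
  (forall z, (X : set _) z -> C z.1 -> 0 <= f z) -> 0 <= point_sum C f X.
Proof.
move=> bC f0; have [s [_ sP sE]] := point_sum_seq X bC; rewrite sE big_seq.
by apply: sumr_ge0 => z /sP[]; exact: f0.
Qed.

Lemma cvg_point_sum C (F : nat -> E * M -> R) f X : bounded_set C ->
  (forall z, F ^~ z @ \oo --> f z) ->
  (fun n => point_sum C (F n) X) @ \oo --> point_sum C f X.
Proof.
move=> bC Ff; have [s [_ _ sE]] := point_sum_seq X bC; rewrite sE.
under eq_fun do rewrite sE.
elim: s {sE} => [|z s ih].
  have -> : (fun n => \sum_(z <- [::]) F n z) = (fun=> 0).
    by apply/funext => n; rewrite big_nil.
  by rewrite big_nil; exact: cvg_cst.
have -> : (fun n => \sum_(y <- z :: s) F n y) =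
    (fun n => F n z + \sum_(y <- s) F n y) by apply/funext => n; rewrite big_cons.
by rewrite big_cons; exact: cvgD.
Qed.

Section measurability.
Variable C : set E.
Hypotheses (mC : measurable C) (bC : bounded_set C).

Let G := [set A : set ((E * M) * conf) | measurable A /\
  measurable_fun setT (fun X => point_sum C (fun z => \1_A (z, X)) X)].

Let measurable_fstC : measurable (fst @^-1` C : set (E * M)).
Proof. by rewrite -[X in measurable X]setTI; exact: measurable_fst. Qed.

Let rectangle (B : set (E * M)) (U : set conf) : measurable B -> measurable U ->
  G (B `*` U).
Proof.
move=> mB mU; split; first exact: measurableX.
have -> : (fun X => point_sum C (fun z => \1_(B `*` U) (z, X)) X) =
    (fun X => \1_U X * fine (evaluation (fst @^-1` C `&` B) X)).
  apply/funext => X; rewrite evaluation_point_sum//= -point_sumZ//.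
  congr point_sum; apply/funext => z.
  rewrite !indicE -natrM mulnb; congr (nat_of_bool _)%:R.
  by rewrite in_setX andbC.
apply: measurable_funM => //; apply: measurableT_comp => //.
exact: measurable_evaluation (measurableI _ _ measurable_fstC mB).
Qed.

(** Dynkin's argument. On a rectangle the sum is the indicator of [U] times an evaluation,
    measurable by the choice of the sigma-algebra; the class [G] is stable under proper differences
    and increasing unions. *)
Lemma measurable_point_sum_indic (A : set ((E * M) * conf)) : measurable A ->
  measurable_fun setT (fun X => point_sum C (fun z => \1_A (z, X)) X).
Proof.
move=> mA; suff: G A by case.
move: A mA; rewrite measurable_prod_measurableType.
set S := [set A1 `*` A2 | A1 in measurable & A2 in measurable].
have SI : setI_closed S.
  move=> X Y [X1 mX1 [X2 mX2 <-{X}]] [Y1 mY1 [Y2 mY2 <-{Y}]].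
  exists (X1 `&` Y1); first exact: measurableI.
  by exists (X2 `&` Y2); [exact: measurableI|rewrite setXI].
have SG : S `<=` G by move=> _ [B mB [U mU <-]]; exact: rectangle.
suff ls : lambda_system setT G by exact: lambda_system_subset.
split => //.
- by rewrite -setXTT; apply: rectangle.
- move=> X Y YX [mX pX] [mY pY]; split; first exact: measurableD.
  have -> : (fun Z => point_sum C (fun z => \1_(X `\` Y) (z, Z)) Z) =
    (fun Z => point_sum C (fun z => \1_X (z, Z)) Z - point_sum C (fun z => \1_Y (z, Z)) Z).
    apply/funext => Z; rewrite -point_sumB//; congr point_sum; apply/funext => z.
    rewrite !indicE in_setD; have [yY|yY] := boolP ((z, Z) \in Y); rewrite ?andbF ?andbT ?subr0//.
    by rewrite (mem_set (YX _ (set_mem yY))) subrr.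
  exact: measurable_funB.
- move=> F ndF GF; split; first by apply: bigcupT_measurable => n; case: (GF n).
  apply: (measurable_fun_cvg (h := fun n X => point_sum C (fun z => \1_(F n) (z, X)) X)).
    by move=> n; case: (GF n).
  move=> X _; apply: cvg_point_sum => // z.
  have [[n _ Fn]|nF] := pselect ((\bigcup_i F i) (z, X)).
    apply: cvg_near_cst; exists n => // k /= nk.
    have h1 : (\bigcup_i F i) (z, X) by exists n.
    have h2 : F k (z, X) by move/subsetPset : (ndF _ _ nk); apply.
    by rewrite !indicE !mem_set.
  apply: cvg_near_cst; exists 0%N => // k _.
  have h : ~ F k (z, X) by move=> Fk; apply: nF; exists k.
  by rewrite !indicE !memNset.
Qed.

(** Mesh [1 / n.+1] and [n.+1 * n.+1] levels: the mesh shrinks while the cap [n.+1] on the height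
    grows, and each level is an indicator. *)
Let stairs (n : nat) (x : R) : R :=
  n.+1%:R^-1 * \sum_(k < n.+1 * n.+1) (k.+1%:R <= n.+1%:R * x)%R%:R.

Let cvg_stairs (x : R) : 0 <= x -> stairs ^~ x @ \oo --> x.
Proof.
move=> x0; apply/cvgrPdist_le => e e0; near=> n.
have n0 : 0 < n.+1%:R :> R by rewrite ltr0n.
have xn : x <= n.+1%:R.
  apply: (@le_trans _ _ n%:R); last by rewrite ler_nat.
  by near: n; exact: nbhs_infty_ger.
have ne : n.+1%:R^-1 <= e.
  by apply: ltW; near: n; exact: (near_infty_natSinv_lt (PosNum e0)).
have y0 : 0 <= n.+1%:R * x by rewrite mulr_ge0// ltW.
have [/(_ _)/andP[|]] := staircase_sum (n.+1 * n.+1) y0.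
  by rewrite natrM ler_pM2l.
rewrite /stairs; set s := \sum_(k < _) _ => s1 s2 _.
have -> : x - n.+1%:R^-1 * s = n.+1%:R^-1 * (n.+1%:R * x - s).
  by rewrite mulrBr mulKf// gt_eqF.
apply: le_trans ne; rewrite normrM (gtr0_norm (_ : 0 < n.+1%:R^-1)) ?invr_gt0//.
by apply: ler_piMr; [rewrite invr_ge0 ltW|rewrite ler_norml; lra].
Unshelve. all: by end_near. Qed.

Let ge0_measurable_point_sum (F : (E * M) * conf -> R) :
  measurable_fun setT F -> (forall y, 0 <= F y) ->
  measurable_fun setT (fun X => point_sum C (fun z => F (z, X)) X).
Proof.
move=> mF F0.
apply: (measurable_fun_cvg
  (h := fun n X => point_sum C (fun z => stairs n (F (z, X))) X)); last first.
  by move=> X _; apply: cvg_point_sum => // z; exact: cvg_stairs.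
move=> n; pose A k := [set y | k.+1%:R <= n.+1%:R * F y].
have mA k : measurable (A k).
  have -> : A k = (fun y => n.+1%:R * F y) @^-1` `[k.+1%:R, +oo[.
    by apply/seteqP; split => w /=; rewrite in_itv/= andbT.
  by rewrite -[X in measurable X]setTI; exact: measurable_funM.
have -> : (fun X => point_sum C (fun z => stairs n (F (z, X))) X) =
  (fun X => n.+1%:R^-1 * \sum_(k < n.+1 * n.+1) point_sum C (fun z => \1_(A k) (z, X)) X).
  apply/funext => X; rewrite point_sumZ// point_sum_sum//; congr (_ * _).
  apply: eq_bigr => k _; congr point_sum; apply/funext => z.
  by rewrite indicE; congr (nat_of_bool _)%:R; apply/idP/idP; rewrite inE.
apply: measurable_funM => //; apply: measurable_sum => k.
exact: measurable_point_sum_indic.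
Qed.

Lemma measurable_point_sum (F : (E * M) * conf -> R) : measurable_fun setT F ->
  measurable_fun setT (fun X => point_sum C (fun z => F (z, X)) X).
Proof.
move=> mF.
have -> : (fun X => point_sum C (fun z => F (z, X)) X) = (fun X =>
   point_sum C (fun z => Num.max (F (z, X)) 0) X -
   point_sum C (fun z => Num.max (- F (z, X)) 0) X).
  apply/funext => X; rewrite -point_sumB//; congr point_sum; apply/funext => z.
  by case: (leP (F (z, X)) 0) => ?; case: leP => ?; lra.
have max_ge0 (y : R) : 0 <= Num.max y 0 by rewrite le_max lexx orbT.
have h (K : (E * M) * conf -> R) : measurable_fun setT K ->
    measurable_fun setT (fun X => point_sum C (fun z => Num.max (K (z, X)) 0) X).
  move=> mK; pose K' y := Num.max (K y) 0.
  have : measurable_fun setT K' by exact: measurable_maxr.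
  by move=> /ge0_measurable_point_sum; apply => y; exact: max_ge0.
apply: measurable_funB; first exact: h.
by apply: (h (fun y => - F y)); exact: measurableT_comp.
Qed.

End measurability.
End point_sums.

Section set_function_integral.
Context {R : realType} {d : measure_display} {T : measurableType d}.
Variable m : set T -> \bar R.

(* [m] need not be a measure: the integral of a nonnegative function is a
   supremum over the simple functions below it. *)
Lemma ge0_le_integral_set_function (f g : T -> \bar R) :
  (forall x, 0 <= f x)%E -> (forall x, f x <= g x)%E ->
  (\int[m]_x f x <= \int[m]_x g x)%E.
Proof.
move=> f0 fg; have g0 x : (0 <= g x)%E by apply: le_trans (fg x).
rewrite /integral !patch_setT.
have n0 (h : T -> \bar R) : (forall x, 0 <= h x)%E -> (h ^\- = cst 0)%E.
  by move=> h0; apply/funext => x; rewrite funenegE max_r// leeNl oppe0.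
have p0 (h : T -> \bar R) : (forall x, 0 <= h x)%E -> (h ^\+ = h)%E.
  by move=> h0; apply/funext => x; rewrite funeposE max_l.
rewrite !n0// !p0//; apply: leeB => //.
apply: ereal_sup_le => _ [h hf <-]; 
by exists h => // x; apply: le_trans (hf x) (fg x).
Qed.

End set_function_integral.

Section palm.
Context {R : realType} {d : nat} {dM : measure_display} {M : measurableType dM}
  {dO : measure_display} {Omega : measurableType dO}.
Variables (P : probability Omega R) (hP : {RV P >-> mconf R d M}).
Local Notation E := (euclid R d).
Local Notation conf := (mconf R d M).
Implicit Types (C : set E).

Definition card_sum C (X : conf) : R := point_sum C (fun=> 1) X.

Lemma card_sum_ge0 C X : bounded_set C -> 0 <= card_sum C X.
Proof. by move=> bC; exact: point_sum_ge0. Qed.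

Lemma esum_point_sum C (f : E * M -> R) (X : conf) : bounded_set C ->
  (forall z, 0 <= f z) ->
  (\esum_(z in (X : set _)) (\1_C z.1 * f z)%:E)%E = (point_sum C f X)%:E.
Proof.
move=> bC f0; have fin := @lfset_lf _ _ _ _ X _ bC.
transitivity (\esum_(z in (X : set _) `&` fst @^-1` C) (f z)%:E)%E.
  rewrite esum_mkcondr; apply: eq_esum => z _; rewrite indicE.
  have -> : (z \in fst @^-1` C) = (z.1 \in C) by apply/idP/idP; rewrite !inE.
  by case: ifP; rewrite ?mul1r ?mul0r.
rewrite esum_fset//; last by move=> z _; rewrite lee_fin.
by rewrite fsumEFin.
Qed.

Lemma measurable_indic_fst C : measurable C ->
  measurable_fun setT (fun y : (E * M) * conf => \1_C y.1.1 : R).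
Proof.
move=> mC; apply: (measurableT_comp (measurable_indic mC)).
exact: measurableT_comp measurable_fst measurable_fst.
Qed.

Lemma measurable_hP_point_sum C (F : (E * M) * conf -> R) :
  measurable C -> bounded_set C -> measurable_fun setT F ->
  measurable_fun setT (fun w => point_sum C (fun z => F (z, hP w)) (hP w)).
Proof.
by move=> mC bC mF; apply: (measurableT_comp (measurable_point_sum mC bC mF)).
Qed.

Lemma measurable_card_sum C : measurable C -> bounded_set C ->
  measurable_fun setT (fun w => card_sum C (hP w)).
Proof. by move=> mC bC; apply: (measurable_hP_point_sum (F := fun=> 1)). Qed.

Variable palm : R.-pker E ~> (M * conf)%type.
Hypothesis hpalm : is_palm hP palm.

(* Campbell's formula, applied to [F] and to the constant [b]. *)
Lemma palm_bound C (F : (E * M) * conf -> R) (b : R) :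
  measurable C -> bounded_set C -> measurable_fun setT F ->
  (forall y, 0 <= F y) -> 0 <= b ->
  (forall x, C x -> \int[palm x]_y (F ((x, y.1), y.2))%:E <= b%:E)%E ->
  (\int[P]_w (point_sum C (fun z => F (z, hP w)) (hP w))%:E <=
   b%:E * \int[P]_w (card_sum C (hP w))%:E)%E.
Proof.
move=> mC bC mF F0 b0 hb.
have mC1 := measurable_indic_fst mC.
have := @hpalm (fun y => (\1_C y.1.1 * F y)%:E).
have := @hpalm (fun y => (\1_C y.1.1 * b)%:E).
under eq_integral => w _ do rewrite esum_point_sum//.
move=> Eb.
under eq_integral => w _ do rewrite esum_point_sum//.
move=> -> ; first last.
- by move=> y; rewrite lee_fin mulr_ge0.
- by apply/measurable_EFinP; exact: measurable_funM.
have -> : (b%:E * \int[P]_w (card_sum C (hP w))%:E =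
    \int[P]_w (point_sum C (fun=> b) (hP w))%:E)%E.
  rewrite -ge0_integralZl//=.
  - apply: eq_integral => w _; rewrite -EFinM -point_sumZ//.
    by congr (point_sum _ _ _)%:E; apply/funext => z; rewrite mulr1.
  - by apply/measurable_EFinP; exact: measurable_card_sum.
  - by move=> w _; rewrite lee_fin card_sum_ge0.
rewrite Eb; first last.
- by move=> y; rewrite lee_fin mulr_ge0.
- by apply/measurable_EFinP; exact: measurable_funM.
apply: ge0_le_integral_set_function => x.
  by apply: integral_ge0 => y _; rewrite lee_fin mulr_ge0.
have -> : (\int[palm x]_y (\1_C (x, y.1, y.2).1.1 * b)%:E = (\1_C x * b)%:E)%E.
  rewrite (eq_integral (cst (\1_C x * b)%:E))//.
  by rewrite integral_cst//= prob_kernel mule1.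
rewrite /= indicE.
have [/set_mem Cx|_] := boolP (x \in C); last first.
  by under eq_integral do rewrite mul0r; rewrite integral0 mul0r.
by under eq_integral do rewrite mul1r; rewrite mul1r; exact: hb.
Qed.

Hypothesis hmarks : unique_marks hP.
Hypothesis hstat : stationary hP.

Definition translate (t : E) (G : set E) : set E := [set x : E | G (x + t)].

(** Uniqueness of marks makes the projection to locations injective, so that marked points and
    locations have the same count. *)
Lemma counting_ground_shift (t : E) (G : set E) w :
  bounded_set (translate t G) ->
  evaluation G (Defs.shift t (ground (hP w))) =
  (card_sum (translate t G) (hP w))%:E.
Proof.
move=> bG; have [s [us sP sE]] := point_sum_seq (hP w) bG.
rewrite /card_sum sE big_const_seq count_predT iter_addr_0.
rewrite /evaluation (counting_seq (s := [seq z.1 + t | z <- s])) ?size_map//.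
  rewrite map_inj_in_uniq// => -[x m] [y m'] /sP[/= Xz _] /sP[/= Xz' _] /addIr xy.
  by subst y; rewrite (hmarks Xz Xz').
move=> x; split.
  move=> /mapP[z /sP[Xz Gz] ->]; split => //=.
  by exists z.1 => //; exists z.
move=> [[_ [z Xz <-] <-] Gx]; apply/mapP; exists z => //.
by apply/sP.
Qed.

Lemma shift_card_law (t : E) (G : set E) (U : set (\bar R)) :
  measurable G -> measurable U -> bounded_set G -> bounded_set (translate t G) ->
  P [set w | U (card_sum (translate t G) (hP w))%:E] =
  P [set w | U (card_sum G (hP w))%:E].
Proof.
move=> mG mU bG bGt.
have := @hstat t (evaluation G @^-1` U).
have mE : measurable (evaluation G @^-1` U : set (gconf R d)).
  by apply: sub_sigma_algebra; exists G => //; exists U.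
move=> /(_ mE) /=.
under [X in P X = _]eq_set do rewrite counting_ground_shift//.
move=> ->; congr (P _); apply/seteqP.
have E0 w : evaluation G (ground (hP w)) = (card_sum G (hP w))%:E.
  have := @counting_ground_shift 0 G w.
  have -> : translate 0 G = G by apply/seteqP; split => x; rewrite /translate /= addr0.
  move=> <-//; rewrite /evaluation; congr counting.
  apply/seteqP; split => x /= [h Gx]; split => //; last first.
    by case: h => y hy <-; rewrite addr0.
  by exists x; rewrite ?addr0.
by split => w /=; rewrite E0.
Qed.

(** Stationarity speaks of events of the ground process, hence of the law of a count; integrals of
    functions of the count follow by passing to image laws. *)
Lemma shift_card_integral (t : E) (G : set E) (f : R -> \bar R) :
  measurable G -> bounded_set G -> measurable (translate t G) ->
  bounded_set (translate t G) ->
  measurable_fun setT f -> (forall x, 0 <= f x)%E ->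
  (\int[P]_w f (card_sum (translate t G) (hP w)) =
   \int[P]_w f (card_sum G (hP w)))%E.
Proof.
move=> mG bG mGt bGt mf f0.
have m1 := measurable_card_sum mGt bGt; have m0 := measurable_card_sum mG bG.
pose X1 : {RV P >-> R} := mfun_Sub (mem_set m1).
pose X0 : {RV P >-> R} := mfun_Sub (mem_set m0).
have -> : (\int[P]_w f (card_sum (translate t G) (hP w)) = \int[P]_w (f \o X1) w)%E by [].
rewrite -ge0_integral_distribution//.
have -> : (\int[P]_w f (card_sum G (hP w)) = \int[P]_w (f \o X0) w)%E by [].
rewrite -ge0_integral_distribution//.
apply: eq_measure_integral => A mA _.
have := @shift_card_law t G (EFin @` A) mG _ bG bGt.
rewrite /distribution /pushforward.
have imE (u : Omega -> R) : [set w | (EFin @` A) (u w)%:E] = u @^-1` A.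
  by apply/seteqP; split => w /=; [case=> x Ax [<-]|exists (u w)].
by rewrite !imE; apply; exact: measurable_image_EFin.
Qed.

End palm.

(** * Power inequalities for sums with a variable number of terms *)

Section power_sums.
Variable R : realType.
Implicit Types (p q : R).

(* Tangent line at the mean: Young's inequality for [a z] and [m `^ (p - 1)]. *)
Lemma powR_sum_le_mean (T : Type) (s : seq T) (a : T -> R) p :
  (forall z, 0 <= a z) -> 1 < p -> (0 < size s)%N ->
  (\sum_(z <- s) a z) `^ p <= (size s)%:R `^ (p - 1) * \sum_(z <- s) a z `^ p.
Proof.
move=> a0 p1 s0; set S := \sum_(z <- s) a z; set N := (size s)%:R : R.
have N0 : 0 < N by rewrite ltr0n.
have S0 : 0 <= S by exact: sumr_ge0.
pose m := S / N; have m0 : 0 <= m by rewrite divr_ge0// ltW.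
have p0 : 0 < p by lra.
have pN0 : p != 0 by rewrite gt_eqF.
pose q := p / (p - 1); have q0 : 0 < q by rewrite divr_gt0//; lra.
have pq : p^-1 + q^-1 = 1 by rewrite /q; field; rewrite pN0/= subr_eq0 gt_eqF.
have mq : (m `^ (p - 1)) `^ q = m `^ p.
  by rewrite -powRrM /q mulrCA divff ?mulr1// subr_eq0 gt_eqF.
have Sm : S = N * m by rewrite /m mulrCA divff ?mulr1// gt_eqF.
have E : N * m `^ p <= \sum_(z <- s) a z `^ p.
  have : \sum_(z <- s) (a z * m `^ (p - 1)) <= \sum_(z <- s) (a z `^ p / p + m `^ p / q).
    apply: ler_sum => z _; rewrite -mq.
    exact: conjugate_powR (a0 z) (powR_ge0 _ _) p0 q0 pq.
  rewrite -mulr_suml -/S big_split/= big_const_seq count_predT iter_addr_0.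
  rewrite -[_ *+ size s]mulr_natl -/N -mulr_suml {1}Sm -mulrA mulr_powRB1//.
  have -> : q^-1 = 1 - p^-1 by lra.
  set Y := \sum_(z <- s) _; have : 0 < p^-1 by rewrite invr_gt0.
  move: (m `^ p) p^-1 => X t t0 h.
  have : N * X * t <= Y * t by lra.
  by rewrite ler_pM2r.
rewrite {1}Sm (powRM _ (ltW N0) m0).
rewrite -[N `^ p](mulr_powRB1 (ltW N0) p0).
by rewrite [N * _]mulrC -mulrA ler_wpM2l ?powR_ge0.
Qed.

Variables (p1 p2 : R).
Hypotheses (hp1 : 1 <= p1) (hp2 : 1 <= p2) (hp0 : 3 <= p0 p1 p2).

Lemma p0_props : [/\ 1 < p1, 1 < p2 & p0 p1 p2 < p2].
Proof.
have h1 := hp1; have h2 := hp2; have s0 : 0 < p1 + p2 - 1 by lra.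
move: hp0; rewrite /p0 ler_pdivlMr// => h.
have k1 : 1 < p1 by nra.
have k2 : 1 < p2 by nra.
by split => //; rewrite ltr_pdivrMr//; nra.
Qed.

(** After convexity, Young's inequality with exponents [u = p2 / p] and [v = p2 / (p2 - p)] splits
    [N^(p - 1) a^p]. The value [p = p0] is the one for which [(p - 1) v = p1 - 1], so that exactly
    the available moments [a^p2] and [N^p1] appear. *)
Lemma powR_sum_le (T : Type) (s : seq T) (a : T -> R) : (forall z, 0 <= a z) ->
  (\sum_(z <- s) a z) `^ p0 p1 p2 <=
  \sum_(z <- s) a z `^ p2 + (size s)%:R `^ p1.
Proof.
move=> a0; have [h1 h2 h3] := p0_props; set p := p0 p1 p2.
have p3 : 3 <= p by exact: hp0.
have h3' : p < p2 by [].
case: s => [|z0 s'].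
  by rewrite !big_nil powR0 ?add0r ?powR_ge0// gt_eqF//; lra.
set s := z0 :: s'; have s0 : (0 < size s)%N by [].
apply: le_trans (powR_sum_le_mean a0 _ s0) _; first lra.
set N := (size s)%:R : R.
have N0 : 0 < N by rewrite ltr0n.
rewrite -[N `^ p1]mulr_powRB1 ?(ltW N0)//; last lra.
have -> : N * N `^ (p1 - 1) = \sum_(z <- s) N `^ (p1 - 1).
  by rewrite big_const_seq count_predT iter_addr_0 mulr_natl.
rewrite mulr_sumr -big_split/=; apply: ler_sum => z _.
have s1 : p1 + p2 - 1 != 0 by rewrite gt_eqF//; lra.
pose u := p2 / p; pose v := p2 / (p2 - p).
have u0 : 0 < u by rewrite divr_gt0//; lra.
have v0 : 0 < v by rewrite divr_gt0//; lra.
have pp : 0 < p by lra.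
have u1 : 1 <= u by rewrite /u ler_pdivlMr// mul1r ltW.
have v1 : 1 <= v by rewrite /v ler_pdivlMr ?mul1r ?subr_gt0// lerBlDr lerDl ltW.
have pN0 : p != 0 by rewrite gt_eqF.
have p2N0 : p2 != 0 by rewrite gt_eqF//; lra.
have dN0 : p2 - p != 0 by rewrite gt_eqF//; lra.
have uv : u^-1 + v^-1 = 1 by rewrite /u /v; field; rewrite pN0 p2N0 dN0.
have Ea : (a z `^ p) `^ u = a z `^ p2.
  by rewrite -powRrM /u mulrCA divff// mulr1.
have EN : (N `^ (p - 1)) `^ v = N `^ (p1 - 1).
  rewrite -powRrM; congr (_ `^ _); rewrite /v.
  have dE : p2 - p = p2 * (p2 - 1) / (p1 + p2 - 1) by rewrite /p /p0; field.
  rewrite dE /p /p0; field; rewrite s1 p2N0/= subr_eq0 gt_eqF//.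
rewrite mulrC; apply: le_trans (conjugate_powR (powR_ge0 _ _) (powR_ge0 _ _) u0 v0 uv) _.
rewrite Ea EN; by apply: lerD; rewrite ler_pdivrMr// ler_peMr ?powR_ge0.
Qed.

End power_sums.

(** * Geometry of Euclidean space *)

Section euclid_geometry.
Context {R : realType} {d : nat}.
Local Notation E := (euclid R d).
Implicit Types (x y c : E) (A B : set E).

Lemma norm_coord_le x (i : 'I_d) : `|x 0 i| <= `|x|.
Proof.
rewrite [leRHS]/Num.Def.normr/= mx_normrE.
by apply/bigmax_geP; right => /=; exists (0, i).
Qed.

Lemma norm_le_coord x (r : R) : 0 <= r -> (forall i : 'I_d, `|x 0 i| <= r) -> `|x| <= r.
Proof.
move=> r0 hx; rewrite /Num.Def.normr/= mx_normrE (bigmax_le _ r0)//= => -[j i] _ /=.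
by rewrite ord1.
Qed.

Lemma norm_le_edist x y : `|x - y| <= Defs.edist x y.
Proof.
apply: norm_le_coord; first exact: sqrtr_ge0.
move=> i; rewrite !mxE -sqrtr_sqr ler_wsqrtr//.
by rewrite (bigD1 i)//= lerDl sumr_ge0// => j _; exact: sqr_ge0.
Qed.

Lemma edist_le_norm x y : Defs.edist x y <= d%:R * `|x - y|.
Proof.
have dx0 : 0 <= d%:R * `|x - y| by rewrite mulr_ge0.
rewrite -[leRHS]ger0_norm// -sqrtr_sqr ler_wsqrtr//.
apply: (@le_trans _ _ (\sum_(i < d) `|x - y| ^+ 2)).
  apply: ler_sum => i _; have := norm_coord_le (x - y) i; rewrite !mxE => h.
  by rewrite -[leLHS]real_normK ?num_real// ler_sqr ?nnegrE.
rewrite sumr_const card_ord exprMn -[leLHS]mulr_natl ler_wpM2r ?sqr_ge0//.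
by rewrite -natrX ler_nat; case: (d) => // k; rewrite expnS leq_pmulr// expn_gt0.
Qed.

Lemma bounded_set_le A (r : R) : (forall x, A x -> `|x| <= r) -> bounded_set A.
Proof.
move=> hA; exists r; split; first exact: num_real.
by move=> m rm x Ax; apply: le_trans (hA x Ax) (ltW rm).
Qed.

Lemma bounded_setS A B : A `<=` B -> bounded_set B -> bounded_set A.
Proof. by move=> AB [r [rr hr]]; exists r; split => // m rm x /AB; exact: hr. Qed.

Lemma open_borel A : open A -> measurable A.
Proof. by move=> oA; exact: sub_sigma_algebra. Qed.

Lemma measurable_coord (i : 'I_d) : measurable_fun setT (fun x : E => x 0 i : R).
Proof.
apply: (@measurability _ _ _ (measurableTypeR R) setT _ _ (RGenOInfty.measurableE R)) => _ [_ [a ->] <-].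
rewrite setTI; apply: open_borel.
apply: open_comp; last exact: interval_open.
by move=> x _; exact: coord_continuous.
Qed.

Lemma measurable_forall_ord (A : 'I_d -> set E) : (forall i, measurable (A i)) ->
  measurable [set x : E | forall i, A i x].
Proof.
move=> mA; have -> : [set x : E | forall i, A i x] = \bigcap_(i in [set: 'I_d]) A i.
  by apply/seteqP; split => x /= h i; [move=> _; exact: h|exact: h].
by apply: fin_bigcap_measurable => //; exact: finite_finset.
Qed.

Lemma measurable_coord_pre (i : 'I_d) (U : set R) : measurable U ->
  measurable [set x : E | U (x 0 i)].
Proof.
by move=> mU; rewrite -[X in measurable X]setTI; exact: (measurable_coord i).
Qed.

Lemma measurable_Gamma (lam : R) : measurable (Gamma d lam : set E).
Proof.
apply: (measurable_forall_ord (A := fun i => [set x : E | `|x 0 i| <= _])) => i.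
have := @measurable_coord_pre i `[- (2^-1 * lam `^ d%:R^-1), 2^-1 * lam `^ d%:R^-1].
rewrite (_ : [set x : E | _ (x 0 i)] =
  [set x : E | `|x 0 i| <= 2^-1 * lam `^ d%:R^-1]); first by apply.
by apply/seteqP; split => x /=; rewrite in_itv/= ler_norml.
Qed.

Lemma Gamma_norm_le (lam : R) x : Gamma d lam x -> `|x| <= 2^-1 * lam `^ d%:R^-1.
Proof. by move=> hx; apply: norm_le_coord => //; rewrite mulr_ge0// powR_ge0. Qed.

Lemma bounded_Gamma (lam : R) : bounded_set (Gamma d lam : set E).
Proof. exact: bounded_set_le (@Gamma_norm_le lam). Qed.

(** Sup-norm balls fit the geometry of cubes; Euclidean balls of the same radius lie inside them by
    [norm_le_edist]. *)
Definition norm_ball c (r : R) : set E := [set x | `|x - c| < r].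

Lemma open_norm_ball c r : open (norm_ball c r).
Proof.
have -> : norm_ball c r = ball c r.
  by rewrite -ball_normE; apply/seteqP; split => x; rewrite /norm_ball /ball_/= distrC.
exact: ball_open.
Qed.

Lemma measurable_norm_ball c r : measurable (norm_ball c r).
Proof. apply: open_borel; exact: open_norm_ball. Qed.

Lemma diam_le A (r : R) c : A !=set0 -> (forall x, A x -> `|x - c| <= r) ->
  diam A <= d%:R * (2 * r).
Proof.
move=> [a Aa] hA; apply: ge_sup; first by exists (Defs.edist a a); exists a => //; exists a.
move=> _ [x Ax [y Ay <-]]; apply: le_trans (edist_le_norm x y) _.
rewrite ler_wpM2l//; have := hA x Ax; have := hA y Ay.
have -> : x - y = (x - c) - (y - c) by rewrite opprB addrA subrK.
by have := ler_normB (x - c) (y - c); lra.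
Qed.

Lemma diam_ge0 A : 0 <= diam A.
Proof.
rewrite /diam; set S := [set _ | _ in _ & _ in _].
have [hS|nS] := pselect (has_sup S); last by rewrite sup_out.
have [[s Ss] ubS] := hS; apply: (@le_trans _ _ s); last exact: ub_le_sup.
by case: Ss => x _ [y _ <-]; exact: sqrtr_ge0.
Qed.

Lemma setdist_ge A B (r : R) : A !=set0 -> B !=set0 ->
  (forall x y, A x -> B y -> r <= `|x - y|) -> r <= setdist A B.
Proof.
move=> [a Aa] [b Bb] h; apply: lb_le_inf; first by exists (Defs.edist a b); exists a => //; exists b.
by move=> _ [x Ax [y By <-]]; apply: le_trans (h x y Ax By) (norm_le_edist x y).
Qed.

End euclid_geometry.

(** * Unit cubes *)

Section cubes.
Context {R : realType} {d : nat}.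
Local Notation E := (euclid R d).
Variable L : nat.
Definition cube_index := {ffun 'I_d -> 'I_(2 * L)}.
Implicit Types (k j : cube_index) (x : E).

Definition corner k : E := \row_i ((k i)%:R - L%:R).

Definition cube k : set E := [set x : E | forall i, corner k 0 i <= x 0 i < corner k 0 i + 1].

Lemma measurable_cube k : measurable (cube k).
Proof.
apply: (measurable_forall_ord (A := fun i => [set x : E | corner k 0 i <= x 0 i < corner k 0 i + 1])) => i.
have := @measurable_coord_pre R d i `[corner k 0 i, corner k 0 i + 1[.
rewrite (_ : [set x : E | _ (x 0 i)] =
  [set x : E | corner k 0 i <= x 0 i < corner k 0 i + 1]); first by apply.
by apply/seteqP; split => x /=; rewrite in_itv/=.
Qed.

Lemma cube_norm_le k x : cube k x -> `|x - corner k| <= 1.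
Proof.
move=> hx; apply: norm_le_coord => // i.
by have := hx i; rewrite !mxE => /andP[h1 h2]; rewrite ler_norml; lra.
Qed.

Lemma corner_norm_le k : `|corner k| <= L%:R.
Proof.
apply: norm_le_coord => // i; rewrite mxE.
have : (k i)%:R <= (2 * L)%:R :> R by rewrite ler_nat ltnW.
have : 0 <= (k i)%:R :> R by [].
by rewrite natrM ler_norml; lra.
Qed.

(** Moves the cube into the centred unit cube, [1/2] being the offset from corner to centre; counts
    in any cube are then governed by stationarity. *)
Definition cube_shift k : E := \row_i (- corner k 0 i - 2^-1).

Lemma translate_Gamma1E (t : E) :
  translate t (Gamma d 1) = [set x : E | forall i, `|x 0 i + t 0 i| <= 2^-1].
Proof.
apply/seteqP; split => x; rewrite /translate /Gamma/= => h i;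
  by have := h i; rewrite mxE powR1 mulr1.
Qed.

Lemma cube_sub_translate k : cube k `<=` translate (cube_shift k) (Gamma d 1).
Proof.
rewrite translate_Gamma1E => x hx i.
by have := hx i; rewrite !mxE => /andP[h1 h2]; rewrite ler_norml; lra.
Qed.

Lemma measurable_translate_Gamma1 (t : E) : measurable (translate t (Gamma d 1)).
Proof.
rewrite translate_Gamma1E.
apply: (measurable_forall_ord (A := fun i => [set x : E | `|x 0 i + t 0 i| <= 2^-1])) => i.
have := @measurable_coord_pre R d i `[- 2^-1 - t 0 i, 2^-1 - t 0 i].
rewrite (_ : [set x : E | _ (x 0 i)] = [set x : E | `|x 0 i + t 0 i| <= 2^-1]).
  by apply.
apply/seteqP; split => x /=; rewrite in_itv/= ler_norml => /andP[h1 h2]; apply/andP; split; lra.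
Qed.

Lemma bounded_translate_Gamma1 (t : E) : bounded_set (translate t (Gamma d 1 : set E)).
Proof.
apply: (@bounded_set_le _ _ _ (2^-1 + `|t|)); rewrite translate_Gamma1E => x hx.
apply: norm_le_coord => [|i]; first by rewrite addr_ge0.
have := hx i; have := norm_coord_le t i; rewrite !ler_norml => /andP[a1 a2] /andP[b1 b2].
apply/andP; split; lra.
Qed.

Lemma cube_inj k j x : cube k x -> cube j x -> k = j.
Proof.
move=> hk hj; apply/ffunP => i; apply: val_inj => /=.
have := hk i; have := hj i; rewrite !mxE => /andP[j1 j2] /andP[k1 k2].
have kj : ((k i)%:R : R) < (j i).+1%:R by rewrite -natr1; lra.
have jk : ((j i)%:R : R) < (k i).+1%:R by rewrite -natr1; lra.
by move: kj jk; rewrite !ltr_nat !ltnS => h1 h2; apply/eqP; rewrite eqn_leq h1 h2.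
Qed.

Lemma cube_cover x : (forall i, `|x 0 i| < L%:R) -> exists k, cube k x.
Proof.
move=> hx.
have h (i : 'I_d) : (Num.truncn (x 0%R i + L%:R)%R < 2 * L)%N.
  have := hx i; rewrite ltr_norml => /andP[h1 h2].
  rewrite -(ltr_nat R); apply: (@le_lt_trans _ _ (x 0 i + L%:R)).
    by have /truncn_itv/andP[] : 0 <= x 0 i + L%:R by lra.
  by rewrite natrM; lra.
exists [ffun i => Ordinal (h i)] => i; rewrite mxE ffunE/=.
have := hx i; rewrite ltr_norml => /andP[h1 h2].
have /truncn_itv/andP[] : 0 <= x 0 i + L%:R by lra.
by rewrite -natr1 => t1 t2; apply/andP; split; lra.
Qed.

Lemma sum_cube_indic x : (forall i, `|x 0 i| < L%:R) ->
  \sum_(k : cube_index) \1_(cube k) x = 1 :> R.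
Proof.
move=> /cube_cover[k kx]; rewrite (bigD1 k)//= big1 ?addr0.
  by rewrite indicE mem_set.
move=> j jk; rewrite indicE memNset// => jx; move/eqP: jk; apply.
exact: cube_inj jx kx.
Qed.

Definition near_cubes k (m : nat) : {set cube_index} :=
  finset (fun j => `|corner k - corner j| < m%:R).

(** Each coordinate offset [j i - k i] lies strictly between [- m] and [m]; shifted by [m], it
    determines [j] among [2 m + 1] values per coordinate. *)
Lemma card_near_cubes k (m : nat) : (#|near_cubes k m| <= (2 * m).+1 ^ d)%N.
Proof.
have aux (a b : nat) : (a < b + m)%N -> (a + m - b < (2 * m).+1)%N.
  by move=> h; rewrite ltnS leq_subLR mul2n -addnn addnA leq_add2r ltnW.
pose f j : {ffun 'I_d -> 'I_(2 * m).+1} := [ffun i => inord (j i + m - k i)].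
have close (j : cube_index) (i : 'I_d) : `|corner k - corner j| < m%:R -> (j i < k i + m)%N /\ (k i < j i + m)%N.
  move=> h; have := le_lt_trans (norm_coord_le (corner k - corner j) i) h.
  rewrite !mxE ltr_norml => /andP[h1 h2].
  by split; rewrite -(ltr_nat R) natrD; lra.
rewrite -[leqRHS](_ : #|{ffun 'I_d -> 'I_(2 * m).+1}| = _); last first.
  by rewrite card_ffun !card_ord.
rewrite -(card_in_imset (f := f)); first exact: max_card.
move=> j j'; rewrite !inE => hj hj' /ffunP fj; apply/ffunP => i; apply: val_inj.
have [a1 a2] := close j i hj; have [b1 b2] := close j' i hj'.
have := congr1 val (fj i); rewrite !ffunE /= !inordK; [|exact: aux|exact: aux].
move=> /(congr1 (addn^~ (k i))); rewrite !subnK 1?ltnW// => /addIn.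
exact.
Qed.

End cubes.

Section partition.
Context {R : realType} {d : nat} {dM : measure_display} {M : measurableType dM}.
Local Notation E := (euclid R d).
Local Notation conf := (mconf R d M).

Lemma point_sum_indic (A B : set E) (f : E * M -> R) (X : conf) : bounded_set B ->
  A `<=` B -> point_sum A f X = point_sum B (fun z => \1_A z.1 * f z) X.
Proof.
move=> bB AB; have bA := bounded_setS AB bB.
have [s [us sP ->]] := point_sum_seq X bA; have [s' [us' sP' ->]] := point_sum_seq X bB.
rewrite [RHS](bigID (fun z => z.1 \in A))/= [X in _ = _ + X]big1 ?addr0; last first.
  by move=> z /negbTE zA; rewrite indicE zA mul0r.
rewrite [RHS](eq_bigr f); last by move=> z zA; rewrite indicE zA mul1r.
rewrite -[RHS]big_filter; apply: perm_big; apply: uniq_perm; rewrite ?filter_uniq//.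
move=> z; rewrite mem_filter; apply/idP/andP.
  move=> /sP[Xz Az]; split; first exact: mem_set.
  by apply/sP'; split => //; exact: AB.
by move=> [/set_mem Az /sP'[Xz _]]; apply/sP; split.
Qed.

Lemma point_sum_cubes (L : nat) (lam : R) (f : E * M -> R) (X : conf) :
  2^-1 * lam `^ d%:R^-1 < L%:R ->
  point_sum (Gamma d lam) f X =
  \sum_(k : cube_index L) point_sum (cube k `&` Gamma d lam) f X.
Proof.
move=> hL; have bG := @bounded_Gamma R d lam.
under eq_bigr => k _ do rewrite (@point_sum_indic _ (Gamma d lam))//.
rewrite -point_sum_sum//; apply: eq_point_sum => // z Xz Gz.
rewrite -mulr_suml (eq_bigr (fun k => \1_(cube k) z.1)); last first.
  by move=> k _; rewrite !indicE in_setI (mem_set Gz) andbT.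
rewrite sum_cube_indic ?mul1r// => i.
by apply: le_lt_trans hL; exact: Gz.
Qed.

End partition.

(** * Truncated sums *)

Section truncated_sum.
Context {R : realType} {dO : measure_display} {Omega : measurableType dO}.
Variable P : probability Omega R.
Local Notation Ex := (Ex P).
Local Notation L1 := (L1 P).

Lemma sqr_sum_le (I : finType) (x : I -> R) :
  (\sum_i x i) ^+ 2 <= #|I|%:R * \sum_i x i ^+ 2.
Proof.
have -> : #|I|%:R * \sum_i x i ^+ 2 = \sum_i \sum_j (2^-1 * (x i ^+ 2 + x j ^+ 2)).
  under [RHS]eq_bigr => i _ do rewrite -mulr_sumr big_split/= sumr_const.
  rewrite -mulr_sumr big_split/= sumr_const sumrMnl mulr_natl.
  by move: (_ *+ _) => z; lra.
rewrite expr2 mulr_suml; apply: ler_sum => i _; rewrite mulr_sumr.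
by apply: ler_sum => j _; have := sqr_ge0 (x i - x j); lra.
Qed.

Definition L2 (f : Omega -> R) := L1 f /\ L1 (fun w => f w ^+ 2).

Lemma L2D f g : L2 f -> L2 g -> L2 (fun w => f w + g w).
Proof.
move=> [f1 f2] [g1 g2]; split; first exact: L1D.
apply: (@L1_dominated _ _ _ _ _ (fun w => 2 * f w ^+ 2 + 2 * g w ^+ 2)).
- by apply: measurable_funX; apply: measurable_funD; [exact: L1_measurable f1|exact: L1_measurable g1].
- move=> w; rewrite ger0_norm ?sqr_ge0//; have := sqr_ge0 (f w - g w); lra.
- by apply: L1D; exact: L1Z.
Qed.

Lemma L2Z (k : R) f : L2 f -> L2 (fun w => k * f w).
Proof.
move=> [f1 f2]; split; first exact: L1Z.
by under [X in L1 X]eq_fun do rewrite exprMn; exact: L1Z.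
Qed.

Lemma L2_cst (k : R) : L2 (fun=> k).
Proof. by split; exact: L1_cst. Qed.

Lemma L2_bounded f : bounded_meas f -> L2 f.
Proof.
by move=> bf; split; apply: L1_bounded => //; under [X in bounded_meas X]eq_fun do rewrite expr2; exact: boundedM.
Qed.

Lemma L2B f g : L2 f -> L2 g -> L2 (fun w => f w - g w).
Proof.
move=> hf hg; have := L2D hf (L2Z (-1) hg).
by under [X in L2 X -> _]eq_fun do rewrite mulN1r.
Qed.

Lemma L2_sum (I : Type) (r : seq I) (F : I -> Omega -> R) :
  (forall i, L2 (F i)) -> L2 (fun w => \sum_(i <- r) F i w).
Proof.
move=> hF; elim: r => [|i r ih].
  by under [X in L2 X]eq_fun do rewrite big_nil; exact: L2_cst.
by under [X in L2 X]eq_fun do rewrite big_cons; exact: L2D.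
Qed.

Lemma L1M f g : L2 f -> L2 g -> L1 (fun w => f w * g w).
Proof.
move=> [f1 f2] [g1 g2]; apply: (@L1_dominated _ _ _ _ _ (fun w => f w ^+ 2 + g w ^+ 2)).
- by apply: measurable_funM; [exact: L1_measurable f1|exact: L1_measurable g1].
- move=> w; rewrite ler_norml; have := sqr_ge0 (f w - g w); have := sqr_ge0 (f w + g w).
  by have := sqr_ge0 (f w); have := sqr_ge0 (g w) => *; apply/andP; split; lra.
- exact: L1D.
Qed.

Lemma Ex_centered_sqr f : L2 f -> Ex (fun w => (f w - Ex f) ^+ 2) <= Ex (fun w => f w ^+ 2).
Proof.
move=> [f1 f2].
have -> : (fun w => (f w - Ex f) ^+ 2) =
    (fun w => f w ^+ 2 - (2 * Ex f) * f w + Ex f ^+ 2).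
  by apply/funext => w; lra.
rewrite ExD; [|by apply: L1B => //; exact: L1Z|exact: L1_cst].
rewrite ExB//; last exact: L1Z.
rewrite ExZ// Ex_cst; have := sqr_ge0 (Ex f); lra.
Qed.

Section variables.
Variables (I : finType) (X Y : I -> Omega -> R) (N N' : I -> {set I}).
Variables (sig del K3 T kap : R) (m : nat).
Hypotheses (sig0 : 0 < sig) (del0 : 0 < del) (K30 : 0 <= K3) (kap0 : 0 <= kap).
Hypothesis I0 : (0 < #|I|)%N.
Hypothesis X2 : forall i, L2 (X i).
Hypothesis mY : forall i, measurable_fun setT (Y i).
Hypothesis YT : forall i w, `|Y i w| <= T.
Hypothesis XY : forall i, Ex (fun w => (X i w - Y i w) ^+ 2) <= del ^+ 2.
Hypothesis Y3 : forall i, Ex (fun w => `|Y i w| ^+ 3) <= K3.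

Let H w := \sum_i X i w.
Hypothesis varH : Ex (fun w => (H w - Ex H) ^+ 2) = sig ^+ 2.

Definition normalized_block i w := (Y i w - Ex (Y i)) / sig.
Local Notation U := normalized_block.
Let C := stein_bound R.

Hypothesis NN' : forall i, N i \subset N' i.
Hypothesis cN' : forall i, (#|N' i| <= m)%N.
Hypothesis far_mean : forall i (f : R -> R), measurable_fun setT f ->
  (forall x, `|f x| <= C) ->
  `|Ex (fun w => U i w * f (outer_sum U (N i) w))| <= kap.
Hypothesis far_cov : forall i j (g : R -> R), j \in N i ->
  measurable_fun setT g -> (forall x, `|g x| <= C) ->
  `|Ex (fun w => U i w * U j w * g (outer_sum U (N' i) w)) -
    Ex (fun w => U i w * U j w) * Ex (fun w => g (outer_sum U (N' i) w))| <= kap.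
Hypothesis far_pair : forall i j, j \notin N i ->
  `|Ex (fun w => U i w * U j w)| <= kap.

Let bY i : bounded_meas (Y i). Proof. by split => //; exists T. Qed.
Let bU i : bounded_meas (U i).
Proof.
by apply: boundedM; [apply: boundedB => //|]; exact: bounded_cst.
Qed.

Let D i w := X i w - Y i w.
Let D2 i : L2 (D i). Proof. by apply: L2B => //; exact: L2_bounded. Qed.
Let Dsum w := \sum_i D i w.
Let LD : L2 Dsum. Proof. exact: L2_sum. Qed.
Let LH : L2 H. Proof. exact: L2_sum. Qed.
Let n : R := #|I|%:R.
Let n0 : 0 < n. Proof. by rewrite ltr0n. Qed.
(** Bounds the [L2] distance between the normalised [H] and the normalised sum of the [Y i]. The
    number of blocks enters linearly, as no cancellation between block errors is sought. *)
Let eta := n * del / sig.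
Let eta0 : 0 < eta. Proof. by rewrite divr_gt0// mulr_gt0. Qed.

Let Dsum_le : Ex (fun w => Dsum w ^+ 2) <= (n * del) ^+ 2.
Proof.
apply: (@le_trans _ _ (Ex (fun w => n * \sum_i D i w ^+ 2))).
  apply: Ex_le; first by case: LD.
    by apply: L1Z; apply: L1_sum => i; case: (D2 i).
  by move=> w; exact: sqr_sum_le.
rewrite ExZ; last by apply: L1_sum => i; case: (D2 i).
rewrite Ex_sum; last by move=> i; case: (D2 i).
rewrite exprMn [n ^+ 2]expr2 -mulrA ler_pM2l//.
rewrite (_ : n * del ^+ 2 = \sum_(i : I) del ^+ 2); last by rewrite sumr_const -mulr_natl.
by apply: ler_sum => i _; exact: XY.
Qed.

Let Hc w := (H w - Ex H) / sig.
Let Dc w := (Dsum w - Ex Dsum) / sig.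
Let W := total_sum U.

Let LHc : L2 Hc.
Proof.
rewrite /Hc; under [X in L2 X]eq_fun do rewrite mulrC.
by apply: L2Z; apply: L2B => //; exact: L2_cst.
Qed.
Let LDc : L2 Dc.
Proof.
rewrite /Dc; under [X in L2 X]eq_fun do rewrite mulrC.
by apply: L2Z; apply: L2B => //; exact: L2_cst.
Qed.

Let Hc2 : Ex (fun w => Hc w ^+ 2) = 1.
Proof.
rewrite /Hc; under eq_Ex do rewrite exprMn mulrC.
rewrite ExZ; last by case: (L2B LH (L2_cst (Ex H))).
by rewrite varH -exprMn mulVf ?expr1n// gt_eqF.
Qed.

Let Dc2 : Ex (fun w => Dc w ^+ 2) <= eta ^+ 2.
Proof.
rewrite /Dc; under eq_Ex do rewrite exprMn mulrC.
rewrite ExZ; last by case: (L2B LD (L2_cst (Ex Dsum))).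
rewrite /eta exprMn mulrC ler_wpM2r ?sqr_ge0//.
exact: le_trans (Ex_centered_sqr LD) Dsum_le.
Qed.

Let WE w : W w = Hc w - Dc w.
Proof.
rewrite /W /total_sum /U /Hc /Dc -mulrBl -mulr_suml; congr (_ / _).
have LX i : L1 (X i) by case: (X2 i).
have LY i : L1 (Y i) by exact: L1_bounded.
have -> : Ex H = \sum_i Ex (X i) by rewrite Ex_sum.
have -> : Ex Dsum = \sum_i (Ex (X i) - Ex (Y i)).
  rewrite Ex_sum; last by move=> i; case: (D2 i).
  by apply: eq_bigr => i _; rewrite ExB.
rewrite /H /Dsum /D !sumrB; lra.
Qed.

(** In place of Cauchy-Schwarz, the pointwise bound [|Dc| <= eta / 2 + Dc^2 / (2 eta)], weighted so
    that each half contributes [eta / 2]. *)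
Let Ex_Dc : Ex (fun w => `|Dc w|) <= eta.
Proof.
have [d1 d2] := LDc.
apply: (@le_trans _ _ (Ex (fun w => eta / 2 + (2 * eta)^-1 * Dc w ^+ 2))).
  apply: Ex_le; first exact: L1_norm.
    by apply: L1D; [exact: L1_cst|exact: L1Z].
  move=> w; rewrite -[Dc w ^+ 2]real_normK ?num_real//.
  have -> : eta / 2 + (2 * eta)^-1 * `|Dc w| ^+ 2 =
    `|Dc w| + (2 * eta)^-1 * (`|Dc w| - eta) ^+ 2 by field; rewrite gt_eqF.
  by rewrite lerDl mulr_ge0 ?sqr_ge0// invr_ge0 mulr_ge0// ltW.
rewrite ExD; [|exact: L1_cst|exact: L1Z].
rewrite Ex_cst ExZ//.
have : (2 * eta)^-1 * Ex (fun w => Dc w ^+ 2) <= (2 * eta)^-1 * eta ^+ 2.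
  by rewrite ler_wpM2l// invr_ge0 mulr_ge0// ltW.
have -> : (2 * eta)^-1 * eta ^+ 2 = eta / 2 by field; rewrite gt_eqF.
lra.
Qed.

(** [W = Hc - Dc] with [E Hc^2 = 1]: the variance misses 1 by twice a cross term, at most [eta] by a
    weighted square inequality, and by [E Dc^2]. *)
Let varW : `|Ex (fun w => W w ^+ 2) - 1| <= 2 * eta + eta ^+ 2.
Proof.
have [d1 d2] := LDc; have [h1 h2] := LHc.
have hd := L1M LHc LDc.
have -> : Ex (fun w => W w ^+ 2) =
    Ex (fun w => Hc w ^+ 2) - 2 * Ex (fun w => Hc w * Dc w) + Ex (fun w => Dc w ^+ 2).
  rewrite -ExZ// -ExB//; last exact: L1Z.
  rewrite -ExD//; last by apply: L1B => //; exact: L1Z.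
  by apply: eq_Ex => w; rewrite WE; lra.
rewrite Hc2.
have HD : `|Ex (fun w => Hc w * Dc w)| <= eta.
  apply: (@le_trans _ _ (Ex (fun w => eta / 2 * Hc w ^+ 2 + (2 * eta)^-1 * Dc w ^+ 2))).
    apply: Ex_abs_le => //; first by apply: L1D; exact: L1Z.
    move=> w; rewrite normrM.
    rewrite -[Dc w ^+ 2]real_normK ?num_real// -[Hc w ^+ 2]real_normK ?num_real//.
    have -> : eta / 2 * `|Hc w| ^+ 2 + (2 * eta)^-1 * `|Dc w| ^+ 2 =
      `|Hc w| * `|Dc w| + (2 * eta)^-1 * (`|Dc w| - eta * `|Hc w|) ^+ 2.
      by field; rewrite gt_eqF.
    by rewrite lerDl mulr_ge0 ?sqr_ge0// invr_ge0 mulr_ge0// ltW.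
  rewrite ExD; [|exact: L1Z|exact: L1Z].
  rewrite !ExZ// Hc2.
  have : (2 * eta)^-1 * Ex (fun w => Dc w ^+ 2) <= (2 * eta)^-1 * eta ^+ 2.
    by rewrite ler_wpM2l// invr_ge0 mulr_ge0// ltW.
  have -> : (2 * eta)^-1 * eta ^+ 2 = eta / 2 by field; rewrite gt_eqF.
  lra.
have D0 : 0 <= Ex (fun w => Dc w ^+ 2) by apply: Ex_ge0 => w; exact: sqr_ge0.
move: HD D0 Dc2; move: (Ex (fun w => Dc w ^+ 2)) (Ex (fun w => Hc w * Dc w)) => x y.
rewrite !ler_norml => /andP[y1 y2] x0 xe; apply/andP; split; lra.
Qed.

(** The centred third moment is bounded through [(y + g)^3 <= 4 (y^3 + g^3)] with
    [|E Y| <= g = 1 + K3]. The leading 1 makes the constant at least 1, so that its powers dominate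
    the first three moments at once. *)
Definition block_cst : R := 1 + 4 * (K3 + (1 + K3) ^+ 3).
Let b := block_cst.

Let b1 : 1 <= b.
Proof. by rewrite /b /block_cst lerDl mulr_ge0// addr_ge0// exprn_ge0// addr_ge0. Qed.

Let V i w := `|Y i w - Ex (Y i)|.
Let bV i : bounded_meas (V i).
Proof. by apply: bounded_norm; apply: boundedB => //; exact: bounded_cst. Qed.
Let bX3 (f : Omega -> R) : bounded_meas f -> bounded_meas (fun w => f w ^+ 3).
Proof.
move=> bf; under [X in bounded_meas X]eq_fun do rewrite !exprS expr0 mulr1.
by apply: boundedM => //; exact: boundedM.
Qed.

Let V3 i : Ex (fun w => V i w ^+ 3) <= b - 1.
Proof.
have L3 : L1 (fun w => `|Y i w| ^+ 3) by apply/L1_bounded/bX3/bounded_norm.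
have e1 : `|Ex (Y i)| <= 1 + K3.
  apply: (@le_trans _ _ (Ex (fun w => 1 + `|Y i w| ^+ 3))).
    apply: Ex_abs_le; [exact: L1_bounded|by apply: L1D => //; exact: L1_cst|].
    move=> w; have := normr_ge0 (Y i w); move: `|Y i w| => y y0.
    have [y1|y1] := leP y 1; first by have := exprn_ge0 3 y0; lra.
    by have := exprn_ege1 2 (ltW y1); rewrite exprS; nra.
  rewrite ExD; [|exact: L1_cst|exact: L3].
  by rewrite Ex_cst lerD2l.
apply: (@le_trans _ _ (Ex (fun w => 4 * (`|Y i w| ^+ 3 + (1 + K3) ^+ 3)))).
  apply: Ex_le.
  - by apply/L1_bounded/bX3.
  - by apply: L1Z; apply: L1D => //; exact: L1_cst.
  - move=> w; rewrite /V.
    have : `|Y i w - Ex (Y i)| <= `|Y i w| + (1 + K3).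
      by apply: le_trans (ler_normB _ _) _; rewrite lerD2l.
    have := normr_ge0 (Y i w); have := normr_ge0 (Y i w - Ex (Y i)).
    move: `|Y i w - Ex (Y i)| `|Y i w| (1 + K3) (le_trans (normr_ge0 _) e1) => v y g g0 v0 y0 vyg.
    apply: (@le_trans _ _ ((y + g) ^+ 3)); first by rewrite lerXn2r// nnegrE addr_ge0.
    have : 0 <= 3 * (y + g) * (y - g) ^+ 2 by apply: mulr_ge0; [apply: mulr_ge0 => //; exact: addr_ge0|exact: sqr_ge0].
    lra.
rewrite ExZ; last by apply: L1D => //; exact: L1_cst.
rewrite ExD//; last exact: L1_cst.
by rewrite Ex_cst /b /block_cst addrAC subrr add0r ler_pM2l// lerD2r.
Qed.

Let a := b / sig.

Let pow_le (x : R) : 0 <= x -> x <= 1 + x ^+ 3 /\ x ^+ 2 <= 1 + x ^+ 3.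
Proof.
move=> x0; have [x1|x1] := leP x 1.
  have := exprn_ge0 3 x0; have : x ^+ 2 <= 1 by rewrite exprn_ile1.
  by split; lra.
have := exprn_ege1 2 (ltW x1); split; first by rewrite [x ^+ 3]exprS; nra.
by rewrite [x ^+ 3]exprS; nra.
Qed.

Let Vpow i (p : nat) : p \in [:: 1; 2; 3]%N -> Ex (fun w => V i w ^+ p) <= b ^+ p.
Proof.
move=> hp; have bp : b <= b ^+ p.
  by move: hp; rewrite !inE => /or3P[] /eqP ->; exact: ler_eXnr.
apply: le_trans bp.
have L3 : L1 (fun w => V i w ^+ 3) by exact/L1_bounded/bX3.
apply: (@le_trans _ _ (Ex (fun w => 1 + V i w ^+ 3))); last first.
  by rewrite ExD//; [rewrite Ex_cst; have := V3 i; lra|exact: L1_cst].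
apply: Ex_le; last 1 first.
- move=> w; have := pow_le (normr_ge0 (Y i w - Ex (Y i))); rewrite -/(V i w) => -[v1 v2].
  by move: hp; rewrite !inE => /or3P[] /eqP ->; rewrite ?expr1//; lra.
- move: hp; rewrite !inE => /or3P[] /eqP ->.
  + by under [X in L1 X]eq_fun do rewrite expr1; exact: L1_bounded.
  + by apply: L1_bounded; under [X in bounded_meas X]eq_fun do rewrite expr2; exact: boundedM.
  + exact: L3.
- by apply: L1D => //; exact: L1_cst.
Qed.

Let Upow i (p : nat) : p \in [:: 1; 2; 3]%N -> Ex (fun w => `|U i w| ^+ p) <= a ^+ p.
Proof.
move=> hp; have s0 : 0 < sig^-1 by rewrite invr_gt0.
have -> : (fun w => `|U i w| ^+ p) = (fun w => sig^-1 ^+ p * V i w ^+ p).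
  by apply/funext => w; rewrite /U normrM (gtr0_norm s0) exprMn mulrC.
rewrite ExZ.
  by rewrite /a exprMn mulrC ler_wpM2r ?exprn_ge0 ?(ltW s0)//; exact: Vpow.
move: hp; rewrite !inE => /or3P[] /eqP ->.
- by under [X in L1 X]eq_fun do rewrite expr1; exact: L1_bounded.
- by apply: L1_bounded; under [X in bounded_meas X]eq_fun do rewrite expr2; exact: boundedM.
- exact/L1_bounded/bX3.
Qed.

Lemma Ex_lipschitz_dist h (f g : Omega -> R) : lipschitz1 h -> L1 f -> L1 g ->
  `|Ex (fun w => h (f w)) - Ex (fun w => h (g w))| <= Ex (fun w => `|f w - g w|).
Proof.
move=> hl hf hg.
have Lh u : L1 u -> L1 (fun w => h (u w)).
  move=> hu; apply: (@L1_dominated _ _ _ _ _ (fun w => `|h 0| + `|u w|)).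
  - exact: measurableT_comp (lipschitz1_measurable hl) (L1_measurable hu).
  - by move=> w; exact: lipschitz1_growth.
  - by apply: L1D; [exact: L1_cst|exact: L1_norm].
rewrite -ExB; [|exact: Lh|exact: Lh].
apply: Ex_abs_le; [by apply: L1B; exact: Lh|by apply: L1_norm; exact: L1B|].
by move=> w; exact: hl.
Qed.

Definition approx_cst : R := 5 + normal_abs_mean R + 6 * C.

Lemma truncated_sum_normal_approx h : lipschitz1 h ->
  `|Ex (fun w => h (Hc w)) - normal_mean h| <=
  approx_cst * (eta + n ^+ 2 * kap + n * (m%:R ^+ 2 * (block_cst / sig) ^+ 3)).
Proof.
move=> hl; have C1 := stein_bound_ge1 R; rewrite -/C in C1.
have A0 := normal_abs_mean_ge0 R.
have [h1 h2] := LHc; have [d1 d2] := LDc.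
have a0 : 0 <= a by rewrite /a divr_ge0// ?ltW//; apply: lt_le_trans b1.
have Q0 : 0 <= n ^+ 2 * kap by rewrite mulr_ge0// exprn_ge0// ltW.
have S0 : 0 <= n * (m%:R ^+ 2 * a ^+ 3).
  by apply: mulr_ge0; [exact: ltW|apply: mulr_ge0; exact: exprn_ge0].
rewrite -/b -/a; set Q := n ^+ 2 * kap in Q0 *.
set S := n * (m%:R ^+ 2 * a ^+ 3) in S0 *.
have QS : 0 <= approx_cst * (Q + S) by rewrite mulr_ge0 /approx_cst; lra.
(* For [eta > 1] the claim follows from the trivial bound [1 + E |Z|]. What remains is [eta <= 1],
   where the variance defect [2 eta + eta^2] is at most [3 eta]. *)
have [eta1|eta1] := leP eta 1; last first.
  clearbody Q S; suff h3 : `|Ex (fun w => h (Hc w)) - normal_mean h| <= 1 + normal_abs_mean R.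
    by rewrite /approx_cst in QS *; nra.
  have g1 : `|Ex (fun w => h (Hc w)) - Ex (fun=> h 0)| <= 1.
    apply: le_trans (Ex_lipschitz_dist hl h1 (L1_cst _ 0)) _.
    apply: (@le_trans _ _ (Ex (fun w => 2^-1 * (1 + Hc w ^+ 2)))).
      apply: Ex_le.
      - by apply: L1_norm; apply: L1B => //; exact: L1_cst.
      - by apply: L1Z; apply: L1D => //; exact: L1_cst.
      - move=> w; rewrite subr0 -[Hc w ^+ 2]real_normK ?num_real//.
        by have := sqr_ge0 (1 - `|Hc w|); lra.
    rewrite ExZ; last by apply: L1D => //; exact: L1_cst.
    by rewrite ExD ?Ex_cst ?Hc2//; [lra|exact: L1_cst].
  rewrite Ex_cst in g1; have g2 := normal_mean_dist0 hl.
  have -> : Ex (fun w => h (Hc w)) - normal_mean h =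
    (Ex (fun w => h (Hc w)) - h 0) + (h 0 - normal_mean h) by lra.
  by apply: le_trans (ler_normD _ _) _; lra.
have LW : L1 W by apply: L1_bounded; exact: bounded_sum.
have g1 : `|Ex (fun w => h (Hc w)) - Ex (fun w => h (W w))| <= eta.
  apply: le_trans (Ex_lipschitz_dist hl h1 LW) _; apply: le_trans Ex_Dc.
  by under eq_Ex do rewrite WE opprB addrC subrK.
have C0 : 0 <= C by lra.
have U1 i : Ex (fun w => `|U i w|) <= a by have := @Upow i 1 isT; rewrite !expr1.
have U2 i : Ex (fun w => U i w ^+ 2) <= a ^+ 2.
  by have := @Upow i 2 isT; under eq_Ex do rewrite real_normK ?num_real//.
have U3 i : Ex (fun w => `|U i w| ^+ 3) <= a ^+ 3 by exact: Upow.
have g2 := dependency_normal_approx bU NN' cN' a0 C0 kap0 U1 U2 U3 far_mean far_cov far_pair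
  erefl hl.
rewrite -/W -/n -/Q -/S in g2; clearbody Q S.
have g3 : C * `|Ex (fun w => W w ^+ 2) - 1| <= C * (3 * eta).
  rewrite ler_wpM2l//; apply: le_trans varW _; have := eta0; nra.
have -> : Ex (fun w => h (Hc w)) - normal_mean h =
   (Ex (fun w => h (Hc w)) - Ex (fun w => h (W w))) + (Ex (fun w => h (W w)) - normal_mean h) by lra.
apply: le_trans (ler_normD _ _) _; apply: le_trans (lerD g1 g2) _.
have e0 := eta0.
have : 0 <= normal_abs_mean R * (eta + Q + S) by rewrite mulr_ge0//; lra.
have : 0 <= C * Q by rewrite mulr_ge0.
have : 0 <= C * S by rewrite mulr_ge0.
have : 0 <= C * eta by rewrite mulr_ge0// ltW.
rewrite /approx_cst; lra.
Qed.

End variables.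
End truncated_sum.

(** * Decay of dependence *)

Section decay_of_dependence.
Context {R : realType} {d : nat} {dM : measure_display} {M : measurableType dM}
  {dO : measure_display} {Omega : measurableType dO}.
Variables (P : probability Omega R) (hP : {RV P >-> mconf R d M}).
Local Notation E := (euclid R d).
Local Notation conf := (mconf R d M).
Hypothesis hd : (0 < d)%N.
Variables (th0 th1 th2 th3 : R).
Hypotheses (h0 : 0 <= th0) (h1 : 0 < th1) (h2 : 0 < th2) (h3 : 0 < th3).

Definition EDD_with : Prop := forall A B : set E, measurable A -> measurable B ->
  A !=set0 -> B !=set0 -> bounded_set A -> bounded_set B ->
  th3 * Num.max (ln (Num.max (diam A) (diam B))) 1 <= setdist A B ->
  (dTV (pushforward P (fun w => restr (A `|` B) (hP w)))
       (pushforward (P \x P)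
          (fun w => lfU (restr A (hP w.1)) (restr B (hP w.2)))) <=
   (th1 * Num.max (diam A `^ th0) 1 * Num.max (diam B `^ th0) 1
        * expR (- th2 * setdist A B))%:E)%E.

Hypothesis hE : EDD_with.

(** The exterior of a ball is cut off by a large ball, since the decay condition concerns bounded
    sets and its bound grows with their diameter. *)
Definition outer_shell (c : E) (rho Lq : R) : set E := ~` norm_ball c rho `&` norm_ball 0 Lq.

Lemma measurable_outer_shell c rho Lq : measurable (outer_shell c rho Lq).
Proof.
apply: measurableI; last exact: measurable_norm_ball.
by apply: measurableC; exact: measurable_norm_ball.
Qed.

Definition EDD_error (D s : R) : R := th1 * D `^ th0 * D `^ th0 * expR (- th2 * s).

Let ln_max (D x y : R) : 1 <= D -> 0 <= x -> 0 <= y -> x <= D -> y <= D ->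
  ln (Num.max x y) <= ln D.
Proof.
move=> D1 x0 y0 xD yD; have [m0|m0] := ltP 0 (Num.max x y).
  by rewrite ler_ln ?posrE// ?ge_max ?xD ?yD//; apply: lt_le_trans D1.
by rewrite ln0// ln_ge0.
Qed.

Lemma EDD_covariance (c : E) (rho1 rho2 s Lq a b : R) (F G : conf -> R) :
  0 < rho1 -> 0 < s -> s <= rho2 - rho1 -> `|c| + rho2 < Lq ->
  1 <= d%:R * (2 * Lq) -> th3 * Num.max (ln (d%:R * (2 * Lq))) 1 <= s ->
  measurable_fun setT F -> measurable_fun setT G -> 0 < a -> 0 < b ->
  (forall X, `|F X| <= a) -> (forall X, `|G X| <= b) ->
  `|Ex P (fun w => F (restr (norm_ball c rho1) (hP w)) *
                   G (restr (outer_shell c rho2 Lq) (hP w))) -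
    Ex P (fun w => F (restr (norm_ball c rho1) (hP w))) *
    Ex P (fun w => G (restr (outer_shell c rho2 Lq) (hP w)))| <=
  2 * (a * b) * EDD_error (d%:R * (2 * Lq)) s.
Proof.
move=> r10 s0 srho cL D1 hs mF mG a0 b0 Fa Gb.
set A := norm_ball c rho1; set B := outer_shell c rho2 Lq; set D := d%:R * (2 * Lq).
have rho20 : 0 <= rho2 by lra.
have Ac : A c by rewrite /A /norm_ball/= subrr normr0.
have An0 : A !=set0 by exists c.
have Bn0 : B !=set0.
  (* In positive dimension this vector has sup norm exactly [rho2], so [c + v] lies outside the open
     inner ball. *)
  pose v : E := const_mx rho2; exists (c + v); split.
    rewrite /norm_ball/= [c + v]addrC addrK => /(le_lt_trans (norm_coord_le v (Ordinal hd))).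
    by rewrite mxE ger0_norm// ltxx.
  rewrite /norm_ball/= subr0; apply: le_lt_trans cL; apply: le_trans (ler_normD _ _) _.
  rewrite lerD2l; apply: norm_le_coord => // i; by rewrite mxE ger0_norm.
have Asub x : A x -> `|x - 0| <= Lq.
  rewrite /A /norm_ball/= subr0 => xc; rewrite -(subrK c x).
  by apply: le_trans (ler_normD _ _) _; lra.
have Bsub x : B x -> `|x - 0| <= Lq by move=> [_]; rewrite /norm_ball/= => /ltW.
have bA : bounded_set A by apply: (@bounded_set_le _ _ _ Lq) => x /Asub; rewrite subr0.
have bB : bounded_set B by apply: (@bounded_set_le _ _ _ Lq) => x /Bsub; rewrite subr0.
have dA : diam A <= D by exact: diam_le An0 Asub.
have dB : diam B <= D by exact: diam_le Bn0 Bsub.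
have sAB : s <= setdist A B.
  apply: setdist_ge => // x y Ax [/negP]; rewrite -leNgt => By _.
  apply: le_trans srho _; rewrite /A /norm_ball/= in Ax.
  have -> : x - y = (x - c) - (y - c) by rewrite opprB addrA subrK.
  have := lerB_dist (y - c) (x - c); rewrite distrC.
  by move: Ax By => a1 a2; rewrite /norm_ball/= in a2; lra.
have AB0 : A `&` B = set0.
  rewrite -subset0 => x [Ax [/negP]]; rewrite -leNgt => Bx _.
  by move: Ax; rewrite /A /norm_ball/=; lra.
apply: dTV_covariance => //; [exact: measurable_norm_ball|exact: measurable_outer_shell|].
apply: le_trans (hE _ _ _ _ _ _ _) _ => //.
- exact: measurable_norm_ball.
- exact: measurable_outer_shell.
- apply: le_trans sAB; apply: le_trans hs; rewrite ler_wpM2l ?(ltW h3)//.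
  rewrite ge_max !le_max lexx orbT andbT.
  by rewrite (ln_max D1) ?diam_ge0.
have D0 : 0 <= D by exact: le_trans ler01 D1.
have maxD x : 0 <= x -> x <= D -> Num.max (x `^ th0) 1 <= D `^ th0.
  move=> x0 xD; rewrite ge_max ge0_ler_powR ?nnegrE//=.
  by rewrite -(powRr0 D); apply: ler_powR.
rewrite lee_fin /EDD_error; apply: ler_pM.
- by rewrite mulr_ge0 ?mulr_ge0 ?(ltW h1)// le_max ler01 orbT.
- exact: expR_ge0.
- apply: ler_pM; rewrite ?maxD ?diam_ge0 ?le_max ?ler01 ?orbT//.
    by rewrite mulr_ge0 ?(ltW h1)// le_max ler01 orbT.
  by rewrite ler_wpM2l ?(ltW h1)// maxD ?diam_ge0.
- by rewrite ler_expR !mulNr lerN2 ler_pM2l.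
Qed.

End decay_of_dependence.

(** * Near independence of blocks read off local configurations *)

Section core.
Context {R : realType} {d : nat} {dM : measure_display} {M : measurableType dM}
  {dO : measure_display} {Omega : measurableType dO}.
Variables (P : probability Omega R) (hP : {RV P >-> mconf R d M}).
Local Notation E := (euclid R d).
Local Notation conf := (mconf R d M).
Hypothesis hd : (0 < d)%N.
Variables (th0 th1 th2 th3 : R).
Hypotheses (h0 : 0 <= th0) (h1 : 0 < th1) (h2 : 0 < th2) (h3 : 0 < th3).
Hypothesis hE : EDD_with hP th0 th1 th2 th3.

Lemma restr_restrS (A B : set E) (X : conf) : A `<=` B -> restr A (restr B X) = restr A X.
Proof.
move=> AB; apply: lfset_eq => /=; apply/seteqP; split => z /=; first by move=> [[]].
by move=> [Xz Az]; split => //; split => //; exact: AB.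
Qed.

Section local_functionals.
Variables (L ms : nat) (r T sig : R) (lb : @cube_index d L -> conf -> R).
Hypotheses (r1 : 1 <= r) (hms : 4 * (1 + r) <= ms%:R) (T0 : 0 < T) (sig0 : 0 < sig).
Hypotheses (mlb : forall k, measurable_fun setT (lb k)) (lbT : forall k X, `|lb k X| <= T).
Local Notation c := (@corner R d L).
Local Notation near_cubes := (@near_cubes R d L).

Let A k : set E := norm_ball (c k) (1 + r).
Definition local_value k w := lb k (restr (A k) (hP w)).
Local Notation Y := local_value.
Local Notation U := (normalized_block P Y sig).
(** Large enough for every set involved: corners lie within [L] of the origin, and the inner radius
    of a shell stays below [2 ms]. *)
Let Lq : R := L%:R + 4 * ms%:R.
Let D := d%:R * (2 * Lq).
Hypothesis hsep : th3 * Num.max (ln D) 1 <= r.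
Let C := stein_bound R.
Let u : R := 2 * T / sig.
(** One bound for three covariances, with sup bounds [u C], [u^2] and [u^2 C]: all are at most
    [(u + u^2) C] because [C >= 1]. The factor 2 is that of [dTV_covariance]. *)
Definition local_error : R := 2 * ((u + u * u) * C) * EDD_error th0 th1 th2 D r.

Lemma measurable_local_value k : measurable_fun setT (Y k).
Proof.
apply: (measurableT_comp (mlb k)); apply: measurableT_comp => //.
by apply: measurable_restr; exact: measurable_norm_ball.
Qed.

Lemma local_value_bound k w : `|Y k w| <= T. Proof. exact: lbT. Qed.

Let nlb k (X : conf) : R := (lb k (restr (A k) X) - Ex P (Y k)) / sig.

Let mnlb k : measurable_fun setT (nlb k).
Proof.
apply: measurable_funM => //; apply: measurable_funB => //.
by apply: (measurableT_comp (mlb k)); apply: measurable_restr; exact: measurable_norm_ball.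
Qed.

Let bY k : bounded_meas (Y k).
Proof. by split; [exact: measurable_local_value|exists T => w; exact: local_value_bound]. Qed.

Let nlbu k X : `|nlb k X| <= u.
Proof.
rewrite /nlb normrM (gtr0_norm (_ : 0 < sig^-1)) ?invr_gt0// /u ler_pM2r ?invr_gt0//.
have EYT : `|Ex P (Y k)| <= T.
  by apply: Ex_abs_bound; [exact: L1_bounded (bY k)|move=> w; exact: local_value_bound].
apply: le_trans (ler_normB _ _) _; have := lbT k (restr (A k) X); lra.
Qed.

Let nlbE k B w : A k `<=` B -> nlb k (restr B (hP w)) = U k w.
Proof. by move=> AB; rewrite /nlb restr_restrS. Qed.

Let r0 : 0 < 1 + r. Proof. by have := r1; lra. Qed.
Let u0 : 0 < u. Proof. by rewrite /u divr_gt0// mulr_gt0. Qed.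
Let C1 : 1 <= C. Proof. exact: stein_bound_ge1. Qed.
Let D1 : 1 <= D.
Proof.
have d1 : 1 <= d%:R :> R by rewrite ler1n.
have l0 : 0 <= L%:R :> R by [].
have q1 : 1 <= 2 * Lq by have := hms; have := r1; rewrite /Lq; lra.
by rewrite /D; nra.
Qed.

Let AinL k : A k `<=` norm_ball 0 Lq.
Proof.
move=> x; rewrite /A /norm_ball/= subr0 => xk; rewrite -(subrK (c k) x).
apply: le_lt_trans (ler_normD _ _) _.
by have := corner_norm_le (R := R) k; have := hms; have := r1; rewrite /Lq; lra.
Qed.

Let far_sub k j (rho : R) : rho <= `|c k - c j| -> A j `<=` outer_shell (c k) (rho - (1 + r)) Lq.
Proof.
move=> kj x Ax; split; last exact: (AinL Ax).
rewrite /norm_ball/= => xk; move: Ax; rewrite /A /norm_ball/= => xj.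
have : `|c k - c j| <= `|x - c k| + `|x - c j|.
  have -> : c k - c j = - (x - c k) + (x - c j) by rewrite opprB addrA subrK.
  by rewrite -[`|x - c k|]normrN; exact: ler_normD.
lra.
Qed.

Let Gsum (S : {set @cube_index d L}) (f : R -> R) (X : conf) : R := f (\sum_(j in ~: S) nlb j X).

Let mGsum S f : measurable_fun setT f -> measurable_fun setT (Gsum S f).
Proof.
move=> mf; apply: (measurableT_comp mf).
have -> : (fun X => \sum_(j in ~: S) nlb j X) = (fun X => \sum_(j <- enum (~: S)) nlb j X).
  by apply/funext => X; rewrite big_enum.
by apply: measurable_sum => j; exact: mnlb.
Qed.

Let GsumE (S : {set @cube_index d L}) (f : R -> R) (B : set E) (w : Omega) : (forall j, j \notin S -> A j `<=` B) ->
  Gsum S f (restr B (hP w)) = f (outer_sum U S w).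
Proof.
move=> h; rewrite /Gsum /outer_sum; congr f; apply: eq_bigr => j.
by rewrite inE => /h; exact: nlbE.
Qed.

Let notin_near k j (m : nat) : j \notin near_cubes k m -> m%:R <= `|c k - c j|.
Proof. by rewrite inE -leNgt. Qed.

Let err0 : 0 <= EDD_error th0 th1 th2 D r.
Proof. by rewrite /EDD_error !mulr_ge0 ?powR_ge0 ?expR_ge0// ltW. Qed.

Let cnorm k := corner_norm_le (R := R) (k : @cube_index d L).
Let ms0 : 8 <= ms%:R :> R. Proof. by have := hms; have := r1; lra. Qed.
Let rms : 4 + 4 * r <= ms%:R. Proof. by have := hms; lra. Qed.

(** A block reads the points within [1 + r] of its corner, and blocks outside [near_cubes k ms] read
    points beyond [ms - (1 + r)]. The gap [ms - 2 (1 + r)] is at least [r]. *)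
Let covN k a b (F G : conf -> R) : measurable_fun setT F -> measurable_fun setT G ->
  0 < a -> 0 < b -> (forall X, `|F X| <= a) -> (forall X, `|G X| <= b) ->
  `|Ex P (fun w => F (restr (norm_ball (c k) (1 + r)) (hP w)) *
                   G (restr (outer_shell (c k) (ms%:R - (1 + r)) Lq) (hP w))) -
    Ex P (fun w => F (restr (norm_ball (c k) (1 + r)) (hP w))) *
    Ex P (fun w => G (restr (outer_shell (c k) (ms%:R - (1 + r)) Lq) (hP w)))| <=
  2 * (a * b) * EDD_error th0 th1 th2 D r.
Proof.
move=> mF mG a0 b0 Fa Gb; have := cnorm k; have := rms; have := ms0; have := r1 => r1' m0 m1 ck.
by apply: (EDD_covariance hd h0 h1 h2 h3 hE) => //; rewrite /Lq; lra.
Qed.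

(** The inner functional now involves two nearby blocks, hence the radius [ms + (1 + r)]; doubling
    the neighbourhood restores the same gap. *)
Let covN' k a b (F G : conf -> R) : measurable_fun setT F -> measurable_fun setT G ->
  0 < a -> 0 < b -> (forall X, `|F X| <= a) -> (forall X, `|G X| <= b) ->
  `|Ex P (fun w => F (restr (norm_ball (c k) (ms%:R + (1 + r))) (hP w)) *
                   G (restr (outer_shell (c k) ((2 * ms)%:R - (1 + r)) Lq) (hP w))) -
    Ex P (fun w => F (restr (norm_ball (c k) (ms%:R + (1 + r))) (hP w))) *
    Ex P (fun w => G (restr (outer_shell (c k) ((2 * ms)%:R - (1 + r)) Lq) (hP w)))| <=
  2 * (a * b) * EDD_error th0 th1 th2 D r.
Proof.
move=> mF mG a0 b0 Fa Gb; have := cnorm k; have := rms; have := ms0; have := r1 => r1' m0 m1 ck.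
by apply: (EDD_covariance hd h0 h1 h2 h3 hE) => //; rewrite ?natrM /Lq; lra.
Qed.

Let meanU (k : @cube_index d L) : Ex P (U k) = 0.
Proof.
rewrite /normalized_block; under eq_Ex do rewrite mulrC.
have LY := L1_bounded P (bY k).
rewrite ExZ; last by apply: L1B => //; exact: L1_cst.
by rewrite ExB ?Ex_cst ?subrr ?mulr0//; exact: L1_cst.
Qed.

Let near_sub k j : j \in near_cubes k ms -> A j `<=` norm_ball (c k) (ms%:R + (1 + r)).
Proof.
rewrite inE => kj x; rewrite /A /norm_ball/= => xj.
have -> : x - c k = (x - c j) - (c k - c j) by rewrite opprB addrA subrK.
by apply: le_lt_trans (ler_normB _ _) _; lra.
Qed.

Let self_near k : k \in near_cubes k ms.
Proof. by rewrite inE subrr normr0; have := ms0; lra. Qed.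

Let le_error (x : R) : x <= (u + u * u) * C ->
  2 * x * EDD_error th0 th1 th2 D r <= local_error.
Proof. by move=> h; rewrite /local_error ler_wpM2r ?err0// ler_pM2l. Qed.

Let uC1 : u * C <= (u + u * u) * C.
Proof. by rewrite ler_wpM2r ?(le_trans ler01 C1)// lerDl mulr_ge0// ltW ?u0. Qed.
Let uC2 : u * u * C <= (u + u * u) * C.
Proof. by rewrite ler_wpM2r ?(le_trans ler01 C1)// lerDr ltW ?u0. Qed.
Let uC3 : u * u <= (u + u * u) * C.
Proof. by apply: le_trans uC2; rewrite ler_peMr ?C1// mulr_ge0// ltW ?u0. Qed.
Let C0 : 0 < C. Proof. exact: lt_le_trans ltr01 C1. Qed.

(** Since [U k] is centred, the product of expectations vanishes and the covariance bound is a bound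
    on the expectation of the product. *)
Lemma local_far_mean (k : @cube_index d L) (f : R -> R) : measurable_fun setT f -> (forall x, `|f x| <= C) ->
  `|Ex P (fun w => U k w * f (outer_sum U (near_cubes k ms) w))| <= local_error.
Proof.
move=> mf fC; apply: le_trans (le_error uC1).
have := @covN k u C (nlb k) (Gsum (near_cubes k ms) f) (mnlb k) (mGsum _ mf) u0 C0
  (nlbu k) (fun X => fC _).
under [X in `|X - _| <= _ -> _]eq_Ex => w.
  rewrite nlbE// GsumE; last by move=> j /notin_near; exact: far_sub.
  over.
under [X in `|_ - X * _| <= _ -> _]eq_Ex => w do rewrite nlbE//.
by rewrite [X in _ - X * _](meanU k) mul0r subr0.
Qed.

Lemma local_far_pair k j : j \notin near_cubes k ms ->
  `|Ex P (fun w => U k w * U j w)| <= local_error.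
Proof.
move=> kj; apply: le_trans (le_error uC3).
have := @covN k u u (nlb k) (nlb j) (mnlb k) (mnlb j) u0 u0 (nlbu k) (nlbu j).
under [X in `|X - _| <= _ -> _]eq_Ex => w.
  rewrite nlbE// nlbE; last by move/notin_near : kj; exact: far_sub.
  over.
under [X in `|_ - X * _| <= _ -> _]eq_Ex => w do rewrite nlbE//.
by rewrite [X in _ - X * _](meanU k) mul0r subr0.
Qed.

Lemma local_far_cov k j (g : R -> R) : j \in near_cubes k ms ->
  measurable_fun setT g -> (forall x, `|g x| <= C) ->
  `|Ex P (fun w => U k w * U j w * g (outer_sum U (near_cubes k (2 * ms)) w)) -
    Ex P (fun w => U k w * U j w) *
    Ex P (fun w => g (outer_sum U (near_cubes k (2 * ms)) w))| <= local_error.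
Proof.
move=> kj mg gC; apply: le_trans (le_error uC2).
have mF : measurable_fun setT (fun X => nlb k X * nlb j X) by exact: measurable_funM.
have Fu X : `|nlb k X * nlb j X| <= u * u by rewrite normrM; apply: ler_pM => //; exact: nlbu.
have uu0 : 0 < u * u by rewrite mulr_gt0 ?u0.
have := @covN' k (u * u) C _ (Gsum (near_cubes k (2 * ms)) g) mF (mGsum _ mg) uu0 C0
  Fu (fun X => gC _).
under [X in `|X - _| <= _ -> _]eq_Ex => w.
  rewrite (nlbE _ (near_sub (self_near k))) (nlbE _ (near_sub kj)).
  rewrite GsumE; last by move=> i /notin_near; exact: far_sub.
  over.
under [X in `|_ - X * _| <= _ -> _]eq_Ex => w.
  rewrite (nlbE _ (near_sub (self_near k))) (nlbE _ (near_sub kj)).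
  over.
under [X in `|_ - _ * X| <= _ -> _]eq_Ex => w.
  rewrite GsumE; last by move=> i /notin_near; exact: far_sub.
  over.
by [].
Qed.

Lemma local_error_ge0 : 0 <= local_error.
Proof.
rewrite /local_error mulr_ge0 ?err0// mulr_ge0// mulr_ge0 ?(ltW C0)//.
by have := ltW u0; clear => h; rewrite addr_ge0// mulr_ge0.
Qed.

End local_functionals.
End core.

(** * Block sums and rates *)

Section nonnegative_expectation.
Context {R : realType} {dO : measure_display} {Omega : measurableType dO}.
Variable P : probability Omega R.

Lemma L1_ge0 (f : Omega -> R) (b : R) : measurable_fun setT f ->
  (forall w, 0 <= f w) -> (\int[P]_w (f w)%:E <= b%:E)%E -> L1 P f /\ Ex P f <= b.
Proof.
move=> mf f0 fb.
have lf : L1 P f.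
  apply/integrableP; split; first exact/measurable_EFinP.
  under eq_integral do rewrite /= ger0_norm//.
  by apply: le_lt_trans fb _; rewrite ltry.
by split => //; rewrite -lee_fin EFin_Ex.
Qed.

End nonnegative_expectation.

(** * Truncation at a level and its cost in moments *)

Section truncation.
Context {R : realType}.
Implicit Types (x y T p : R).

Definition clamp T x : R := Num.max (- T) (Num.min x T).

Lemma clamp_bound T x : 0 <= T -> `|clamp T x| <= T.
Proof.
move=> T0; rewrite ler_norml /clamp le_max lexx/= ge_max ge_min lexx orbT andbT.
by lra.
Qed.

Lemma clamp_id T x : `|x| <= T -> clamp T x = x.
Proof.
by rewrite ler_norml => /andP[x1 x2]; rewrite /clamp min_l// max_r.
Qed.

Lemma norm_clamp_le T x : 0 <= T -> `|clamp T x| <= `|x|.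
Proof.
move=> T0; rewrite /clamp; case: (leP x T) => xT.
  case: (leP (- T) x) => // xT'; rewrite normrN (ger0_norm T0).
  by rewrite ltr0_norm; lra.
by rewrite max_r; [rewrite ger0_norm// gtr0_norm; lra|lra].
Qed.

Lemma clamp_dist T x : 0 <= T -> `|x - clamp T x| <= `|x|.
Proof.
move=> T0; rewrite /clamp; have [xT|xT] := leP x T.
  have [h|h] := leP (- T) x; first by rewrite subrr normr0.
  by rewrite ler_norml ltr0_norm; lra.
have [h|h] := leP (- T) T; last by lra.
by rewrite ler_norml gtr0_norm; lra.
Qed.

Lemma measurable_clamp T : measurable_fun setT (clamp T).
Proof. by apply: measurable_maxr => //; exact: measurable_minr. Qed.

Lemma sqr_le_powR T x p : 0 < T -> 2 <= p -> T < `|x| ->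
  x ^+ 2 <= `|x| `^ p * T `^ (2 - p).
Proof.
move=> T0 p2 Tx; have x0 : 0 < `|x| by exact: lt_trans Tx.
rewrite -[x ^+ 2]real_normK ?num_real//.
have -> : `|x| `^ p = `|x| ^+ 2 * `|x| `^ (p - 2).
  rewrite -powR_mulrn ?(ltW x0)// -powRD; last by rewrite (gt_eqF x0) implybT.
  by congr (_ `^ _); lra.
rewrite -mulrA ler_peMr ?sqr_ge0//.
have -> : 2 - p = - (p - 2) by rewrite opprB.
rewrite powRN ler_pdivlMr ?powR_gt0// mul1r.
by apply: ge0_ler_powR; rewrite ?nnegrE ?subr_ge0// ltW.
Qed.

(* [b] stands for the indicator of the event on which [y] fails to be the
   truncation of [x]. *)
Lemma truncation_error T x y p (b : bool) : 0 < T -> 2 <= p -> `|y| <= T ->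
  (~~ b -> y = clamp T x) ->
  (x - y) ^+ 2 <= 2 * T `^ (2 - p) * `|x| `^ p + 4 * T ^+ 2 * b%:R.
Proof.
move=> T0 p2 yT; have X0 : 0 <= `|x| `^ p * T `^ (2 - p) by rewrite mulr_ge0 ?powR_ge0.
have big := @sqr_le_powR T x p T0 p2.
have sqx : x ^+ 2 = `|x| ^+ 2 by rewrite real_normK ?num_real.
have -> : 2 * T `^ (2 - p) * `|x| `^ p = 2 * (`|x| `^ p * T `^ (2 - p)) by lra.
move: (`|x| `^ p * T `^ (2 - p)) X0 big => X X0 big.
case: b => [_|/(_ isT) ->]; rewrite ?mulr1 ?mulr0 ?addr0.
  have h : (x - y) ^+ 2 <= 2 * x ^+ 2 + 2 * T ^+ 2.
    have : y ^+ 2 <= T ^+ 2.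
      by rewrite -[y ^+ 2]real_normK ?num_real// ler_sqr ?nnegrE// ltW.
    by have := sqr_ge0 (x + y); lra.
  have [xT|/big] := leP `|x| T; last by have := sqr_ge0 T; lra.
  have : x ^+ 2 <= T ^+ 2 by rewrite sqx ler_sqr ?nnegrE// ltW.
  by lra.
have [xT|xT] := leP `|x| T; first by rewrite clamp_id// subrr expr0n/=; lra.
apply: (@le_trans _ _ (x ^+ 2)); last by have := big xT; lra.
have := clamp_dist x (ltW T0).
by move=> h; rewrite sqx -(real_normK (num_real (x - clamp T x))) ler_sqr ?nnegrE.
Qed.

Lemma cube_le_powR x p : 0 <= x -> 3 <= p -> x ^+ 3 <= 1 + x `^ p.
Proof.
move=> x0 p3; have [x1|x1] := leP x 1.
  by apply: (@le_trans _ _ 1); [rewrite exprn_ile1|rewrite lerDl powR_ge0].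
rewrite -powR_mulrn//; apply: (@le_trans _ _ (x `^ p)); last by rewrite lerDr.
by rewrite ler_powR// ltW.
Qed.

Lemma sqr_le_1powR x p : 0 <= x -> 2 <= p -> x ^+ 2 <= 1 + x `^ p.
Proof.
move=> x0 p3; have [x1|x1] := leP x 1.
  by apply: (@le_trans _ _ 1); [rewrite exprn_ile1|rewrite lerDl powR_ge0].
rewrite -powR_mulrn//; apply: (@le_trans _ _ (x `^ p)); last by rewrite lerDr.
by rewrite ler_powR// ltW.
Qed.

End truncation.

Section truncation.
Context {R : realType} {dO : measure_display} {Omega : measurableType dO}.
Variable P : probability Omega R.

Lemma Ex_indic (B : set Omega) (e : R) : measurable B -> (P B <= e%:E)%E ->
  L1 P (\1_B : Omega -> R) /\ Ex P (\1_B : Omega -> R) <= e.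
Proof.
move=> mB Be; apply: L1_ge0 => //.
by rewrite integral_indic// setIT.
Qed.

(** Where [Y] is the truncation of [X], the error is paid by the [p]-th moment; elsewhere [|Y| <= T]
    and the probability [e] of the exceptional event enters. *)
Lemma truncated_moments (X Y : Omega -> R) (T p M e : R) :
  measurable_fun setT X -> measurable_fun setT Y -> 3 <= p -> 0 < T ->
  (forall w, `|Y w| <= T) -> (\int[P]_w (`|X w| `^ p)%:E <= M%:E)%E ->
  (P [set w | clamp T (X w) != Y w] <= e%:E)%E ->
  [/\ L2 P X, Ex P (fun w => (X w - Y w) ^+ 2) <= 2 * T `^ (2 - p) * M + 4 * T ^+ 2 * e &
      Ex P (fun w => `|Y w| ^+ 3) <= 1 + M + T ^+ 3 * e].
Proof.
move=> mX mY p3 T0 YT XM Be; pose B := [set w | clamp T (X w) != Y w].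
have mcX : measurable_fun setT (fun w => clamp T (X w)).
  exact: measurableT_comp (measurable_clamp T) mX.
have mB : measurable B.
  have -> : B = ~` [set w | clamp T (X w) = Y w].
    by apply/seteqP; split => w /=; [move/eqP|move=> /eqP].
  apply: measurableC; have := measurable_fun_eqr mcX mY measurableT.
  move=> /(_ [set true] I); rewrite setTI; congr measurable.
  by apply/seteqP; split => w /= /eqP.
have [LB EB] := Ex_indic mB Be.
have indB w : \1_B w = (clamp T (X w) != Y w)%:R :> R by rewrite indicE mem_setE.
have mXp : measurable_fun setT (fun w => `|X w| `^ p).
  by apply: (measurableT_comp (measurable_powR p)); exact: measurableT_comp mX.
have [Lp Ep] : L1 P (fun w => `|X w| `^ p) /\ Ex P (fun w => `|X w| `^ p) <= M.
  by apply: L1_ge0 => // w; exact: powR_ge0.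
have p2 : 2 <= p by lra.
have L1p : L1 P (fun w => 1 + `|X w| `^ p) by apply: L1D => //; exact: L1_cst.
have L2X : L2 P X.
  split; apply: (L1_dominated _ _ L1p) => //.
  - move=> w; have [X1|/ltW X1] := leP `|X w| 1; first by rewrite (le_trans X1)// lerDl powR_ge0.
    have Xp : `|X w| <= `|X w| `^ p by rewrite -[leLHS]powRr1// ler_powR//; lra.
    lra.
  - by apply: measurable_funX.
  - by move=> w; rewrite normrX; exact: sqr_le_1powR.
split=> //.
- apply: (@le_trans _ _ (Ex P (fun w => 2 * T `^ (2 - p) * `|X w| `^ p + 4 * T ^+ 2 * \1_B w))).
    apply: Ex_le.
    + have bY : bounded_meas Y by split => //; exists T.
      by case: (L2B L2X (L2_bounded P bY)).
    + by apply: L1D; apply: L1Z.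
    + move=> w; rewrite indB; apply: truncation_error => //.
      by rewrite negbK => /eqP.
  rewrite ExD; [|exact: L1Z|exact: L1Z].
  rewrite !ExZ//; apply: lerD.
    by rewrite ler_wpM2l// mulr_ge0// powR_ge0.
  by rewrite ler_wpM2l// mulr_ge0// sqr_ge0.
- apply: (@le_trans _ _ (Ex P (fun w => (1 + `|X w| `^ p) + T ^+ 3 * \1_B w))).
    apply: Ex_le.
    + apply: L1_bounded; split.
        by apply: measurable_funX; exact: measurableT_comp mY.
      exists (T ^+ 3) => w; rewrite normrX normr_id lerXn2r// nnegrE ltW//.
    + by apply: L1D => //; exact: L1Z.
    + move=> w; rewrite indB; have [eqY|neY] := eqVneq (clamp T (X w)) (Y w).
        rewrite mulr0 addr0; apply: le_trans (cube_le_powR (normr_ge0 _) p3).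
        by rewrite lerXn2r ?nnegrE// -eqY norm_clamp_le ?ltW.
      rewrite mulr1 -[leLHS]add0r; apply: lerD.
        by rewrite addr_ge0// powR_ge0.
      by rewrite lerXn2r ?nnegrE// ltW.
  rewrite ExD//; last exact: L1Z.
  rewrite ExZ// ExD ?Ex_cst//; last exact: L1_cst.
  by apply: lerD; rewrite ?lerD2l// ler_wpM2l// exprn_ge0// ltW.
Qed.
End truncation.

Section expectation_variance.
Context {R : realType} {dO : measure_display} {Omega : measurableType dO}.
Variable P : probability Omega R.

Lemma expectation_Ex (f : Omega -> R) : L1 P f -> ('E_P[f] = (Ex P f)%:E)%E.
Proof. by move=> Lf; rewrite unlock EFin_Ex. Qed.

Lemma variance_Ex (f : Omega -> R) : L2 P f ->
  ('V_P[f] = (Ex P (fun w => (f w - Ex P f) ^+ 2)%R)%:E)%E.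
Proof.
move=> Lf; rewrite /variance covariance.unlock (expectation_Ex Lf.1)/=.
have [_ L2f] := L2B Lf (L2_cst P (Ex P f)).
rewrite -expectation_Ex//; congr expectation; apply/funext => w; rewrite /= expr2//.
Qed.
End expectation_variance.

(** * Passage to the Wasserstein distance *)

Section wasserstein.
Context {R : realType}.

(** [Z] is given through its law, so [E h(Z)] is first transported to an integral against
    [normal_prob]; the rest is uniformity in [h]. *)
Lemma dW_le (dO dQ : measure_display) (Omega : measurableType dO) (OmegaQ : measurableType dQ)
  (P : probability Omega R) (Q : probability OmegaQ R) (N : Omega -> R) (Z : {RV Q >-> R}) (B : R) :
  (forall A : set R, measurable A -> distribution Q Z A = normal_prob 0 1 A) ->
  L1 P N -> (forall h, lipschitz1 h -> `|Ex P (fun w => h (N w)) - normal_mean h| <= B) ->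
  (dW P N Q Z <= B%:E)%E.
Proof.
move=> hZ LN hB; apply: ge_ereal_sup => _ [h /= hl <-].
have mh := lipschitz1_measurable hl.
have LhN : L1 P (fun w => h (N w)).
  apply: (@L1_dominated _ _ _ _ _ (fun w => `|h 0| + `|N w|)).
  - exact: measurableT_comp mh (L1_measurable LN).
  - by move=> w; exact: lipschitz1_growth.
  - by apply: L1D; [exact: L1_cst|exact: L1_norm].
have -> : 'E_P[(h \o N)]%E = (Ex P (fun w => h (N w)))%:E by rewrite -expectation_Ex.
have mhE : measurable_fun setT (EFin \o h) by exact/measurable_EFinP.
have -> : 'E_Q[(h \o Z)]%E = (normal_mean h)%:E.
  have mZ : measurable_fun setT (Z : OmegaQ -> measurableTypeR R) by exact: (measurable_funPT Z).
  have eqZ (f : measurableTypeR R -> \bar R) :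
      (\int[normal_prob 0 1]_y f y = \int[pushforward Q (Z : OmegaQ -> measurableTypeR R)]_y f y)%E.
    by apply: eq_measure_integral => A mA _; exact: (esym (hZ A mA)).
  have mh' : measurable_fun setT (EFin \o h : measurableTypeR R -> \bar R) by exact: mhE.
  have intZ : Q.-integrable setT ((EFin \o h) \o (Z : OmegaQ -> measurableTypeR R)).
    apply/integrableP; split; first exact: measurableT_comp.
    have /integrableP[_] := integrable_normal_lipschitz1 hl.
    rewrite eqZ ge0_integral_pushforward//.
    exact: measurableT_comp.
  rewrite unlock -normal_meanE// eqZ integral_pushforward//.
by rewrite -EFinB abse_EFin lee_fin; exact: hB.
Qed.

End wasserstein.

(** * Sizes of the grid, of the neighbourhoods and of the dependence error *)

Section scales.
Context {R : realType}.

Lemma powR_ge1 (x a : R) : 1 <= x -> 0 <= a -> 1 <= x `^ a.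
Proof. by move=> x1 a0; have := ler_powR x1 a0; rewrite powRr0. Qed.

(** With [x = lam^(1/d) >= 1] and [L] the integer just above [x / 2], one has [2 L <= x + 2 <= 3 x];
    this is the origin of [3^d]. *)
Lemma grid_size (d : nat) (lam : R) : (0 < d)%N -> 1 <= lam ->
  exists L : nat, [/\ 2^-1 * lam `^ d%:R^-1 < L%:R, ((2 * L) ^ d)%:R <= 3 ^+ d * lam &
    L%:R <= 2 * lam].
Proof.
move=> d0 l1; pose x := lam `^ d%:R^-1.
have x1 : 1 <= x by rewrite powR_ge1// invr_ge0.
have xd : x ^+ d = lam.
  by rewrite -powR_mulrn ?powR_ge0// /x -powRrM mulVf ?pnatr_eq0 -?lt0n// powRr1//; lra.
have xl : x <= lam by rewrite -xd; apply: ler_eXnr.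
exists (Num.truncn (2^-1 * x)).+1.
have /truncn_itv/andP[t1 t2] : 0 <= 2^-1 * x by lra.
rewrite -(@natr1 _ (Num.truncn _)) in t2 *; split; rewrite ?natrX ?natrM -?(@natr1 _ (Num.truncn _)).
- exact: t2.
- rewrite -[in leRHS]xd -exprMn lerXn2r ?nnegrE ?mulr_ge0 ?addr_ge0//; lra.
- lra.
Qed.

Lemma separation_size (r : R) : 1 <= r ->
  exists m : nat, 4 * (1 + r) <= m%:R /\ m%:R <= 9 * r.
Proof.
move=> r1; exists (Num.truncn (4 * (1 + r))).+1.
have /truncn_itv/andP[t1 t2] : 0 <= 4 * (1 + r) by lra.
by rewrite -(@natr1 _ (Num.truncn _)) in t2 *; split; lra.
Qed.

Section local_error.
Variables (d : nat) (th0 th1 th2 th3 : R).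
Hypotheses (hd : (0 < d)%N) (h0 : 0 <= th0) (h1 : 0 < th1) (h2 : 0 < th2) (h3 : 0 < th3).
Variables (lam s r g T sig : R) (L ms : nat).
Hypotheses (l1 : 1 <= lam) (s1 : 1 <= s) (r1 : 1 <= r) (rs : r <= lam `^ s) (g0 : 0 < g).
Hypotheses (Ll : L%:R <= 2 * lam) (mr : ms%:R <= 9 * r) (T0 : 0 < T) (Ts : T <= lam `^ s).
Hypothesis gsig : g <= sig.
Let D : R := d%:R * (2 * (L%:R + 4 * ms%:R)).
Let l0 : 0 < lam. Proof. exact: lt_le_trans ltr01 l1. Qed.
Let W := lam `^ s.

Lemma le_powR_self : lam <= W.
Proof. by rewrite /W -[leLHS]powRr1 ?ler_powR ?(ltW l0). Qed.

(** [2 L + 8 ms <= 4 lam + 72 r], and both [lam] and [r] are at most [lam^s]: hence 76. *)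
Lemma diameter_le : D <= 76 * d%:R * W.
Proof.
have lW := le_powR_self; rewrite /D (mulrC 76) -mulrA ler_wpM2l//.
by have := rs; have := Ll; have := mr; rewrite -/W; lra.
Qed.

(** [ln D <= (s + 1) ln lam], the extra unit in the exponent absorbing [76 d]; a multiple of
    [ln lam] is therefore a sufficient separation. *)
Lemma separation_le (K0 : R) : 76 * d%:R <= lam -> expR 1 <= lam ->
  th3 * (s + 1) <= K0 -> K0 * ln lam <= r -> th3 * Num.max (ln D) 1 <= r.
Proof.
have := l1; have := s1 => s1' l1'.
move=> dl el K0s; apply: le_trans.
have ln1 : 1 <= ln lam by rewrite -(expRK 1) ler_ln ?posrE ?expR_gt0.
apply: (@le_trans _ _ (th3 * ((s + 1) * ln lam))); last first.
  by rewrite mulrA ler_wpM2r//; lra.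
rewrite ler_wpM2l ?(ltW h3)// ge_max; apply/andP; split; last by nra.
have D0 : 0 <= D by rewrite mulr_ge0// mulr_ge0// addr_ge0// mulr_ge0.
have [D00|D00] := eqVneq D 0.
  by rewrite D00 ln0// mulr_ge0//; lra.
have Dp : 0 < D by rewrite lt0r D00.
rewrite mulrDl mul1r -ln_powR -lnM ?posrE ?powR_gt0// ler_ln//; last by rewrite posrE mulr_gt0// powR_gt0.
apply: le_trans diameter_le _; by rewrite mulrC ler_wpM2l// powR_ge0.
Qed.

Definition local_cst : R :=
  2 * ((2 / g + 4 / g ^+ 2) * stein_bound R) * (th1 * ((76 * d%:R) `^ th0) ^+ 2).

(** With [W = lam^s], the sizes of the blocks contribute [W^2], the two diameters [W^(2 th0)] and
    the exponential [lam^(- th2 K0)]: a large [K0] yields any negative power. *)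
Lemma local_error_le (K0 : R) : K0 * ln lam <= r ->
  @local_error R d th0 th1 th2 L ms r T sig <=
  local_cst * lam `^ (2 * s + 2 * s * th0 - th2 * K0).
Proof.
have := l1; have := s1; have := g0; have := gsig => gs g0' s1' l1'.
move=> K0r; have W1 : 1 <= W by have := le_powR_self; lra.
have W0 : 0 < W by lra.
have C1 := stein_bound_ge1 R; have sg0 : 0 < sig by lra.
have -> : lam `^ (2 * s + 2 * s * th0 - th2 * K0) =
    W ^+ 2 * (W `^ th0) ^+ 2 * lam `^ (- (th2 * K0)).
  rewrite powRD; last by rewrite (gt_eqF l0) implybT.
  rewrite powRD; last by rewrite (gt_eqF l0) implybT.
  have <- : lam `^ (2 * s) = W ^+ 2 by rewrite -powR_mulrn ?powR_ge0// -powRrM mulrC.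
  have <- // : lam `^ (2 * s * th0) = (W `^ th0) ^+ 2.
  by rewrite -powR_mulrn ?powR_ge0// -!powRrM; congr powR; lra.
rewrite /local_error -/D.
set u := 2 * T / sig.
have u0 : 0 < u by rewrite divr_gt0// mulr_gt0.
have uW : u <= 2 / g * W.
  rewrite /u mulrAC -!mulrA ler_pM2l//; apply: ler_pM => //; [by rewrite invr_ge0 ltW|exact: ltW|by rewrite lef_pV2].
have uu : u + u * u <= (2 / g + 4 / g ^+ 2) * W ^+ 2.
  have -> : (2 / g + 4 / g ^+ 2) * W ^+ 2 = 2 / g * W * W + (2 / g * W) * (2 / g * W).
    by field; rewrite gt_eqF.
  apply: lerD; last by apply: ler_pM => //; exact: ltW.
  by apply: le_trans uW _; apply: ler_peMr => //; rewrite !mulr_ge0 ?invr_ge0 ?ltW.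
have eE : expR (- th2 * r) <= lam `^ (- (th2 * K0)).
  rewrite /powR gt_eqF// ler_expR !mulNr lerN2 -mulrA ler_wpM2l//; exact: ltW.
have D0 : 0 <= D by rewrite mulr_ge0// mulr_ge0// addr_ge0// mulr_ge0.
have DW : D `^ th0 <= (76 * d%:R) `^ th0 * W `^ th0.
  rewrite -powRM ?mulr_ge0 ?(ltW W0)//; apply: ge0_ler_powR; rewrite ?nnegrE ?mulr_ge0 ?(ltW W0)//.
  exact: diameter_le.
rewrite /EDD_error /local_cst.
have -> : 2 * ((2 / g + 4 / g ^+ 2) * stein_bound R) * (th1 * (76 * d%:R) `^ th0 ^+ 2) *
    (W ^+ 2 * (W `^ th0) ^+ 2 * lam `^ (- (th2 * K0))) =
  2 * ((2 / g + 4 / g ^+ 2) * W ^+ 2 * stein_bound R) *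
   (th1 * ((76 * d%:R) `^ th0 * W `^ th0) * ((76 * d%:R) `^ th0 * W `^ th0) * lam `^ (- (th2 * K0))).
  by rewrite !expr2; lra.
have D0' := powR_ge0 D th0; have e0 := expR_ge0 (- th2 * r).
have uu0 : 0 <= u + u * u by have u0' := ltW u0; apply: addr_ge0 => //; exact: mulr_ge0.
have C0 : 0 <= stein_bound R by lra.
have h1' := ltW h1.
apply: ler_pM.
- by apply: mulr_ge0 => //; exact: mulr_ge0.
- by rewrite !mulr_ge0.
- by rewrite ler_pM2l//; exact: ler_wpM2r.
- apply: ler_pM => //; first by rewrite !mulr_ge0.
  apply: ler_pM => //; first by rewrite !mulr_ge0.
  by rewrite ler_wpM2l.
Qed.

End local_error.
End scales.

Section rates.
Context {R : realType}.

Lemma approx_cst_gt0 : 0 < (approx_cst : R).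
Proof.
by have := normal_abs_mean_ge0 R; have := stein_bound_ge1 R; rewrite /approx_cst; lra.
Qed.

Lemma block_cst_gt0 (K : R) : 0 <= K -> 0 < block_cst K.
Proof. by move=> K0; rewrite /block_cst ltr_wpDr// mulr_ge0// !addr_ge0// exprn_ge0// addr_ge0. Qed.

Lemma inv_sigma_le (sig g lam nu : R) : 0 < g -> 0 < lam -> g * lam `^ (nu / 2) <= sig ->
  sig^-1 <= g^-1 * lam `^ (- (nu / 2)).
Proof.
move=> g0 l0 h; have a0 : 0 < g * lam `^ (nu / 2) by rewrite mulr_gt0// powR_gt0.
by rewrite powRN -invfM lef_pV2 ?posrE//; apply: lt_le_trans h.
Qed.

Lemma truncation_rate (n sig g lam nu eps q tc a : R) : 0 < g -> 0 < lam -> 0 < eps -> 0 <= tc ->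
  0 <= n -> 0 < sig -> n <= a * lam -> g * lam `^ (nu / 2) <= sig ->
  n * Num.sqrt (tc * eps `^ q) / sig <=
  a * Num.sqrt tc / g * (lam * eps `^ (q / 2) * lam `^ (- (nu / 2))).
Proof.
move=> g0 l0 e0 tc0 n0 s0 na h.
rewrite sqrtrM// -(powR12_sqrt (powR_ge0 _ _)) -powRrM.
have -> : a * Num.sqrt tc / g * (lam * eps `^ (q / 2) * lam `^ (- (nu / 2))) =
  (a * lam) * (Num.sqrt tc * eps `^ (q / 2)) * (g^-1 * lam `^ (- (nu / 2))) by lra.
apply: ler_pM; [|by rewrite invr_ge0 ltW| |exact: inv_sigma_le].
  by rewrite !mulr_ge0// ?sqrtr_ge0 ?powR_ge0.
by rewrite ler_wpM2r// mulr_ge0 ?sqrtr_ge0 ?powR_ge0.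
Qed.

Lemma dependence_rate (n lam a lc e Z le : R) : 1 <= lam -> 0 <= n -> n <= a * lam -> 0 <= le ->
  le <= lc * lam `^ e -> 0 <= lc -> 2 + e <= - Z -> n ^+ 2 * le <= a ^+ 2 * lc * lam `^ (- Z).
Proof.
move=> l1 n0 na le0 lec lc0 eZ; have l0 : 0 < lam by lra.
apply: (@le_trans _ _ ((a * lam) ^+ 2 * (lc * lam `^ e))).
  by apply: ler_pM => //; [exact: sqr_ge0|rewrite lerXn2r// nnegrE// (le_trans n0)].
have -> : (a * lam) ^+ 2 * (lc * lam `^ e) = a ^+ 2 * lc * (lam ^+ 2 * lam `^ e).
  by rewrite exprMn; lra.
rewrite ler_wpM2l//; first by rewrite mulr_ge0// sqr_ge0.
rewrite -powR_mulrn ?(ltW l0)// -powRD ?(gt_eqF l0) ?implybT//.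
by rewrite ler_powR.
Qed.

(** From [ms <= 9 r] and [r >= 1], [4 ms + 1 <= 37 r]; the square of the neighbourhood size becomes
    [r^(2 d)], and the cube of [1 / sig] becomes [lam^(- 3 nu / 2)]. *)
Lemma stein_rate (n sig g lam nu a r b : R) (d ms : nat) : 0 < g -> 0 < lam -> 1 <= r ->
  0 <= n -> 0 < sig -> 0 < b -> n <= a * lam -> ms%:R <= 9 * r -> g * lam `^ (nu / 2) <= sig ->
  n * (((4 * ms).+1 ^ d)%:R ^+ 2 * (b / sig) ^+ 3) <=
  a * (37 ^+ d) ^+ 2 * (b / g) ^+ 3 * (lam * r ^+ (2 * d) * lam `^ (- (3 / 2) * nu)).
Proof.
move=> g0 l0 r1 n0 s0 b0 na mr h.
have -> : a * (37 ^+ d) ^+ 2 * (b / g) ^+ 3 * (lam * r ^+ (2 * d) * lam `^ (- (3 / 2) * nu)) =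
  (a * lam) * (((37 * r) ^+ d) ^+ 2 * (b * (g^-1 * lam `^ (- (nu / 2)))) ^+ 3).
  have -> : lam `^ (- (3 / 2) * nu) = (lam `^ (- (nu / 2))) ^+ 3.
    by rewrite -powR_mulrn ?powR_ge0// -powRrM; congr powR; lra.
  by rewrite !exprMn mulnC exprM; lra.
apply: ler_pM => //.
  by rewrite mulr_ge0 ?sqr_ge0// exprn_ge0// divr_ge0// ltW.
apply: ler_pM; rewrite ?sqr_ge0// ?exprn_ge0// ?divr_ge0 ?(ltW b0) ?(ltW s0)//.
  have m37 : (4 * ms).+1%:R <= 37 * r :> R by rewrite -(@natr1 _ (4 * ms)) natrM; lra.
  rewrite natrX lerXn2r ?nnegrE ?exprn_ge0//; first by lra.
  by rewrite lerXn2r ?nnegrE//; lra.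
rewrite lerXn2r ?nnegrE ?divr_ge0 ?(ltW b0) ?(ltW s0)//.
  by rewrite mulr_ge0 ?(ltW b0)// mulr_ge0 ?powR_ge0// invr_ge0 ltW.
by rewrite ler_pM2l//; exact: inv_sigma_le.
Qed.

Lemma sum_rates_le (a1 a2 a3 x y z : R) : 0 <= a1 -> 0 <= a2 -> 0 <= a3 ->
  0 <= x -> 0 <= y -> 0 <= z ->
  a1 * x + a2 * z + a3 * y <= (a1 + a2 + a3 + 1) * (x + y + z).
Proof.
move=> a10 a20 a30 x0 y0 z0.
have := mulr_ge0 a10 (addr_ge0 y0 z0); have := mulr_ge0 a20 (addr_ge0 x0 y0).
have := mulr_ge0 a30 (addr_ge0 x0 z0); lra.
Qed.

End rates.

(** * Moments and localisation of the score sums over cubes *)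

Section score_sums.
Context {R : realType} {d : nat} {dM : measure_display} {M : measurableType dM}
  {dO : measure_display} {Omega : measurableType dO}.
Variables (P : probability Omega R) (hP : {RV P >-> mconf R d M}).
Local Notation E := (euclid R d).
Local Notation conf := (mconf R d M).
Hypotheses (hd : (0 < d)%N) (hmarks : unique_marks hP) (hstat : stationary hP).
Variables (mu : R) (hintensity : has_intensity hP mu).
Variables (palm : R.-pker euclid R d ~> (M * mconf R d M)%type) (hpalm : is_palm hP palm).
Variables (xi : score_fun R d M) (hxi : is_score xi).
Variables (p1 p2 : R) (hp1 : 1 <= p1) (hp2 : 1 <= p2) (hp0 : 3 <= p0 p1 p2).
Hypotheses (mu0 : 0 <= mu) (hPmoment : point_moment hP p1) (hximoment : score_moment palm xi p2).

Lemma card_inE (G : set E) w : bounded_set G ->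
  card_in hP G w = (card_sum G (hP w))%:E.
Proof.
move=> bG; have := @counting_ground_shift _ _ _ _ _ _ _ hP hmarks 0 G w.
have -> : translate 0 G = G.
  by apply/seteqP; split => x; rewrite /translate /= addr0.
move=> <-//; rewrite /evaluation /card_in; congr counting.
apply/seteqP; split => x /= [h Gx]; split => //; last first.
  by case: h => y hy <-; rewrite addr0.
by exists x; rewrite ?addr0.
Qed.

Let mG1 := @measurable_Gamma R d 1.
Let bG1 := @bounded_Gamma R d 1.

Lemma card_Gamma1_mean : (\int[P]_w (card_sum (Gamma d 1) (hP w))%:E = mu%:E)%E.
Proof.
rewrite -hintensity /intensity_measure.
by apply: eq_integral => w _; rewrite card_inE.
Qed.

Lemma card_Gamma1_moment : exists2 b : R, 0 <= b &
  (\int[P]_w (card_sum (Gamma d 1) (hP w) `^ p1)%:E <= b%:E)%E.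
Proof.
have : (\int[P]_w (card_sum (Gamma d 1) (hP w) `^ p1)%:E < +oo)%E.
  have <- : (\int[P]_w `|card_in hP (Gamma d 1) w| `^ p1 =
      \int[P]_w (card_sum (Gamma d 1) (hP w) `^ p1)%:E)%E.
    apply: eq_integral => w _; rewrite card_inE// abse_EFin poweR_EFin.
    by rewrite ger0_norm// card_sum_ge0.
  rewrite -poweR_Lnorm; first exact: poweR_lty.
  by rewrite gt_eqF// (lt_le_trans _ hp1).
have : (0 <= \int[P]_w (card_sum (Gamma d 1) (hP w) `^ p1)%:E)%E.
  by apply: integral_ge0 => w _; rewrite lee_fin powR_ge0.
case: (\int[P]_w _)%E => // b b0 _; exists b => //.
Qed.

Lemma score_moment_bound : exists2 b : R, 0 <= b &
  forall (lam : R) (x : E), 0 < lam -> Gamma d lam x ->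
  (\int[palm x]_y (`|xi (x, y.1) y.2 (Gamma d lam)| `^ p2)%:E <= b%:E)%E.
Proof.
have p20 : p2 != 0 by rewrite gt_eqF// (lt_le_trans _ hp2).
move: hximoment; rewrite /score_moment; set S := ereal_sup _ => Soo.
exists (fine S `^ p2); first exact: powR_ge0.
move=> lam x lam0 Gx.
have <- : (\int[palm x]_y (`|(xi (x, y.1) y.2 (Gamma d lam))%:E| `^ p2) =
    \int[palm x]_y (`|xi (x, y.1) y.2 (Gamma d lam)| `^ p2)%:E)%E.
  by apply: eq_integral => y _; rewrite abse_EFin poweR_EFin.
rewrite -(poweR_Lnorm _ _ p20).
have NS : ('N[palm x]_(p2%:E)[(fun y => (xi (x, y.1) y.2 (Gamma d lam))%:E)] <= S)%E.
  by apply: ereal_sup_ubound; exists lam, x.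
have S0 : (0 <= S)%E by apply: le_trans NS; exact: Lnorm_ge0.
rewrite -poweR_EFin fineK ?ge0_fin_numE//.
apply: gt0_ler_poweR => //; rewrite ?in_itv/= ?leey ?andbT//.
- exact: le_trans ler01 hp2.
- exact: Lnorm_ge0.
Qed.

Section block.
Variables (C : set E) (t : E) (lam : R).
Hypotheses (lam0 : 0 < lam) (mC : measurable C) (CG : C `<=` Gamma d lam)
  (C1 : C `<=` translate t (Gamma d 1)).

Let mt := measurable_translate_Gamma1 t.
Let bt := bounded_translate_Gamma1 t.

Let bC : bounded_set C. Proof. exact: bounded_setS C1 bt. Qed.

Lemma card_sum_le (A B : set E) (X : conf) : A `<=` B -> bounded_set B ->
  card_sum A X <= card_sum B X.
Proof.
move=> AB bB; have bA := bounded_setS AB bB.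
have [s [us sP sE]] := point_sum_seq X bA; have [s' [us' sP' sE']] := point_sum_seq X bB.
rewrite /card_sum sE sE' !big_const_seq !count_predT !iter_addr_0 ler_nat.
by apply: uniq_leq_size => // z /sP[Xz Az]; apply/sP'; split => //; exact: AB.
Qed.

Lemma card_block_mean : (\int[P]_w (card_sum C (hP w))%:E <= mu%:E)%E.
Proof.
have e (D : set E) : bounded_set D ->
    (\int[P]_w (card_sum D (hP w))%:E = \int[P]_w `|card_sum D (hP w)|%:E)%E.
  by move=> bD; apply: eq_integral => w _; rewrite ger0_norm// card_sum_ge0.
rewrite -card_Gamma1_mean !e//.
have mn : measurable_fun setT (fun x : R => `|x|%:E).
  by apply/measurable_EFinP; exact: normr_measurable.
have /= <- := @shift_card_integral _ _ _ _ _ _ _ _ hmarks hstat t _ _ mG1 bG1 mt bt mn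
  (fun x => normr_ge0 x).
apply: ge0_le_integral => //.
- by apply: (measurableT_comp mn); exact: measurable_card_sum.
- by apply: (measurableT_comp mn); exact: measurable_card_sum.
- by move=> w _; rewrite lee_fin !ger0_norm ?card_sum_ge0// card_sum_le.
Qed.

Lemma card_block_moment (b : R) :
  (\int[P]_w (card_sum (Gamma d 1) (hP w) `^ p1)%:E <= b%:E)%E ->
  (\int[P]_w (card_sum C (hP w) `^ p1)%:E <= b%:E)%E.
Proof.
have p10 : 0 <= p1 by exact: le_trans ler01 hp1.
apply: le_trans.
have mp : measurable_fun setT (fun x : R => (x `^ p1)%:E).
  by apply/measurable_EFinP; exact: measurable_powR.
have /= <- := @shift_card_integral _ _ _ _ _ _ _ _ hmarks hstat t _ _ mG1 bG1 mt bt mp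
  (fun x => powR_ge0 x p1).
apply: ge0_le_integral => //.
- by move=> w _; rewrite lee_fin powR_ge0.
- by apply: (measurableT_comp mp); exact: measurable_card_sum.
- by apply: (measurableT_comp mp); exact: measurable_card_sum.
- move=> w _; rewrite lee_fin ge0_ler_powR ?nnegrE ?card_sum_ge0//.
  exact: card_sum_le.
Qed.

Definition block_sum (w : Omega) : R :=
  point_sum C (fun z => xi z (hP w) (Gamma d lam)) (hP w).

Let mxi : measurable_fun setT
  (fun zX : (E * M) * conf => xi zX.1 zX.2 (Gamma d lam)).
Proof. by case: hxi => + _; apply; exact: measurable_Gamma. Qed.

Lemma measurable_block_sum : measurable_fun setT block_sum.
Proof. exact: (measurable_hP_point_sum hP mC bC mxi). Qed.

(** [powR_sum_le] separates scores from counts: Campbell's formula controls the first part, at the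
    cost of [mu], and stationarity the [p1]-th moment of the count. *)
Lemma block_moment (b2 b1 : R) : 0 <= b2 ->
  (forall (lam : R) (x : E), 0 < lam -> Gamma d lam x ->
    (\int[palm x]_y (`|xi (x, y.1) y.2 (Gamma d lam)| `^ p2)%:E <= b2%:E)%E) ->
  (\int[P]_w (card_sum (Gamma d 1) (hP w) `^ p1)%:E <= b1%:E)%E ->
  (\int[P]_w (`|block_sum w| `^ p0 p1 p2)%:E <= (b2 * mu + b1)%:E)%E.
Proof.
move=> b20 hb2 hb1.
pose F (y : (E * M) * conf) := `|xi y.1 y.2 (Gamma d lam)| `^ p2.
have mF : measurable_fun setT F.
  apply: (measurableT_comp (measurable_powR p2)).
  exact: (measurableT_comp (@normr_measurable R setT) mxi).
pose S w := point_sum C (fun z => F (z, hP w)) (hP w).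
have mS : measurable_fun setT S by exact: measurable_hP_point_sum.
have S0 w : 0 <= S w by apply: point_sum_ge0 => // z _ _; exact: powR_ge0.
pose K w := card_sum C (hP w) `^ p1.
have mK : measurable_fun setT K.
  by apply: (measurableT_comp (measurable_powR p1)); exact: measurable_card_sum.
have h w : `|block_sum w| `^ p0 p1 p2 <= S w + K w.
  have p00 : 0 <= p0 p1 p2 by apply: le_trans hp0.
  have [s [_ _ sE]] := point_sum_seq (hP w) bC.
  rewrite /S /K /card_sum /block_sum !sE big_const_seq count_predT iter_addr_0.
  apply: le_trans (powR_sum_le hp1 hp2 hp0 s (fun z => normr_ge0 (xi z (hP w) (Gamma d lam)))).
  by rewrite ge0_ler_powR ?nnegrE ?sumr_ge0//; exact: ler_norm_sum.
apply: (@le_trans _ _ (\int[P]_w (S w + K w)%:E)%E).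
  apply: ge0_le_integral => //.
  - apply/measurable_EFinP; apply: (measurableT_comp (measurable_powR _)).
    exact: (measurableT_comp (@normr_measurable R setT) measurable_block_sum).
  - by apply/measurable_EFinP; exact: measurable_funD.
  - by move=> w _; rewrite lee_fin.
under eq_integral do rewrite EFinD.
rewrite ge0_integralD//=; first last.
- exact/measurable_EFinP.
- by move=> w _; rewrite lee_fin powR_ge0.
- exact/measurable_EFinP.
- by move=> w _; rewrite lee_fin.
rewrite EFinD; apply: leeD; last exact: card_block_moment.
apply: le_trans (palm_bound hpalm mC bC mF _ b20 _) _.
- by move=> y; exact: powR_ge0.
- by move=> x Cx; exact/hb2/CG.
- by rewrite EFinM lee_wpmul2l ?lee_fin//; exact: card_block_mean.
Qed.

Section short_range_block.
Variables (r : R) (xih : score_fun R d M) (A : set E) (T ph : R).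
Hypotheses (r0 : 0 < r) (hxih : short_range hP r xih) (mA : measurable A)
  (CA : forall x, C x -> eball x r `<=` A) (T0 : 0 <= T) (ph0 : 0 <= ph).
Hypothesis hph : forall x, Gamma d lam x ->
  (palm x [set y | xi (x, y.1) y.2 (Gamma d lam) <> xih (x, y.1) y.2 (Gamma d lam)]
   <= ph%:E)%E.

(** Scores and summation points are both read off [X], so composing with [restr A] gives a function
    of the configuration in [A] alone. *)
Definition local_block (X : conf) : R :=
  clamp T (point_sum C (fun z => xih z X (Gamma d lam)) X).

Lemma local_block_bound X : `|local_block X| <= T.
Proof. exact: clamp_bound. Qed.

Let mxih : measurable_fun setT
  (fun zX : (E * M) * conf => xih zX.1 zX.2 (Gamma d lam)).
Proof. by case: hxih => + _; apply; exact: measurable_Gamma. Qed.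

Lemma measurable_local_block : measurable_fun setT local_block.
Proof.
by apply: (measurableT_comp (measurable_clamp T)); exact: (measurable_point_sum mC bC mxih).
Qed.

Let CsubA : C `<=` A.
Proof.
move=> x Cx; apply: (CA Cx); rewrite /eball/= /Defs.edist big1 ?sqrtr0//.
by move=> i _; rewrite subrr expr0n.
Qed.

Let disagree := [set y : (E * M) * conf |
  xi y.1 y.2 (Gamma d lam) <> xih y.1 y.2 (Gamma d lam)].

Let mdisagree : measurable disagree.
Proof.
have -> : disagree = (fun y : (E * M) * conf =>
    xi y.1 y.2 (Gamma d lam) - xih y.1 y.2 (Gamma d lam)) @^-1` (~` [set 0]).
  apply/seteqP; split => y /= h e; apply: h; first by apply/eqP; rewrite -subr_eq0 e.
  by rewrite e subrr.
rewrite -[X in measurable X]setTI; apply: measurable_funB => //.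
exact: measurableC.
Qed.

(** Both [X] and [restr A X] consist of the points in the [r]-ball around [z] and of points outside
    it; the short-range property discards the latter in each case. *)
Lemma local_block_restr (X : conf) :
  (forall (z : E * M) (Y : conf), (X : set _) z -> (Y : set _) `<=` fst @^-1` (~` eball z.1 r) ->
    xih z (lfU (restr (eball z.1 r) X) Y) (Gamma d lam) =
    xih z (restr (eball z.1 r) X) (Gamma d lam)) ->
  (forall z, (X : set _) z -> C z.1 ->
     xi z X (Gamma d lam) = xih z X (Gamma d lam)) ->
  local_block (restr A X) =
  clamp T (point_sum C (fun z => xi z X (Gamma d lam)) X).
Proof.
move=> hX hz; congr clamp.
have -> : point_sum C (fun z => xih z (restr A X) (Gamma d lam)) (restr A X) =
    point_sum C (fun z => xih z (restr A X) (Gamma d lam)) X.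
  have e : (restr A X : set _) `&` fst @^-1` C = (X : set _) `&` fst @^-1` C.
    apply/seteqP; split => z /=; first by move=> [[]].
    by move=> [Xz Cz]; split => //; split => //; exact: CsubA.
  by rewrite /point_sum e.
apply: eq_point_sum => // z Xz Cz; rewrite hz//.
have E1 : X = lfU (restr (eball z.1 r) X) (restr (~` eball z.1 r) X).
  apply: lfset_eq => /=; apply/seteqP; split => y /=; last by case=> -[].
  by move=> Xy; have [] := pselect (eball z.1 r y.1) => h; [left|right].
have E2 : restr A X = lfU (restr (eball z.1 r) X) (restr (A `\` eball z.1 r) X).
  apply: lfset_eq => /=; apply/seteqP; split => y /=.
    move=> [Xy Ay]; have [] := pselect (eball z.1 r y.1) => h; [by left|right].
    by split.
  by move=> [[Xy By]|[Xy [Ay _]]]; split => //; exact: CA By.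
rewrite [in RHS]E1 [in LHS]E2 !hX//.
- by move=> y /= [].
- by move=> y /= [_ []].
Qed.

(** Almost surely, a disagreement requires a point of [C] at which the two scores differ. The number
    [S] of such points dominates the indicator, and Campbell's formula bounds its mean. *)
Lemma local_block_error :
  (P [set w | clamp T (block_sum w) != local_block (restr A (hP w))] <=
   (ph * mu)%:E)%E.
Proof.
pose S w := point_sum C (fun z => \1_disagree (z, hP w)) (hP w).
have mF : measurable_fun setT (\1_disagree : (E * M) * conf -> R).
  exact: measurable_indic.
have mS : measurable_fun setT S by exact: measurable_hP_point_sum.
have S0 w : 0 <= S w by apply: point_sum_ge0.
set B := [set w | _].
have mY : measurable_fun setT (fun w => local_block (restr A (hP w))).
  apply: (measurableT_comp measurable_local_block).
  exact: (measurableT_comp (measurable_restr mA)).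
have mB : measurable B.
  have -> : B = (fun w => clamp T (block_sum w) - local_block (restr A (hP w))) @^-1` (~` [set 0]).
    apply/seteqP; split => y /=.
      by move=> /eqP h e; apply: h; apply/eqP; rewrite -subr_eq0 e.
    by move=> h; apply/eqP => e; apply: h; rewrite e subrr.
  rewrite -[X in measurable X]setTI; apply: measurable_funB => //.
    exact: (measurableT_comp (measurable_clamp T) measurable_block_sum).
  exact: measurableC.
apply: (@le_trans _ _ (\int[P]_w (S w)%:E)%E); last first.
  apply: le_trans (palm_bound hpalm mC bC mF _ ph0 _) _ => //.
  - move=> x /CG Gx; apply: le_trans (hph Gx).
    have mx : measurable [set y : M * conf |
        xi (x, y.1) y.2 (Gamma d lam) <> xih (x, y.1) y.2 (Gamma d lam)].
      have -> : [set y : M * conf | xi (x, y.1) y.2 (Gamma d lam) <>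
          xih (x, y.1) y.2 (Gamma d lam)] = (fun y => ((x, y.1), y.2)) @^-1` disagree by [].
      have mpair : measurable_fun setT (fun y : M * conf => ((x, y.1), y.2)).
        by apply: measurable_fun_pair => //; exact: measurable_fun_pair.
      by rewrite -[X in measurable X]setTI; exact: mpair.
    have -> : (\int[palm x]_y (\1_disagree ((x, y.1), y.2))%:E =
      \int[palm x]_y (\1_[set y : M * conf | xi (x, y.1) y.2 (Gamma d lam) <>
          xih (x, y.1) y.2 (Gamma d lam)] y)%:E)%E.
      by apply: eq_integral => y _; rewrite !indicE; congr (nat_of_bool _)%:R%:E;
         apply/idP/idP; rewrite !inE.
    by rewrite integral_indic// setIT.
  - by rewrite EFinM lee_wpmul2l ?lee_fin//; exact: card_block_mean.
rewrite -[X in P X]setIT -integral_indic//.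
apply: ae_ge0_le_integral => //.
- by apply/measurable_EFinP; exact: measurable_indic.
- by move=> w _; rewrite lee_fin.
- exact/measurable_EFinP.
case: hxih => _ /(_ lam lam0); apply: filterS => w hw _.
rewrite lee_fin indicE; have [/set_mem/= Bw|_] := boolP (w \in B); last exact: S0.
have [s [us sP sE]] := point_sum_seq (hP w) bC; rewrite /S sE.
have [hs|/contrapT hs] := pselect (~ exists2 z, z \in s & disagree (z, hP w)).
  exfalso; move/eqP: Bw; apply; apply/esym; apply: local_block_restr.
    by move=> z Y; exact: hw.
  move=> z Xz Cz; apply: contrapT => zd; apply: hs; exists z => //.
  by apply/sP; split.
have [z zs zd] := hs; rewrite (big_rem z)//= indicE mem_set//= lerDl.
by apply: sumr_ge0.
Qed.

End short_range_block.
End block.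

Section core_estimate.
Variables (b1 b2 : R) (b10 : 0 <= b1) (b20 : 0 <= b2).
Hypothesis hb1 : (\int[P]_w (card_sum (Gamma d 1) (hP w) `^ p1)%:E <= b1%:E)%E.
Hypothesis hb2 : forall (lam : R) (x : E), 0 < lam -> Gamma d lam x ->
  (\int[palm x]_y (`|xi (x, y.1) y.2 (Gamma d lam)| `^ p2)%:E <= b2%:E)%E.
Let K := b2 * mu + b1.
Let K0 : 0 <= K. Proof. by rewrite addr_ge0// mulr_ge0. Qed.
Let p := p0 p1 p2.

Variables (L : nat) (lam : R) (lam0 : 0 < lam) (hL : 2^-1 * lam `^ d%:R^-1 < L%:R).
Local Notation I := (@cube_index d L).
Local Notation C k := (@cube R d L k `&` Gamma d lam).

Let mC (k : I) : measurable (C k).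
Proof. by apply: measurableI; [exact: measurable_cube|exact: measurable_Gamma]. Qed.
Let CG (k : I) : C k `<=` Gamma d lam. Proof. by move=> x []. Qed.
Let C1 (k : I) : C k `<=` translate (cube_shift k) (Gamma d 1).
Proof. by move=> x [kx _]; exact: cube_sub_translate. Qed.

Let X (k : I) := block_sum (C k) lam.
Let mX k : measurable_fun setT (X k).
Proof. exact: (measurable_block_sum lam (mC k) (@C1 k)). Qed.
Let XK k : (\int[P]_w (`|X k w| `^ p)%:E <= K%:E)%E.
Proof.
exact: (block_moment lam0 (mC k) (@CG k) (@C1 k) b20 hb2 hb1).
Qed.

Lemma H_block_sum w : H hP xi lam w = \sum_(k : I) X k w.
Proof. exact: (point_sum_cubes (fun z => xi z (hP w) (Gamma d lam)) (hP w) hL). Qed.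

(** [truncated_moments] is applied at level 1 with [Y] the truncation of [X k] itself, for which the
    exceptional event is empty. *)
Let LX k : L2 P (X k).
Proof.
have m1 := measurableT_comp (measurable_clamp (1 : R)) (mX k).
have [] // := @truncated_moments _ _ _ P (X k) (fun w => clamp 1 (X k w)) 1 p K 0 (mX k) m1 hp0 ltr01
  (fun w => clamp_bound _ ler01) (XK k).
rewrite [X in P X](_ : _ = set0) ?measure0//.
by apply/seteqP; split => w //=; rewrite eqxx.
Qed.

Lemma L2_H : L2 P (H hP xi lam).
Proof.
by rewrite (_ : H hP xi lam = fun w => \sum_k X k w); [exact: L2_sum|apply/funext => w; exact: H_block_sum].
Qed.

(** A crude bound by the square of the number of cubes, obtained from moments alone; it limits [nu]
    a priori. *)
Lemma variance_le : Ex P (fun w => (H hP xi lam w - Ex P (H hP xi lam)) ^+ 2) <=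
  ((2 * L) ^ d)%:R ^+ 2 * (1 + K).
Proof.
apply: le_trans (Ex_centered_sqr L2_H) _.
apply: (@le_trans _ _ (Ex P (fun w => ((2 * L) ^ d)%:R * \sum_k X k w ^+ 2))).
  apply: Ex_le; first by case: L2_H.
    by apply: L1Z; apply: L1_sum => k; case: (LX k).
  move=> w; rewrite H_block_sum; apply: le_trans (sqr_sum_le _) _.
  by rewrite card_ffun !card_ord.
have LS : L1 P (fun w => \sum_k X k w ^+ 2) by apply: L1_sum => k; case: (LX k).
rewrite ExZ// expr2 -mulrA ler_wpM2l// Ex_sum; last by move=> k; case: (LX k).
have -> : ((2 * L) ^ d)%:R * (1 + K) = \sum_(k : I) (1 + K).
  by rewrite sumr_const card_ffun !card_ord mulr_natl.
apply: ler_sum => k _.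
have mp : measurable_fun setT (fun w => `|X k w| `^ p).
  by apply: (measurableT_comp (measurable_powR p)); exact: measurableT_comp.
have [Lp Ep] := L1_ge0 mp (fun w => powR_ge0 _ _) (XK k).
apply: (@le_trans _ _ (Ex P (fun w => 1 + `|X k w| `^ p))).
  apply: Ex_le; [by case: (LX k)|by apply: L1D => //; exact: L1_cst|].
  move=> w; rewrite -[X k w ^+ 2]real_normK ?num_real//.
  by apply: sqr_le_1powR => //; apply: le_trans hp0; rewrite ler_nat.
by rewrite ExD ?Ex_cst ?lerD2l//; exact: L1_cst.
Qed.

Variables (r eps ph : R) (xihr : score_fun R d M) (ms : nat).
Variables (th0 th1 th2 th3 : R).
Hypotheses (h0 : 0 <= th0) (h1 : 0 < th1) (h2 : 0 < th2) (h3 : 0 < th3).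
Hypothesis hE : EDD_with hP th0 th1 th2 th3.
Hypotheses (r1 : 1 <= r) (hms : 4 * (1 + r) <= ms%:R).
Hypotheses (eps0 : 0 < eps) (eps1 : eps <= 1) (hxih : short_range hP r xihr).
Hypotheses (ph0 : 0 <= ph) (pheps : ph * mu <= eps).
Hypothesis hph : forall x : E, Gamma d lam x ->
  (palm x [set y | xi (x, y.1) y.2 (Gamma d lam) <> xihr (x, y.1) y.2 (Gamma d lam)] <= ph%:E)%E.
Hypothesis hsep : th3 * Num.max (ln (d%:R * (2 * (L%:R + 4 * ms%:R)))) 1 <= r.
Let sig := Num.sqrt (fine 'V_P[H hP xi lam]).
Hypothesis sig0 : 0 < sig.

Let T : R := eps `^ (- p^-1).
Let T0 : 0 < T. Proof. exact: powR_gt0. Qed.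
Let lb (k : I) := local_block (C k) lam xihr T.
Let Y := local_value hP r lb.
Let mlb k : measurable_fun setT (lb k).
Proof. exact: (measurable_local_block lam (mC k) (@C1 k) T hxih). Qed.
Let lbT k c : `|lb k c| <= T.
Proof. exact: (local_block_bound _ _ _ (ltW T0)). Qed.

Let Yerr k : (P [set w | clamp T (X k w) != Y k w] <= eps%:E)%E.
Proof.
apply: (@le_trans _ _ (ph * mu)%:E); last by rewrite lee_fin.
apply: (local_block_error lam0 (mC k) (@CG k) (@C1 k) T _ hxih _ _ ph0 hph).
- by apply: lt_le_trans r1.
- exact: measurable_norm_ball.
(* From the corner to [x] the sup distance is at most 1, and from [x] to [y] less than [r]: this
   explains the radius [1 + r]. *)
- move=> x [kx _] y; rewrite /eball/= => xy; rewrite /norm_ball/=.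
  have e1 := cube_norm_le kx; have e2 := le_lt_trans (norm_le_edist x y) xy.
  have -> : y - corner k = (x - corner k) - (x - y) by rewrite opprB [RHS]addrC addrA subrK.
  by apply: le_lt_trans (ler_normB _ _) _; apply: ler_ltD.
Qed.

Let q := p1bar p1 p2.
Let p_gt0 : 0 < p. Proof. by apply: lt_le_trans hp0. Qed.

Let Tpow (a : R) : T `^ a = eps `^ (- (a / p)).
Proof. by rewrite /T -powRrM mulNr mulrC. Qed.

Let T2 : T `^ (2 - p) = eps `^ q.
Proof. by rewrite Tpow; congr powR; rewrite /q /p1bar -/p; field; rewrite gt_eqF. Qed.

Let T2e : T ^+ 2 * eps = eps `^ q.
Proof.
rewrite -powR_mulrn ?(ltW T0)// Tpow -[X in _ * X]powRr1 ?(ltW eps0)// -powRD ?(gt_eqF eps0)//.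
  by congr powR; rewrite /q /p1bar -/p addrC.
by apply/implyP.
Qed.

(** The quantity is [eps^(1 - 3/p)], whose exponent is nonnegative because [p >= 3]. *)
Let T3e : T ^+ 3 * eps <= 1.
Proof.
rewrite -powR_mulrn ?(ltW T0)// Tpow -[X in _ * X]powRr1 ?(ltW eps0)// -powRD ?(gt_eqF eps0)//.
  rewrite -[leRHS](powRr0 eps); apply: ger_powR; first by rewrite eps0.
  by rewrite addrC subr_ge0 ler_pdivrMr ?mul1r.
by apply/implyP.
Qed.

Definition truncation_cst : R := 2 * K + 4.

Theorem core_estimate h : lipschitz1 h ->
  `|Ex P (fun w => h (normalized_H hP xi lam w)) - normal_mean h| <=
  approx_cst * (((2 * L) ^ d)%:R * Num.sqrt (truncation_cst * eps `^ q) / sig +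
    ((2 * L) ^ d)%:R ^+ 2 * @local_error R d th0 th1 th2 L ms r T sig +
    ((2 * L) ^ d)%:R * (((4 * ms).+1 ^ d)%:R ^+ 2 * (block_cst (2 + K) / sig) ^+ 3)).
Proof.
move=> hl.
have nI : #|{: I}| = ((2 * L) ^ d)%N by rewrite card_ffun !card_ord.
have L0 : (0 < L)%N.
  by rewrite -(ltr_nat R); apply: le_lt_trans hL; rewrite mulr_ge0// powR_ge0.
have mY k : measurable_fun setT (Y k) by exact: measurable_local_value.
have mom k := truncated_moments (mX k) (mY k) hp0 T0 (fun w => lbT k _) (XK k) (Yerr k).
have tr0 : 0 < truncation_cst * eps `^ q by rewrite mulr_gt0 ?powR_gt0// /truncation_cst; have := K0; lra.
have fin : [/\ ('E_P[H hP xi lam] = (Ex P (H hP xi lam))%:E)%E &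
  Ex P (fun w => (H hP xi lam w - Ex P (H hP xi lam)) ^+ 2) = sig ^+ 2].
  have LH := L2_H; split; first by rewrite expectation_Ex//; case: LH.
  by rewrite /sig sqr_sqrtr variance_Ex//= Ex_ge0// => w; exact: sqr_ge0.
have HE : H hP xi lam = fun w => \sum_k X k w by apply/funext => w; exact: H_block_sum.
have [EH VH] := fin; rewrite HE in VH.
have -> : (fun w => h (normalized_H hP xi lam w)) =
  (fun w => h ((\sum_k X k w - Ex P (fun w => \sum_k X k w)) / sig)).
  by apply/funext => w; rewrite /normalized_H EH -/sig HE.
rewrite -nI.
(* The third-moment bound [2 + K] is [1 + K + T^3 eps] with the last term at most 1; the
   neighbourhoods are those of radii [ms] and [2 ms], the larger one having at most [(4 ms + 1)^d]
   cubes. *)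
apply: (@truncated_sum_normal_approx _ _ _ P I X Y (fun k => @near_cubes R d L k ms)
  (fun k => @near_cubes R d L k (2 * ms)) sig (Num.sqrt (truncation_cst * eps `^ q)) (2 + K) T
  (@local_error R d th0 th1 th2 L ms r T sig) ((4 * ms).+1 ^ d)) => //.
- by rewrite sqrtr_gt0.
- by rewrite addr_ge0.
- exact: local_error_ge0.
- by rewrite nI expn_gt0 muln_gt0 L0.
- move=> k w; exact: lbT.
- move=> k; have [_ e _] := mom k; apply: le_trans e _.
  rewrite sqr_sqrtr ?(ltW tr0)// -(mulrA 4) T2e T2 /truncation_cst; lra.
- move=> k; have [_ _ e] := mom k; apply: le_trans e _; have := T3e; lra.
- move=> k; apply/fintype.subsetP => j; rewrite !inE => /lt_le_trans; apply.
  by rewrite ler_nat leq_pmull.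
- move=> k; have := @card_near_cubes R d L k (2 * ms); rewrite mulnA; exact.
- move=> k f mf fC; exact: (local_far_mean hd h0 h1 h2 h3 hE r1 hms T0 sig0 mlb lbT hsep).
- move=> k j g kj mg gC; exact: (local_far_cov hd h0 h1 h2 h3 hE r1 hms T0 sig0 mlb lbT hsep).
- move=> k j kj; exact: (local_far_pair hd h0 h1 h2 h3 hE r1 hms T0 sig0 mlb lbT hsep).
Qed.

End core_estimate.

Hypothesis hEDD : EDD hP.
Variables (nu c : R) (nu0 : 0 < nu) (c0 : 0 < c).
Context {dQ : measure_display} {OmegaQ : measurableType dQ}.
Variables (Q : probability OmegaQ R) (Z : {RV Q >-> R}).
Hypothesis hZ : forall A : set R, measurable A -> distribution Q Z A = normal_prob 0 1 A.
Let q := p1bar p1 p2.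

(* [Var H = O(lam ^+ 2)] even gives [nu <= 2]. *)
Lemma variance_exponent_le (hvar : variance_lower_bound hP xi nu) : nu <= 6.
Proof.
have [b2 b20 hb2] := score_moment_bound.
have [b1 b10 hb1] := card_Gamma1_moment.
have K0 : 0 <= b2 * mu + b1 by rewrite addr_ge0// mulr_ge0.
case: hvar => c' c'0 [m [_ hm]]; rewrite leNgt; apply/negP => nu6.
pose B : R := (3 ^+ d) ^+ 2 * (1 + (b2 * mu + b1)).
have B0 : 0 <= B by rewrite mulr_ge0 ?sqr_ge0// addr_ge0.
pose lam := Num.max m 0 + 1 + B / c'.
have Bc0 : 0 <= B / c' by rewrite divr_ge0// ltW.
have mm : m <= Num.max m 0 by rewrite le_max lexx.
have m0 : 0 <= Num.max m 0 by rewrite le_max lexx orbT.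
have ml : m < lam by rewrite /lam; lra.
have l1 : 1 <= lam by rewrite /lam; lra.
have l0 : 0 < lam by lra.
have [L [hL nL Ll]] := grid_size hd l1.
have V := hm _ ml; rewrite (variance_Ex (L2_H b20 hb1 hb2 l0 hL)) lee_fin in V.
have := le_trans V (variance_le b20 hb1 hb2 l0 hL).
apply/negP; rewrite -ltNge.
apply: (@le_lt_trans _ _ (B * lam ^+ 2)).
  have -> : B * lam ^+ 2 = (3 ^+ d * lam) ^+ 2 * (1 + (b2 * mu + b1)) by rewrite /B exprMn; lra.
  apply: ler_wpM2r; first by rewrite addr_ge0.
  rewrite lerXn2r ?nnegrE//.
  by rewrite mulr_ge0 ?exprn_ge0// ltW.
have Bl : B < c' * lam.
  by rewrite -ltr_pdivrMl// mulrC /lam; lra.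
apply: (@lt_le_trans _ _ (c' * lam * lam ^+ 2)); first by rewrite ltr_pM2r ?exprn_gt0.
rewrite -mulrA ler_pM2l// -exprS -powR_mulrn ?(ltW l0)//.
by rewrite ler_powR//; lra.
Qed.

(** Common source of (a) and (b): [s] fixes the polynomial window allowed for [r] and [eps], and [e]
    the power of [lam] to which the dependence error is reduced. The constants are uniform in [lam],
    [r], [eps] and the short-range score. *)
Lemma wasserstein_estimate (s e : R) : 1 <= s -> 0 <= e ->
  exists K0 l0 K : R, [/\ 0 < K0, 1 <= l0, 0 < K &
    forall (lam r eps ph : R) (xihr : score_fun R d M), l0 <= lam ->
    ((c * lam `^ nu)%:E <= 'V_P[H hP xi lam])%E ->
    1 <= r -> K0 * ln lam <= r -> r <= lam `^ s -> lam `^ (- s) <= eps -> eps <= 1 ->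
    short_range hP r xihr -> 0 <= ph -> ph * mu <= eps ->
    (forall x : E, Gamma d lam x ->
      (palm x [set y | xi (x, y.1) y.2 (Gamma d lam) <> xihr (x, y.1) y.2 (Gamma d lam)] <=
       ph%:E)%E) ->
    (dW P (normalized_H hP xi lam) Q Z <=
     (K * (lam * eps `^ (q / 2) * lam `^ (- (nu / 2)) +
           lam * r ^+ (2 * d) * lam `^ (- (3 / 2) * nu) + lam `^ (- e)))%:E)%E].
Proof.
move=> s1 e0.
have [b2 b20 hb2] := score_moment_bound.
have [b1 b10 hb1] := card_Gamma1_moment.
have [th0 [th1 [th2 [th3 [h0 h1 h2 h3 hE]]]]] := hEDD.
have K0 : 0 <= b2 * mu + b1 by rewrite addr_ge0// mulr_ge0.
pose g := Num.sqrt c; have g0 : 0 < g by rewrite sqrtr_gt0.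
pose tc := truncation_cst b1 b2; pose b := block_cst (2 + (b2 * mu + b1)).
have tc0 : 0 <= tc by rewrite /tc /truncation_cst addr_ge0// mulr_ge0.
have b0 : 0 < b by apply: block_cst_gt0; rewrite addr_ge0.
pose lc := local_cst d th0 th1 g.
have lc0 : 0 <= lc.
  rewrite /lc /local_cst; have h1' := ltW h1; have C1 := stein_bound_ge1 R.
  apply: mulr_ge0; last by rewrite mulr_ge0 ?sqr_ge0.
  apply: mulr_ge0 => //; apply: mulr_ge0; last by lra.
  by rewrite addr_ge0 ?divr_ge0 ?sqr_ge0 ?(ltW g0).
pose A1 := 3 ^+ d * Num.sqrt tc / g; pose A2 := (3 ^+ d) ^+ 2 * lc.
pose A3 := 3 ^+ d * (37 ^+ d) ^+ 2 * (b / g) ^+ 3.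
have A10 : 0 <= A1 by rewrite divr_ge0 ?(ltW g0)// mulr_ge0 ?exprn_ge0 ?sqrtr_ge0.
have A20 : 0 <= A2 by rewrite mulr_ge0// sqr_ge0.
have A30 : 0 <= A3.
  apply: mulr_ge0; first by rewrite !mulr_ge0.
  by rewrite exprn_ge0// divr_ge0// ltW.
(* The first term ensures the separation required by the decay of dependence, the
   second one that [expR (- th2 * r)] absorbs all the powers of [lam]. *)
pose K2 := th3 * (s + 1) + (2 + 2 * s + 2 * s * th0 + e) / th2.
have K21 : th3 * (s + 1) <= K2.
  by rewrite lerDl divr_ge0 ?(ltW h2)// !addr_ge0// !mulr_ge0//; lra.
have K22 : 2 + (2 * s + 2 * s * th0 - th2 * K2) <= - e.
  have -> : th2 * K2 = th2 * (th3 * (s + 1)) + (2 + 2 * s + 2 * s * th0 + e).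
    by rewrite /K2; field; rewrite gt_eqF.
  have : 0 <= th2 * (th3 * (s + 1)) by rewrite !mulr_ge0 ?ltW//; lra.
  lra.
have K20 : 0 < K2 by apply: lt_le_trans K21; rewrite mulr_gt0//; lra.
have e1 : 1 <= expR 1 :> R by rewrite -[leLHS]expR0 ler_expR.
exists K2, (76 * d%:R + expR 1), (approx_cst * (A1 + A2 + A3 + 1)); split => //.
- by have : 0 <= d%:R :> R by []; lra.
- by rewrite mulr_gt0 ?approx_cst_gt0//; lra.
move=> lam r eps ph xihr ll hV r1 K0r rs seps eps1 hxih ph0 pheps hph.
have d0 : 0 <= d%:R :> R by [].
have l1 : 1 <= lam by lra.
have dl : 76 * d%:R <= lam by have := expR_gt0 (1 : R); lra.
have el : expR 1 <= lam by lra.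
have l0 : 0 < lam by lra.
have eps0 : 0 < eps by apply: lt_le_trans seps; rewrite powR_gt0.
have [L [hL nL Ll]] := grid_size hd l1; have [ms [hms mr]] := separation_size r1.
have LH := L2_H b20 hb1 hb2 l0 hL.
pose sig := Num.sqrt (fine 'V_P[H hP xi lam]).
have gsig : g * lam `^ (nu / 2) <= sig.
  have -> : g * lam `^ (nu / 2) = Num.sqrt (c * lam `^ nu).
    by rewrite sqrtrM ?(ltW c0)// -(powR12_sqrt (powR_ge0 _ _)) -powRrM.
  rewrite /sig ler_wsqrtr//; move: hV; rewrite variance_Ex// lee_fin//.
have nu1 : 1 <= lam `^ (nu / 2).
  by rewrite powR_ge1// divr_ge0// ltW.
have gs : g <= sig by apply: le_trans gsig; rewrite ler_peMr// ltW.
have sig0 : 0 < sig by apply: lt_le_trans gs.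
pose T := eps `^ (- (p0 p1 p2)^-1).
have T0 : 0 < T by exact: powR_gt0.
(* As [1 / p0 <= 1] and [eps <= 1], the level is at most [1 / eps]. *)
have Ts : T <= lam `^ s.
  rewrite /T powRN -[leRHS]invrK lef_pV2 ?posrE ?powR_gt0 ?invr_gt0 ?powR_gt0//.
  rewrite -powRN; apply: le_trans seps _; apply: ger1_powR; first by rewrite eps0.
  have p01 : 1 <= p0 p1 p2 by apply: le_trans hp0; rewrite ler1n.
  by rewrite invf_le1// (lt_le_trans ltr01 p01).
have hsep := separation_le h3 l1 s1 rs Ll mr dl el K21 K0r.
have key := core_estimate b10 b20 hb1 hb2 l0 hL h0 h1 h2 h3 hE r1 hms eps0 eps1 hxih ph0 pheps hph hsep sig0.
apply: dW_le => //.
  rewrite /normalized_H; under [X in L1 _ X]eq_fun do rewrite mulrC.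
  by apply: L1Z; apply: L1B; [case: LH|exact: L1_cst].
move=> h hl; apply: le_trans (key h hl) _; rewrite -[leRHS]mulrA.
apply: ler_wpM2l; first exact: ltW approx_cst_gt0.
have n0 : 0 <= ((2 * L) ^ d)%:R :> R by [].
have t1 := truncation_rate q g0 l0 eps0 tc0 n0 sig0 nL gsig.
have le0 : 0 <= @local_error R d th0 th1 th2 L ms r T sig.
  exact: local_error_ge0.
have t2 := dependence_rate l1 n0 nL le0
  (local_error_le d h0 h1 h2 l1 s1 rs g0 Ll mr T0 Ts gs K0r) lc0 K22.
have t3 := stein_rate d g0 l0 r1 n0 sig0 b0 nL mr gsig.
rewrite -/sig -/T -/q.
apply: le_trans (lerD (lerD t1 t2) t3) _; rewrite -/A1 -/A2 -/A3.
apply: sum_rates_le => //.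
- by rewrite mulr_ge0 ?powR_ge0// mulr_ge0 ?powR_ge0// ltW.
- rewrite mulr_ge0 ?powR_ge0// mulr_ge0 ?(ltW l0)// exprn_ge0//.
  exact: le_trans ler01 r1.
- exact: powR_ge0.
Qed.

End score_sums.

(** * Comparison of exponents and the final rates *)

Section exponents_and_logarithms.
Context {R : realType}.

Lemma p1bar_gt0 (p1 p2 : R) : 3 <= p0 p1 p2 -> 0 < p1bar p1 p2.
Proof.
move=> h; rewrite /p1bar subr_gt0 ltr_pdivrMr ?mul1r; lra.
Qed.

(** [ln y <= y] at [y = lam^(a/2)] uses half of the power; the threshold makes the other half exceed
    the constant [2 K / a]. *)
Lemma ln_le_powR (a K lam : R) : 0 < a -> 0 <= K -> (2 * K / a) `^ (2 / a) + 1 <= lam ->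
  K * ln lam <= lam `^ a.
Proof.
move=> a0 K0 h.
have l1 : 1 <= lam by have := powR_ge0 (2 * K / a) (2 / a); lra.
have l0 : 0 < lam by lra.
have hK : 2 * K / a <= lam `^ (a / 2).
  have h' : (2 * K / a) `^ (2 / a) <= lam by lra.
  have a2 : 0 <= a / 2 by lra.
  have := @ge0_ler_powR _ (a / 2) a2 _ _ (powR_ge0 _ _) (ltW l0) h'.
  rewrite -powRrM (_ : 2 / a * (a / 2) = 1) ?powRr1//.
    by rewrite divr_ge0 ?mulr_ge0// ltW.
  by field; rewrite gt_eqF.
have ll : ln lam <= 2 / a * lam `^ (a / 2).
  have := ln_sublinear (powR_gt0 (a / 2) l0); rewrite ln_powR => /ltW h1.
  have a2 : 0 < a / 2 by lra.
  rewrite -(ler_pM2l a2); apply: le_trans h1 _.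
  by rewrite mulrA (_ : a / 2 * (2 / a) = 1) ?mul1r//; field; rewrite gt_eqF.
apply: (@le_trans _ _ (K * (2 / a * lam `^ (a / 2)))); first by rewrite ler_wpM2l.
have -> : K * (2 / a * lam `^ (a / 2)) = (2 * K / a) * lam `^ (a / 2) by lra.
have -> : lam `^ a = lam `^ (a / 2) * lam `^ (a / 2).
  rewrite -powRD ?(gt_eqF l0) ?implybT//; congr powR; lra.
by rewrite ler_wpM2r// powR_ge0.
Qed.

(** In (b) the truncation term has the announced rate as soon as the second inequality holds. The
    first entry of the maximum gives [t (3 d + beta q) >= 3 d (nu + 2 + q)], hence the same lower
    bound for [t (4 d + beta q)]; it remains that [3 (nu + 2 + q) >= 4 nu], true for [nu <= 6]. *)
Lemma tau_ge (d : nat) (nu q beta : R) : (0 < d)%N -> 0 < q -> 0 < beta -> 0 < nu -> nu <= 6 ->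
  let t := tau d nu (d%:R * (2 + q)) (beta * q) in
  0 < t /\ nu <= t + t * (beta * q) / (4 * d%:R).
Proof.
move=> d0 q0 b0 nu0 nu6 t.
have D0 : 0 < d%:R :> R by rewrite ltr0n.
have g0 : 0 < beta * q by rewrite mulr_gt0.
have tD : 3 * d%:R * (nu + 2 + q) / (3 * d%:R + beta * q) <= t.
  rewrite /t /tau.
  have -> : 3 * d%:R * (nu + 2 + q) / (3 * d%:R + beta * q) =
    3 / 2 * ((2 * nu * d%:R + 2 * (d%:R * (2 + q))) / (3 * d%:R + beta * q)) by lra.
  by rewrite ler_pM2l// le_max lexx.
move: tD; move: (beta * q) t g0 => g t g0 tD.
have h3 : 0 < 3 * d%:R + g by lra.
have t0 : 0 < t by apply: lt_le_trans tD; rewrite divr_gt0// !mulr_gt0//; lra.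
split => //.
rewrite ler_pdivrMr// in tD.
have -> : t + t * g / (4 * d%:R) = t * (4 * d%:R + g) / (4 * d%:R) by field; rewrite gt_eqF.
rewrite ler_pdivlMr; last by lra.
have : 3 / 4 * (nu + 2 + q) * (4 * d%:R) <= t * (3 * d%:R + g) by lra.
have : 0 <= t * d%:R by rewrite mulr_ge0// ltW.
have : (nu * (4 * d%:R)) <= 3 / 4 * (nu + 2 + q) * (4 * d%:R) by rewrite ler_pM2r; lra.
lra.
Qed.

Lemma lt_threshold (m l0 a b c e lam : R) : 0 <= l0 -> 0 <= a -> 0 <= b -> 0 <= c -> 0 <= e ->
  Num.max m l0 + a + b + c + e < lam ->
  [/\ m < lam, l0 <= lam, a <= lam, b <= lam & c <= lam /\ e <= lam].
Proof.
have : m <= Num.max m l0 by rewrite le_max lexx.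
have : l0 <= Num.max m l0 by rewrite le_max lexx orbT.
by move: (Num.max m l0) => x ? ? ? ? ? ? ? ?; split; [..|split]; lra.
Qed.

Lemma log_rate_le (a b u v k y : R) : 0 <= y -> a <= y -> b <= y -> u <= v -> 1 <= v -> 0 <= k ->
  a + k * u * y + b <= (2 + k) * (v * y).
Proof.
move=> y0 ay bee uv v1 k0.
have : k * (u * y) <= k * (v * y) by rewrite ler_wpM2l// ler_wpM2r.
have : y <= v * y by rewrite ler_peMl.
lra.
Qed.

End exponents_and_logarithms.

Theorem corollary1p11 (R : realType) (d : nat) (hd : (0 < d)%N)
  (dM : measure_display) (M : measurableType dM)
  (dO : measure_display) (Omega : measurableType dO) (P : probability Omega R)
  (hP : {RV P >-> mconf R d M}) (hmarks : unique_marks hP)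
  (hstat : stationary hP)
  (mu : R) (hmu : 0 < mu) (hintensity : has_intensity hP mu)
  (palm : R.-pker (euclid R d) ~> (M * mconf R d M)%type)
  (hpalm : is_palm hP palm)
  (xi : score_fun R d M) (hxi : is_score xi)
  (p1 p2 : R) (hp1 : 1 <= p1) (hp2 : 1 <= p2) (hp0 : 3 <= p0 p1 p2)
  (hPmoment : point_moment hP p1)
  (hEDD : EDD hP)
  (hximoment : score_moment palm xi p2)
  (nu : R) (hnu : 2 / 3 < nu) (hvar : variance_lower_bound hP xi nu)
  (xih : R -> score_fun R d M)
  (hxih : forall r, 0 < r -> short_range hP r (xih r))
  (dQ : measure_display) (OmegaQ : measurableType dQ) (Q : probability OmegaQ R)
  (Z : {RV Q >-> R})
  (hZ : forall A : set R, measurable A -> distribution Q Z A = normal_prob 0 1 A) :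
  (exp_stabilization palm xi xih ->
    exists2 K : R, 0 < K & \forall lam \near +oo,
      (dW P (normalized_H hP xi lam) Q Z <=
       (K * (ln lam ^+ (3 * d) * lam `^ (- (3 / 2) * nu + 1)))%:E)%E)
  /\
  (forall beta : R, 0 < beta -> poly_stabilization palm xi xih beta ->
    exists2 K : R, 0 < K & \forall lam \near +oo,
      (dW P (normalized_H hP xi lam) Q Z <=
       (K * lam `^ (- (3 / 2) * nu + 1
                    + tau d nu (gamma0 d p1 p2) (gamma2 beta p1 p2)))%:E)%E).
Proof.
have nu0 : 0 < nu by lra.
have nu6 := variance_exponent_le hd hmarks hstat hintensity hpalm hxi hp1 hp2 hp0 (ltW hmu)
  hPmoment hximoment hvar.
have [c c0 [m [_ hm]]] := hvar.
pose q := p1bar p1 p2; have q0 : 0 < q := p1bar_gt0 hp0.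
have phi_le r ph : (phiPr palm xi xih r <= ph%:E)%E -> forall lam x, 0 < lam -> Gamma d lam x ->
    (palm x [set y | xi (x, y.1) y.2 (Gamma d lam) <> xih r (x, y.1) y.2 (Gamma d lam)] <=
     ph%:E)%E.
  move=> h lam x l0 lx; apply: le_trans h.
  by apply: ereal_sup_ubound; exists lam, x.
have nu_e : 0 <= 3 / 2 * nu by lra.
split.
  move=> [C1 [C2 [C10 C20 hph]]].
  (* With [eps = lam^(- s)] this gives [eps^(q/2) <= lam^(- nu)], which turns [lam^(- nu/2)] into
     the required [lam^(- 3 nu / 2)]. *)
  pose s := 1 + 2 * nu / q.
  have sq : nu <= s * (q / 2).
    have -> : s * (q / 2) = q / 2 + nu by rewrite /s; field; rewrite gt_eqF.
    by rewrite lerDr divr_ge0// ltW.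
  have s1 : 1 <= s by rewrite lerDl divr_ge0 ?mulr_ge0 ?ltW.
  have [K0 [l0 [K [K00 l01 Kp hmain]]]] := wasserstein_estimate hd hmarks hstat hintensity hpalm
    hxi hp1 hp2 hp0 (ltW hmu) hPmoment hximoment hEDD nu0 c0 hZ s1 nu_e.
  (* [K0] serves the decay of dependence; the increment makes the stabilization error of order
     [lam^(- s - 1)], the spare power of [lam] absorbing [C1 mu]. *)
  pose K1 := K0 + (s + 1) / C2.
  have K10 : K0 <= K1 by rewrite lerDl divr_ge0 ?(ltW C20)//; lra.
  have K1p : 0 < K1 by apply: lt_le_trans K10.
  exists (K * (2 + K1 ^+ (2 * d))).
    by rewrite mulr_gt0// addr_gt0// exprn_gt0.
  (* The summands ensure, in order, the variance bound and the estimate, [ln lam >= 1],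
     [K1 ln lam >= 1], [C1 mu <= lam], and [K1 ln lam <= lam]. *)
  pose l2 := Num.max m l0 + expR 1 + expR (K1^-1) + C1 * mu + ((2 * K1 / 1) `^ (2 / 1) + 1).
  exists l2; split; first by rewrite num_real.
  move=> lam ll.
  have l00 : 0 <= l0 by lra.
  have Cm : 0 <= C1 * mu by rewrite mulr_ge0 ?(ltW C10) ?ltW.
  have X0 : 0 <= (2 * K1 / 1) `^ (2 / 1) + 1 by rewrite addr_ge0 ?powR_ge0.
  have := lt_threshold l00 (expR_ge0 1) (expR_ge0 K1^-1) Cm X0 ll.
  case=> lm ll0 le1 leK [lC lK].
  have l1 : 1 <= lam by lra.
  have lp : 0 < lam by lra.
  have ln1 : 1 <= ln lam by rewrite -(expRK 1) ler_ln ?posrE ?expR_gt0.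
  have lnK : 1 <= K1 * ln lam.
    by rewrite -ler_pdivrMl// mulr1 -[leLHS]expRK ler_ln ?posrE ?expR_gt0.
  have rs : K1 * ln lam <= lam `^ s.
    apply: le_trans (ln_le_powR ltr01 (ltW K1p) lK) _; exact: ler_powR.
  have eps1 : lam `^ (- s) <= 1 by rewrite powRN invf_le1 ?powR_gt0// powR_ge1//; lra.
  have phle : C1 * expR (- C2 * (K1 * ln lam)) * mu <= lam `^ (- s).
    have -> : expR (- C2 * (K1 * ln lam)) = lam `^ (- (C2 * K1)).
      by rewrite /powR gt_eqF//; congr expR; lra.
    have : lam `^ (- (C2 * K1)) <= lam `^ (- s - 1).
      rewrite ler_powR//.
      have -> : C2 * K1 = C2 * K0 + (s + 1) by rewrite /K1; field; rewrite gt_eqF.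
      by have := mulr_gt0 C20 K00; lra.
    have -> : lam `^ (- s - 1) = lam `^ (- s) * lam^-1.
      by rewrite powRD ?(gt_eqF lp) ?implybT// powR_inv1// ltW.
    move=> h; apply: (@le_trans _ _ (C1 * mu * (lam `^ (- s) / lam))).
      by rewrite mulrAC ler_pM2l ?mulr_gt0.
    rewrite mulrCA ler_piMr ?powR_ge0// ler_pdivrMr ?mul1r//.
  have Vl := hm _ lm.
  apply: le_trans (hmain lam (K1 * ln lam) (lam `^ (- s)) _ (xih (K1 * ln lam)) ll0 Vl lnK _ rs
    (lexx _) eps1 (hxih _ _) _ phle _) _.
  - by rewrite ler_wpM2r//; lra.
  - by lra.
  - by rewrite mulr_ge0 ?expR_ge0// ltW.
  - move=> x; apply: phi_le => //; apply: hph; lra.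
  rewrite lee_fin -[leRHS]mulrA; apply: ler_wpM2l; first exact: ltW.
  pose y := lam `^ (- (3 / 2) * nu + 1); have y0 : 0 <= y by exact: powR_ge0.
  have f1 : lam * (lam `^ (- s)) `^ (q / 2) * lam `^ (- (nu / 2)) <= y.
    rewrite -{1}(powRr1 (ltW lp)) -powRrM -!powRD ?(gt_eqF lp) ?implybT//.
    by rewrite ler_powR//; lra.
  have f2 : lam * (K1 * ln lam) ^+ (2 * d) * lam `^ (- (3 / 2) * nu) =
      K1 ^+ (2 * d) * ln lam ^+ (2 * d) * y.
    rewrite exprMn /y powRD ?(gt_eqF lp) ?implybT// powRr1 ?(ltW lp)//; lra.
  have f3 : lam `^ (- (3 / 2 * nu)) <= y by rewrite ler_powR//; lra.
  (* The neighbourhoods produce the power [2 d] of the logarithm, which is at most the power [3 d]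
     as [ln lam >= 1]. *)
  have g1 : ln lam ^+ (2 * d) <= ln lam ^+ (3 * d) by rewrite ler_weXn2l// leq_mul2r orbT.
  have g2 : 1 <= ln lam ^+ (3 * d) by rewrite exprn_ege1.
  have g3 : 0 <= K1 ^+ (2 * d) by rewrite exprn_ge0// ltW.
  rewrite f2; exact: log_rate_le.
move=> beta b0 [C C0 hph].
rewrite /gamma0 /gamma2 -/q.
have [] := tau_ge hd q0 b0 nu0 nu6; rewrite -/q.
(* From here on the exponent enters only through its positivity and the inequality [ht]. *)
move: (tau _ _ _ _) => t t0 ht.
have D0 : 0 < d%:R :> R by rewrite ltr0n.
pose al := t / (2 * d%:R).
have al0 : 0 < al by rewrite divr_gt0// mulr_gt0.
have ab0 : 0 < al * beta by rewrite mulr_gt0.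
pose s := 1 + al + al * beta.
have s1 : 1 <= s by rewrite /s; lra.
have [K0 [l0 [K [K00 l01 Kp hmain]]]] := wasserstein_estimate hd hmarks hstat hintensity hpalm
    hxi hp1 hp2 hp0 (ltW hmu) hPmoment hximoment hEDD nu0 c0 hZ s1 nu_e.
(* The summand 1 keeps [eps] above [lam^(- s)], and [C mu] covers the probability of
   disagreement. *)
pose B := 1 + C * mu; have B1 : 1 <= B by rewrite /B lerDl mulr_ge0 ?ltW.
have B0 : 0 < B by lra.
exists (K * (2 + B `^ (q / 2))).
  by rewrite mulr_gt0// addr_gt0// powR_gt0.
(* The power of [B] ensures [eps <= 1], the last summand [K0 ln lam <= r]; the zero fills a slot of
   [lt_threshold]. *)
pose l2 := Num.max m l0 + 1 + B `^ (al * beta)^-1 + 0 + ((2 * K0 / al) `^ (2 / al) + 1).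
exists l2; split; first by rewrite num_real.
move=> lam ll.
have l00 : 0 <= l0 by lra.
have X0 : 0 <= (2 * K0 / al) `^ (2 / al) + 1 by rewrite addr_ge0 ?powR_ge0.
have := lt_threshold l00 ler01 (powR_ge0 B (al * beta)^-1) (lexx 0) X0 ll.
case=> lm ll0 _ lB [_ lK].
have l1 : 1 <= lam by lra.
have lp : 0 < lam by lra.
pose r := lam `^ al; pose eps := B * lam `^ (- (al * beta)).
have r1 : 1 <= r by rewrite powR_ge1// ltW.
have rs : r <= lam `^ s by rewrite ler_powR// /s; lra.
have seps : lam `^ (- s) <= eps.
  apply: (@le_trans _ _ (lam `^ (- (al * beta)))); first by rewrite ler_powR// /s; lra.
  by rewrite ler_peMl// powR_ge0.
have eps1 : eps <= 1.
  rewrite /eps powRN ler_pdivrMr ?powR_gt0// mul1r.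
  have := @ge0_ler_powR _ (al * beta) (ltW ab0) _ _ (powR_ge0 _ _) (ltW lp) lB.
  by rewrite -powRrM mulVf ?gt_eqF// powRr1// ltW.
have phle : C * r `^ (- beta) * mu <= eps.
  rewrite /r -powRrM mulrN /eps mulrAC ler_wpM2r ?powR_ge0// /B; lra.
have Vl := hm _ lm.
have K0r := ln_le_powR al0 (ltW K00) lK.
have rp : 0 < r by lra.
apply: le_trans (hmain lam r eps _ (xih r) ll0 Vl r1 K0r rs seps eps1 (hxih _ rp) _ phle _) _.
- by rewrite mulr_ge0 ?powR_ge0// ltW.
- move=> x; apply: phi_le => //; exact: hph.
rewrite lee_fin -[leRHS]mulrA; apply: ler_wpM2l; first exact: ltW.
pose y := lam `^ (- (3 / 2) * nu + 1 + t); have y0 : 0 <= y by exact: powR_ge0.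
(* Comparing exponents leaves [nu <= t + al beta q / 2], which is [ht] because [al = t / (2 d)]. *)
have f1 : lam * eps `^ (q / 2) * lam `^ (- (nu / 2)) <= B `^ (q / 2) * y.
  rewrite /eps powRM ?powR_ge0 ?(ltW B0)// -powRrM mulrCA -mulrA ler_wpM2l ?powR_ge0//.
  rewrite -{1}(powRr1 (ltW lp)) -!powRD ?(gt_eqF lp) ?implybT// ler_powR//.
  have e1 : al * beta * (q / 2) = t * (beta * q) / (4 * d%:R) by rewrite /al; field; rewrite gt_eqF.
  lra.
have f2 : lam * r ^+ (2 * d) * lam `^ (- (3 / 2) * nu) = y.
  rewrite /r -powR_mulrn ?powR_ge0// -powRrM -{1}(powRr1 (ltW lp)).
  rewrite -!powRD ?(gt_eqF lp) ?implybT//; congr powR.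
  by rewrite /al natrM; field; rewrite gt_eqF.
have f3 : lam `^ (- (3 / 2 * nu)) <= y by rewrite ler_powR//; lra.
rewrite f2 -/y; lra.
Qed.
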